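(* Let $Z$ be a Banach space with continuously varying symplectic structures $\omega(s)$, $s\in[0,1]$. Assume that $Z=X(s)\oplus Y(s)$ with two paths $\{X(s)\}_{s\in[0,1]}$ and $\{Y(s)\}_{s\in[0,1]}$ of closed subspaces such that $X(s)$ and $Y(s)$ are Lagrangian subspaces of $(Z,\omega(s))$. Let $\{(\lambda(s),\mu(s))\}_{s\in[0,1]}$ be a path of Fredholm pairs of index $0$ of Lagrangian subspaces of $(Z,\omega(s))$. Set $A(s):=\lambda(s)\cap Y(s)$ and $B(s):=\mu(s)\cap Y(s)$. Assume that $\{A(s)\}_{s\in[0,1]}$ and $\{B(s)\}_{s\in[0,1]}$ are two paths, and that $\dim Y(s)/(A(s)+B(s))<+\infty$ for each $s\in[0,1]$. View subspaces of $Z$ as linear relations from $X(s)$ to $Y(s)$, and for each $s\in[0,1]$ define the form $$Q(s)(x_1,x_2):=\omega(s)\bigl(x_1,(\lambda(s)-\mu(s))x_2\bigr),\qquad x_1,x_2\in\operatorname{dom}(\lambda(s))\cap\operatorname{dom}(\mu(s)).$$ Then $$\operatorname{Mas}_{\pm}\{\lambda(s),\mu(s);\,\omega(s),\,s\in[0,1]\}=\pm\dim(\lambda(0)\cap\mu(0)\cap Y(0))\mp\dim(\lambda(1)\cap\mu(1)\cap Y(1))\pm m^{\pm}(Q(1))\mp m^{\pm}(Q(0)).$$ Moreover, for each $s\in[0,1]$, $$\dim(\lambda(s)\cap\mu(s))=\dim\ker Q(s)+\dim (A(s)\cap B(s)).$$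
   Context: A symplectic form $\omega$ on a complex vector space is a non-degenerate sesquilinear form (linear in the first, conjugate-linear in the second variable) with $\omega(y,x)=-\overline{\omega(x,y)}$. On a Banach space it is moreover required to be bounded (the induced map to the dual need not be surjective). ''Continuously varying'': depending continuously on $s$ in the norm of bounded sesquilinear forms. For a subspace $\lambda$, $\lambda^\omega=\{x:\omega(x,y)=0\ \forall y\in\lambda\}$; $\lambda$ is Lagrangian if $\lambda=\lambda^\omega$. A pair $(\lambda,\mu)$ of subspaces of $Z$ is Fredholm if $\dim(\lambda\cap\mu)<\infty$ and $\dim Z/(\lambda+\mu)<\infty$, with index $\dim(\lambda\cap\mu)-\dim Z/(\lambda+\mu)$. A ''path'' of closed subspaces is a family continuous in the gap topology. $m^\pm(Q)$ denotes the positive/negative Morse index of a (Hermitian-)symmetric form. Linear relations: if $Z=X\oplus Y$, a subspace $\lambda\subset Z$ is a linear relation from $X$ to $Y$ with $\operatorname{dom}(\lambda)=\{x\in X:\exists y\in Y,\ x+y\in\lambda\}$ and $\lambda x=\{y\in Y:x+y\in\lambda\}$. $(\lambda-\mu)x=\{y-y':y\in\lambda x,\,y'\in\mu x\}$; the value $\omega(s)(x_1,(\lambda(s)-\mu(s))x_2)$ does not depend on the representative, and $Q(s)$ is symmetric. Maslov index. (i) Finite dimensional case: let $\alpha(s),\beta(s)$, $s\in[a,b]$, be continuous families of Lagrangian subspaces of a continuous family of finite dimensional symplectic spaces $(E(s),\sigma(s))$. Choose $a=t_0<\dots<t_N=b$ and on each $[t_{k-1},t_k]$ a continuous family of Lagrangian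 subspaces $L_k(s)$ with $L_k(s)\cap\alpha(s)=L_k(s)\cap\beta(s)=\{0\}$. Write $\alpha(s)=\{y+A_k(s)y:y\in\beta(s)\}$ with $A_k(s):\beta(s)\to L_k(s)$ and put $q_k(s)(x,y)=\sigma(s)(x,A_k(s)y)$, a Hermitian form on $\beta(s)$. Then $\operatorname{Mas}_+\{\alpha,\beta\}=\sum_k[m^+(q_k(t_k))-m^+(q_k(t_{k-1}))]$ and $\operatorname{Mas}_-\{\alpha,\beta\}=\sum_k[m^-(q_k(t_{k-1}))-m^-(q_k(t_k))]$; these do not depend on the choices. (ii) General case: for a path $(\lambda(s),\mu(s))$ of Fredholm pairs of index $0$ of Lagrangian subspaces of $(Z,\omega(s))$, each $t$ admits a finite dimensional $V_t$ with $Z=V_t\oplus(\lambda(t)+\mu(t))$; for $s$ near $t$ one has $V_t\cap\lambda(s)=V_t\cap\mu(s)=\{0\}$ and $Z=V_t+(V_t^{\omega(s)}\cap\lambda(s))+\mu(s)$, and with $W_s:=V_t+\lambda(s)$ (coisotropic, $W_s^{\omega(s)}=V_t^{\omega(s)}\cap\lambda(s)$) the reduced spaces $R(\eta):=(\eta\cap W_s+W_s^{\omega(s)})/W_s^{\omega(s)}$, $\eta=\lambda(s),\mu(s)$, are continuous families of Lagrangian subspaces of the finite dimensional symplectic spaces $W_s/W_s^{\omega(s)}$ (with the induced form). $\operatorname{Mas}_\pm\{\lambda(s),\mu(s);\omega(s)\}$ is the sum of the finite dimensional indices $\operatorname{Mas}_\pm$ of these reduced pairs over the intervals of a sufficiently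 fine partition; it is independent of the choices. *)

(* Defs.v *)
From HB Require Import structures.
From mathcomp Require Import all_boot all_order all_algebra.
From mathcomp Require Import all_classical all_reals all_analysis.
From mathcomp Require Export complex.
Set Implicit Arguments.
Unset Strict Implicit.
Unset Printing Implicit Defensive.
Import Order.TTheory GRing.Theory Num.Theory.
Import numFieldNormedType.Exports.
Local Open Scope classical_set_scope.
Local Open Scope ring_scope.

Section LinearAlgebra.
Variables (K : numFieldType) (Z : lmodType K).
Implicit Types (A B D N P : set Z).

Definition sumset A B : set Z := [set x + y | x in A & y in B].

Definition direct_sum A B : Prop :=
  A `&` B = [set 0] /\ sumset A B = [set: Z].

(* The classes of [b] form a basis of the quotient of [D] by [N]; plain bases
   are the case [N = [set 0]]. *)
Definition basis_mod n D N (b : 'I_n -> Z) : Prop :=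
  [/\ forall i, D (b i),
      forall c : 'I_n -> K, N (\sum_i c i *: b i) -> forall i, c i = 0
    & forall x, D x -> exists c : 'I_n -> K, N (x - \sum_i c i *: b i)].

Definition has_dim_mod D N (n : nat) : Prop :=
  exists b : 'I_n -> Z, basis_mod D N b.

Definition findim_mod D N : Prop := exists n, has_dim_mod D N n.

(* The dimension of D/N; the value 0 is only conventional when it is infinite. *)
Definition dim_mod D N : nat := xget 0%N [set n | has_dim_mod D N n].

Definition findim D : Prop := findim_mod D [set 0].
Definition sdim D : nat := dim_mod D [set 0].

Definition fredholm_pair A B : Prop :=
  findim (A `&` B) /\ findim_mod [set: Z] (sumset A B).

Definition fredholm_index A B : int :=
  (sdim (A `&` B))%:Z - (dim_mod [set: Z] (sumset A B))%:Z.

(* Linear relations from X to Y, for subspaces l, m of the direct sum of X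
   and Y. *)
Definition rel_dom (X Y l : set Z) : set Z :=
  [set x | X x /\ exists2 y, Y y & l (x + y)].

Definition rel_val (Y l : set Z) (x : Z) : set Z :=
  [set y | Y y /\ l (x + y)].

Definition rel_diff (Y l m : set Z) (x : Z) : set Z :=
  [set y - y' | y in rel_val Y l x & y' in rel_val Y m x].

Implicit Types (om q : Z -> Z -> K).

Definition annihilator om A : set Z :=
  [set x | forall y, A y -> om x y = 0].

Definition lagrangian om A : Prop := A = annihilator om A.

(* The value does not depend on the representative selected by [xget]. *)
Definition rel_form om (Y l m : set Z) : Z -> Z -> K :=
  fun x1 x2 => om x1 (xget 0 (rel_diff Y l m x2)).

Definition form_ker D q : set Z :=
  [set x | D x /\ forall y, D y -> q y x = 0].

End LinearAlgebra.

Section Morse.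
Variables (K : numFieldType) (Z : lmodType K).
Implicit Types (D N P : set Z) (q : Z -> Z -> K).

(* The form induced by (-1)^neg q on P/N is positive definite; recall that
   0 < z in K means that z is real and positive. *)
Definition definite_mod (neg : bool) q P N : Prop :=
  forall x, P x -> ~ N x -> 0 < (-1) ^+ neg * q x x.

Definition has_definite_dim neg D N q (n : nat) : Prop :=
  exists P : set Z,
    [/\ submod_closed (mem P), N `<=` P, P `<=` D, has_dim_mod P N n
      & definite_mod neg q P N].

(* Morse index m^+ (neg = false) or m^- (neg = true) of the form induced by q
   on D/N. *)
Definition morse_mod neg D N q : nat :=
  xget 0%N [set n | has_definite_dim neg D N q n /\
    forall n', has_definite_dim neg D N q n' -> (n' <= n)%N].

Definition morse neg D q : nat := morse_mod neg D [set 0] q.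

End Morse.

Section Continuity.
Variables (R : realType) (Z : normedModType R[i]).
Implicit Types (M N : set Z) (om : Z -> Z -> R[i]).

(* The norm of V has its values in R[i]; they are real. *)
Definition rnorm (V : normedZmodType R[i]) (x : V) : R := complex.Re `|x|.

Definition dist (x : Z) N : R := inf [set rnorm (x - y) | y in N].

(* sup set0 = 0, which is the usual convention when M is the null space. *)
Definition semigap M N : R :=
  sup [set dist x N | x in [set x | M x /\ rnorm x = 1]].

Definition gap M N : R := Num.max (semigap M N) (semigap N M).

Definition subspace_path (a b : R) (M : R -> set Z) : Prop :=
  (forall s, s \in `[a, b] -> submod_closed (mem (M s)) /\ closed (M s)) /\
  (forall s, s \in `[a, b] ->
     gap (M t) (M s) @[t --> within `[a, b] (nbhs s)] --> (0 : R)).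

Definition form_bounded om : Prop :=
  exists C : R, forall x y, rnorm (om x y) <= C * rnorm x * rnorm y.

Definition form_norm om : R :=
  sup [set rnorm (om u.1 u.2) | u in
         [set u : Z * Z | rnorm u.1 <= 1 /\ rnorm u.2 <= 1]].

(* To be used for om : {hermitian Z for true & Num.conj}, i.e. for a
   skew-Hermitian form, conjugate-linear in the second variable. *)
Definition symplectic om : Prop :=
  form_bounded om /\ forall x, (forall y, om x y = 0) -> x = 0.

Definition form_path (a b : R) (om : R -> Z -> Z -> R[i]) : Prop :=
  forall s, s \in `[a, b] ->
    form_norm (fun x y => om t x y - om s x y)
      @[t --> within `[a, b] (nbhs s)] --> (0 : R).

Definition time_partition (a b : R) (n : nat) (t : nat -> R) : Prop :=
  [/\ t 0%N = a, t n = b & forall k, (k < n)%N -> t k < t k.+1].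

End Continuity.

(* Finite dimensional Maslov index, for the spaces E(s) = W(s)/N(s) with the
   form induced by om(s).  A subspace of W/N is represented by its preimage in
   W, i.e. by an intermediate subspace between N and W; accordingly the null
   subspace of W/N is represented by N, and a family of subspaces of
   W(s)/N(s) is continuous if the preimages are gap-continuous. *)
Section FiniteMaslov.
Variables (R : realType) (Z : normedModType R[i]).
Implicit Types (W N al be L : R -> set Z).

Definition fd_symplectic_path (a b : R) (om : R -> Z -> Z -> R[i]) W N : Prop :=
  [/\ form_path a b om, subspace_path a b W, subspace_path a b N &
      forall s, s \in `[a, b] ->
        [/\ N s `<=` W s, findim_mod (W s) (N s)
          & W s `&` annihilator (om s) (W s) = N s]].

Definition fd_lagrangian_path (a b : R) (om : R -> Z -> Z -> R[i]) W N L : Prop :=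
  subspace_path a b L /\
  forall s, s \in `[a, b] ->
    [/\ N s `<=` L s, L s `<=` W s
      & L s = W s `&` annihilator (om s) (L s)].

(* al/N is the graph {y + A y : y in be/N} of a linear map A : be/N -> L/N;
   [graph_map al L y] is a representative of A y. *)
Definition graph_map (al L : set Z) (y : Z) : Z :=
  xget 0 [set z | L z /\ al (y + z)].

Definition graph_form (om : Z -> Z -> R[i]) (al L : set Z) : Z -> Z -> R[i] :=
  fun x y => om x (graph_map al L y).

(* Mas_+ (neg = false) is the sum of the m^+(q_k(t_k)) - m^+(q_k(t_{k-1})),
   Mas_- (neg = true) is the sum of the m^-(q_k(t_{k-1})) - m^-(q_k(t_k)). *)
Definition is_maslov_fd (neg : bool) (a b : R) (om : R -> Z -> Z -> R[i])
    W N al be (m : int) : Prop :=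
  [/\ fd_symplectic_path a b om W N,
      fd_lagrangian_path a b om W N al,
      fd_lagrangian_path a b om W N be &
  exists (n : nat) (t : nat -> R) (L : nat -> R -> set Z),
    let q k s := graph_form (om s) (al s) (L k s) in
    let ind k s := (morse_mod neg (be s) (N s) (q k s))%:Z in
    [/\ time_partition a b n t,
        forall k, (k < n)%N ->
          fd_lagrangian_path (t k) (t k.+1) om W N (L k) /\
          forall s, s \in `[t k, t k.+1] ->
            L k s `&` al s = N s /\ L k s `&` be s = N s
      & m = \sum_(k < n) (-1) ^+ neg * (ind k (t k.+1) - ind k (t k))]].

End FiniteMaslov.

Section Maslov.
Variables (R : realType) (Z : normedModType R[i]).
Implicit Types (V W N eta : set Z) (lam mu : R -> set Z).

(* Preimage in W of the reduction of eta in W/N, where N is the annihilator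
   of W. *)
Definition reduction W N eta : set Z := sumset (eta `&` W) N.

Definition reducing (om : Z -> Z -> R[i]) V (l m : set Z) : Prop :=
  [/\ V `&` l = [set 0], V `&` m = [set 0]
    & sumset (sumset V (annihilator om V `&` l)) m = [set: Z]].

(* [is_maslov neg a b om lam mu m]: m is obtained as Mas_+ (neg = false) or
   Mas_- (neg = true) of the path (lam, mu) on [a, b], for some choice of a
   fine partition t and of the finite dimensional spaces V k. *)
Definition is_maslov (neg : bool) (a b : R) (om : R -> Z -> Z -> R[i])
    lam mu (m : int) : Prop :=
  exists (n : nat) (t : nat -> R) (V : nat -> set Z) (c : nat -> int),
    let W k s := sumset (V k) (lam s) in
    let N k s := annihilator (om s) (W k s) in
    [/\ time_partition a b n t,
        forall k, (k < n)%N ->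
          [/\ submod_closed (mem (V k)), findim (V k),
              exists2 tau, tau \in `[t k, t k.+1] &
                direct_sum (V k) (sumset (lam tau) (mu tau)),
              forall s, s \in `[t k, t k.+1] ->
                reducing (om s) (V k) (lam s) (mu s)
            & is_maslov_fd neg (t k) (t k.+1) om (W k) (N k)
                (fun s => reduction (W k s) (N k s) (lam s))
                (fun s => reduction (W k s) (N k s) (mu s)) (c k)]
      & m = \sum_(k < n) c k].

Definition is_maslov_plus := is_maslov false.
Definition is_maslov_minus := is_maslov true.

End Maslov.

(* Main.v *)
Require Import Defs.
From HB Require Import structures.
From mathcomp Require Import all_boot all_order all_algebra.
From mathcomp Require Import all_classical all_reals all_analysis complex.
From mathcomp Require Import zify ring lra.
Set Implicit Arguments.
Unset Strict Implicit.
Unset Printing Implicit Defensive.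
Import Order.TTheory GRing.Theory Num.Theory.
Import numFieldNormedType.Exports.
Local Open Scope classical_set_scope.
Local Open Scope ring_scope.

(* The Hermitian form q((l, m), (l', m')) = (om(m, l') - om(l, m')) / 2 on lam x mu,
   restricted to E = {(l, m) : l - m in Y}, is the pull-back of Q, so that the Morse
   indices of Q are those of q on E.  Set a = m(Q) - dim (lam /\ mu /\ Y).  Near a time
   s0, a maximal definite subspace for q at s0, together with the part of lam /\ mu on
   which the crossing at s0 becomes definite, is transported into E at time s: a family
   of pairs with differences in a complement of lam + mu is corrected by bounded amounts
   so that the differences enter Y.  This bounds a(s) - a(s0) from below, for both signs,
   by numbers depending on lam, mu and om only; the sum of the two indices being
   prescribed by the dimensions up to a semicontinuous term, the bounds are equalities.
   Hence the variation of a is the same for any other Lagrangian path with a Lagrangian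
   complement in the role of Y, in particular for the complement L of the reductions of
   lam and mu which defines the finite dimensional index: there (Y, X) becomes (L, mu)
   and the corresponding a is the Morse index of the form q_k.  A Cousin argument on
   [0, 1] gives the formula.  Partitions exist because, if V complements lam + mu at s0
   and W = V + lam, the set of the v + l in W with om(v', v + 2 l) = 0 for all v' in V
   is, near s0, a continuous Lagrangian complement of both reductions. *)

(** * Linear algebra modulo a subspace *)

(** Two obstacles shape the proof. The domain of [Q(s)] and the subspaces [A + B] and [A /\ B] may
    jump although [A] and [B] vary continuously, so [Q] cannot be treated as a continuous family of
    forms; hence the fixed formula on [lam x mu] and the bookkeeping with [j = dim A /\ B] and
    [k = dim Y/(A + B)]. And [om(s)] need not identify [Z] with its dual, so a double annihilator
    can be too large; the cases required are recovered by comparing finite dimensions, where the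
    vanishing of the index enters. Let p, n be the two indices at a time near s0, with a zero
    appended for the values at s0, and let g+, g- count the positive and negative directions that
    emerge from [lam /\ mu]. Adding p - j >= p0 - j0 + g+, n - j >= n0 - j0 + g-, p + n = k + j - d,
    k - k0 <= j - j0 and d0 - d <= g+ + g- shows that none of them is strict. The perturbation
    arguments rest on one tool: if closed subspaces sum to [Z], nearby ones still do, with a uniform
    bound on the summands. *)

Section Subspaces.
Variables (K : numFieldType) (Z : lmodType K).
Implicit Types (A B D N M : set Z).

Definition lin_sub A : Prop := A 0 /\ forall a x y, A x -> A y -> A (a *: x + y).

Lemma lin_subP A : submod_closed (mem A) <-> lin_sub A.
Proof.
split=> [[A0 AD]|[A0 AD]].
  split; first by move: A0; rewrite inE.
  by move=> a x y Ax Ay; have := AD a x y; rewrite !inE; apply.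
split; first by rewrite inE.
by move=> a x y; rewrite !inE; exact: AD.
Qed.

Lemma sub0 A : lin_sub A -> A 0. Proof. by case. Qed.

Lemma subD A x y : lin_sub A -> A x -> A y -> A (x + y).
Proof. by move=> [_ h] Ax Ay; have := h 1 x y Ax Ay; rewrite scale1r. Qed.

Lemma subZ A a x : lin_sub A -> A x -> A (a *: x).
Proof. by move=> [A0 h] Ax; have := h a x 0 Ax A0; rewrite addr0. Qed.

Lemma subN A x : lin_sub A -> A x -> A (- x).
Proof. by move=> sA Ax; rewrite -scaleN1r; exact: subZ. Qed.

Lemma subB A x y : lin_sub A -> A x -> A y -> A (x - y).
Proof. by move=> sA Ax Ay; apply: subD => //; exact: subN. Qed.

Lemma sub_sum A I (r : seq I) (P : pred I) (F : I -> Z) :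
  lin_sub A -> (forall i, P i -> A (F i)) -> A (\sum_(i <- r | P i) F i).
Proof.
move=> sA h; elim/big_ind: _ => //; first exact: sub0.
by move=> x y; exact: subD.
Qed.

Lemma lin_subI A B : lin_sub A -> lin_sub B -> lin_sub (A `&` B).
Proof.
move=> sA sB; split; first by split; exact: sub0.
by move=> a x y [Ax Bx] [Ay By]; split; apply: subD => //; exact: subZ.
Qed.

Lemma lin_subT : lin_sub [set: Z]. Proof. by []. Qed.

Lemma lin_sub0 : lin_sub ([set 0] : set Z).
Proof. by split=> // a x y /= -> ->; rewrite scaler0 addr0. Qed.

Lemma lin_sub_sumset A B : lin_sub A -> lin_sub B -> lin_sub (sumset A B).
Proof.
move=> sA sB; split.
  by exists 0; [exact: sub0|exists 0; [exact: sub0|rewrite addr0]].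
move=> a x y [x1 Ax1 [x2 Bx2 <-]] [y1 Ay1 [y2 By2 <-]].
exists (a *: x1 + y1); first by apply: subD => //; exact: subZ.
exists (a *: x2 + y2); first by apply: subD => //; exact: subZ.
by rewrite scalerDr addrACA.
Qed.

Lemma sumset_l A B : lin_sub B -> A `<=` sumset A B.
Proof. by move=> sB x Ax; exists x => //; exists 0; [exact: sub0|rewrite addr0]. Qed.

Lemma sumset_r A B : lin_sub A -> B `<=` sumset A B.
Proof. by move=> sA x Bx; exists 0; [exact: sub0|exists x => //; rewrite add0r]. Qed.

Lemma sumset_sub A B D : lin_sub D -> A `<=` D -> B `<=` D -> sumset A B `<=` D.
Proof. by move=> sD AD BD x [a /AD Da [b /BD Db <-]]; exact: subD. Qed.

Lemma sub_eqv A x y : lin_sub A -> A (x - y) -> A x <-> A y.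
Proof.
move=> sA h; split=> [Ax|Ay]; last by rewrite -(subrK y x); exact: subD.
by rewrite -[y]opprK -[- y](addKr x) opprD opprK; apply: subB => //; rewrite addrC.
Qed.

End Subspaces.

Section LinearCombinations.
Variables (K : numFieldType) (Z : lmodType K).
Implicit Types (A B D N M : set Z).

Definition lc n (c : 'rV[K]_n) (b : 'I_n -> Z) : Z := \sum_i c 0 i *: b i.

Lemma lcP n a (c c' : 'rV[K]_n) (b : 'I_n -> Z) :
  lc (a *: c + c') b = a *: lc c b + lc c' b.
Proof.
rewrite /lc scaler_sumr -big_split /=; apply: eq_bigr => i _.
by rewrite !mxE scalerDl scalerA.
Qed.

Lemma lc0 n (b : 'I_n -> Z) : lc 0 b = 0.
Proof. by rewrite /lc big1 // => i _; rewrite mxE scale0r. Qed.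

Lemma lcZ n a (c : 'rV[K]_n) (b : 'I_n -> Z) : lc (a *: c) b = a *: lc c b.
Proof. by have := lcP a c 0 b; rewrite !addr0 lc0 addr0. Qed.

Lemma lcD n (c c' : 'rV[K]_n) (b : 'I_n -> Z) : lc (c + c') b = lc c b + lc c' b.
Proof. by have := lcP 1 c c' b; rewrite !scale1r. Qed.

Lemma lcN n (c : 'rV[K]_n) (b : 'I_n -> Z) : lc (- c) b = - lc c b.
Proof. by rewrite -(scaleN1r c) lcZ scaleN1r. Qed.

Lemma lcB n (c c' : 'rV[K]_n) (b : 'I_n -> Z) : lc (c - c') b = lc c b - lc c' b.
Proof. by rewrite lcD lcN. Qed.

Lemma lc_addf n (c : 'rV[K]_n) (b b' : 'I_n -> Z) :
  lc c (fun i => b i + b' i) = lc c b + lc c b'.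
Proof. by rewrite /lc -big_split; apply: eq_bigr => i _; rewrite scalerDr. Qed.

Lemma lc_oppf n (c : 'rV[K]_n) (b : 'I_n -> Z) :
  lc c (fun i => - b i) = - lc c b.
Proof. by rewrite /lc -sumrN; apply: eq_bigr => i _; rewrite scalerN. Qed.

Lemma lc_subf n (c : 'rV[K]_n) (b b' : 'I_n -> Z) :
  lc c (fun i => b i - b' i) = lc c b - lc c b'.
Proof. by rewrite lc_addf lc_oppf. Qed.

Lemma lc_mul m n (c : 'rV[K]_m) (C : 'M[K]_(m, n)) (b : 'I_n -> Z) :
  lc (c *m C) b = lc c (fun i => lc (row i C) b).
Proof.
rewrite /lc; under eq_bigr do rewrite mxE scaler_suml.
rewrite exchange_big /=; apply: eq_bigr => i _; rewrite scaler_sumr.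
by apply: eq_bigr => j _; rewrite mxE scalerA.
Qed.

Lemma lc_delta n i (b : 'I_n -> Z) : lc (delta_mx 0 i) b = b i.
Proof.
rewrite /lc (bigD1 i) //= mxE !eqxx scale1r big1 ?addr0 // => j jNi.
by rewrite mxE eqxx (negbTE jNi) scale0r.
Qed.

Lemma sub_lc A n (c : 'rV[K]_n) (b : 'I_n -> Z) :
  lin_sub A -> (forall i, A (b i)) -> A (lc c b).
Proof. by move=> sA h; apply: sub_sum => // i _; apply: subZ. Qed.

Definition cat_fam m n (b : 'I_m -> Z) (b' : 'I_n -> Z) (i : 'I_(m + n)) : Z :=
  match fintype.split i with inl j => b j | inr j => b' j end.

Lemma lc_cat m n (c : 'rV[K]_(m + n)) (b : 'I_m -> Z) (b' : 'I_n -> Z) :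
  lc c (cat_fam b b') = lc (lsubmx c) b + lc (rsubmx c) b'.
Proof.
rewrite /lc big_split_ord /=; congr (_ + _); apply: eq_bigr => i _; rewrite mxE /cat_fam.
  by rewrite -[lshift _ _]/(unsplit (inl i)) unsplitK.
by rewrite -[rshift _ _]/(unsplit (inr i)) unsplitK.
Qed.

Lemma cat_famP m n (b : 'I_m -> Z) (b' : 'I_n -> Z) (P : set Z) :
  (forall i, P (b i)) -> (forall i, P (b' i)) -> forall i, P (cat_fam b b' i).
Proof. by move=> h h' i; rewrite /cat_fam; case: fintype.split. Qed.

Definition indep_mod n N (b : 'I_n -> Z) : Prop := forall c, N (lc c b) -> c = 0.

Definition spans_mod n D N (b : 'I_n -> Z) : Prop :=
  (forall i, D (b i)) /\ forall x, D x -> exists c, N (x - lc c b).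

Lemma has_dim_modP D N n : has_dim_mod D N n <->
  exists b : 'I_n -> Z, spans_mod D N b /\ indep_mod N b.
Proof.
have E (c : 'I_n -> K) b : \sum_i c i *: b i = lc (\row_i c i) b.
  by apply: eq_bigr => i _; rewrite mxE.
split=> [[b [h1 h2 h3]]|[b [[h1 h3] h2]]]; exists b; split => //.
- split=> // x Dx; have [c Hc] := h3 _ Dx; exists (\row_i c i).
  by rewrite -E.
- by move=> c Hc; apply/rowP=> i; rewrite mxE (h2 (fun i => c 0 i)).
- by move=> c; rewrite E => /h2 /rowP c0 i; have := c0 i; rewrite !mxE.
- move=> x Dx; have [c Hc] := h3 _ Dx; exists (fun i => c 0 i).
  by rewrite E; congr N: Hc; congr (_ - lc _ _); apply/rowP => i; rewrite mxE.
Qed.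

Lemma row_free_kernel m n (C : 'M[K]_(m, n)) :
  (forall c : 'rV_m, c *m C = 0 -> c = 0) -> row_free C.
Proof.
move=> h; rewrite -kermx_eq0; apply/eqP/row_matrixP => i.
by rewrite row0; apply: h; rewrite -row_mul mulmx_ker row0.
Qed.

(** The coordinates of [e] in the spanning family form a row free matrix: a relation between its
    rows is a combination of [e] lying in [N]. *)
Lemma steinitz D N m n (b : 'I_n -> Z) (e : 'I_m -> Z) :
  lin_sub N -> spans_mod D N b -> (forall i, D (e i)) -> indep_mod N e -> (m <= n)%N.
Proof.
move=> sN [Db bD] De ie.
have /choice [C HC] : forall i, exists c, N (e i - lc c b) by move=> i; exact: bD.
have : row_free (\matrix_i C i).
  apply: row_free_kernel => c c0; apply: ie.
  have c1 : lc c e = lc c e - lc (c *m (\matrix_i C i)) b by rewrite c0 lc0 subr0.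
  rewrite c1 lc_mul -lc_subf; apply: sub_lc => // i; rewrite rowK; exact: HC.
by rewrite /row_free => /eqP <-; exact: rank_leq_col.
Qed.

(** A maximal independent family spans: adjoining one more vector produces a relation in which the
    coefficient of that vector is nonzero. *)
Lemma exists_basis D N n : lin_sub D -> lin_sub N ->
  (forall m (e : 'I_m -> Z), (forall i, D (e i)) -> indep_mod N e -> (m <= n)%N) ->
  exists2 m, (m <= n)%N & has_dim_mod D N m.
Proof.
move=> sD sN h.
pose P m := `[< exists2 e : 'I_m -> Z, forall i, D (e i) & indep_mod N e >].
have P0 : exists m, P m.
  exists 0%N; apply/asboolP; exists (fun=> 0) => [[]//|c _].
  by apply/rowP => -[].
have Pn m : P m -> (m <= n)%N by move=> /asboolP[e]; exact: h.
case: (ex_maxnP P0 Pn) => m /asboolP[e De ie] mmax.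
exists m; first exact: Pn (asboolT (ex_intro2 _ _ e De ie)).
apply/has_dim_modP; exists e; split => //; split => // x Dx.
have nP : ~ P (m + 1)%N by move=> /mmax; rewrite addn1 ltnn.
have : ~ indep_mod N (cat_fam e (fun _ : 'I_1 => x)).
  move=> ic; apply: nP; apply/asboolP; exists (cat_fam e (fun _ : 'I_1 => x)) => //.
  exact: cat_famP.
move=> /existsNP[c /not_implyP[Nc c0]].
move: Nc; rewrite lc_cat {2}/lc big_ord1.
set a := rsubmx c 0 0; set c' := lsubmx c => Nc.
have aN0 : a != 0.
  apply/eqP => a0; apply: c0; rewrite -(hsubmxK c) -/c'.
  move: Nc; rewrite a0 scale0r addr0 => /ie ->.
  suff -> : rsubmx c = 0 by rewrite row_mx0.
  by apply/rowP => i; rewrite ord1 -/a a0 mxE.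
exists (- a^-1 *: c'); rewrite lcZ scaleNr opprK.
have := subZ a^-1 sN Nc; rewrite scalerDr scalerA mulVf // scale1r.
by rewrite addrC.
Qed.

Lemma dim_uniq D N m n : lin_sub N ->
  has_dim_mod D N m -> has_dim_mod D N n -> m = n.
Proof.
move=> sN /has_dim_modP[b [sb ib]] /has_dim_modP[b' [sb' ib']].
apply/eqP; rewrite eqn_leq.
by rewrite (steinitz sN sb' sb.1 ib) (steinitz sN sb sb'.1 ib').
Qed.

Lemma dim_modE D N n : lin_sub N -> has_dim_mod D N n -> dim_mod D N = n.
Proof.
move=> sN h; rewrite /dim_mod; case: xgetP => [m _ hm|/(_ n)//].
exact: dim_uniq hm h.
Qed.

Lemma has_dim0 D : lin_sub D -> has_dim_mod D D 0.
Proof.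
move=> sD; apply/has_dim_modP; exists (fun=> 0); split.
  split; [by case|move=> x Dx; exists 0; rewrite lc0 subr0].
  by [].
by move=> c _; apply/rowP => -[].
Qed.

Lemma dim_sub D D' N n : lin_sub D -> lin_sub N -> D `<=` D' ->
  has_dim_mod D' N n -> exists2 m, (m <= n)%N & has_dim_mod D N m.
Proof.
move=> sD sN DD' /has_dim_modP[b [sb ib]]; apply: exists_basis => // m e De ie.
by apply: (steinitz sN sb _ ie) => i; exact: DD'.
Qed.

Lemma dim_quot D N N' n : lin_sub D -> lin_sub N -> lin_sub N' -> N `<=` N' ->
  has_dim_mod D N n -> exists2 m, (m <= n)%N & has_dim_mod D N' m.
Proof.
move=> sD sN sN' NN' /has_dim_modP[b [sb ib]]; apply: exists_basis => // m e De ie.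
by apply: (steinitz sN sb De) => c /NN' /ie.
Qed.

Lemma dim_add D M N a b : lin_sub N -> lin_sub M -> N `<=` M -> M `<=` D ->
  has_dim_mod D M a -> has_dim_mod M N b -> has_dim_mod D N (a + b).
Proof.
move=> sN sM NM MD /has_dim_modP[e [[De se] ie]] /has_dim_modP[f [[Mf sf] jf]].
apply/has_dim_modP; exists (cat_fam e f); split; first split.
- by apply: cat_famP => // i; exact: MD.
- move=> x /se[c Mc]; have [c' Nc'] := sf _ Mc.
  exists (row_mx c c'); rewrite lc_cat row_mxKl row_mxKr opprD addrA.
  exact: Nc'.
- move=> c; rewrite lc_cat -{3}(hsubmxK c) => Nc.
  have l0 : lsubmx c = 0.
    apply: ie; rewrite -[lc _ e](addrK (lc (rsubmx c) f)).
    by apply: subB => //; [exact: NM|exact: sub_lc].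
  move: Nc; rewrite l0 lc0 add0r => /jf ->.
  by rewrite row_mx0.
Qed.

Lemma dim_split D M N n : lin_sub D -> lin_sub M -> lin_sub N ->
    N `<=` M -> M `<=` D -> has_dim_mod D N n ->
  exists a b, [/\ has_dim_mod D M a, has_dim_mod M N b & (a + b)%N = n].
Proof.
move=> sD sM sN NM MD h.
have [a _ ha] := dim_quot sD sN sM NM h.
have [b _ hb] := dim_sub sM sN MD h.
by exists a, b; split => //; apply: (dim_uniq sN (dim_add sN sM NM MD ha hb) h).
Qed.

Lemma dim_le_indep D N n m (e : 'I_m -> Z) : lin_sub N -> has_dim_mod D N n ->
  (forall i, D (e i)) -> indep_mod N e -> (m <= n)%N.
Proof. by move=> sN /has_dim_modP[b [sb _]]; exact: (steinitz sN sb). Qed.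

Lemma dim0_eq D N : lin_sub N -> has_dim_mod D N 0 -> D `<=` N.
Proof.
move=> sN /has_dim_modP[b [[_ h] _]] x /h[c].
by rewrite /lc big_ord0 subr0.
Qed.

Lemma dim_eq_sub D D' N n : lin_sub D -> lin_sub D' -> lin_sub N ->
  N `<=` D -> D `<=` D' -> has_dim_mod D N n -> has_dim_mod D' N n -> D' `<=` D.
Proof.
move=> sD sD' sN ND DD' h h'.
have [a [b [ha hb E]]] := dim_split sD' sD sN ND DD' h'.
have bn := dim_uniq sN hb h; move: E; rewrite bn => /eqP.
rewrite -{2}[n]add0n eqn_add2r => /eqP a0; move: ha; rewrite a0.
exact: dim0_eq.
Qed.

End LinearCombinations.

Section Isomorphism.
Variables (K : numFieldType) (Z Z' : lmodType K) (f : Z -> Z').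
Hypothesis flin : linear f.
Variables (D N : set Z) (D' N' : set Z').
Hypotheses (sN : lin_sub N) (sN' : lin_sub N').
Hypothesis fD : forall x, D x -> D' (f x).

Lemma lc_linear n c (b : 'I_n -> Z) : f (lc c b) = lc c (fun i => f (b i)).
Proof.
have f0 : f 0 = 0 by have := flin (-1) 0 0; rewrite scaler0 addr0 scaleN1r addNr.
rewrite /lc; elim/big_rec2: _ => //= i y y' _ <-; exact: flin.
Qed.

Let fB x y : f (x - y) = f x - f y.
Proof. by have := flin (-1) y x; rewrite !scaleN1r ![- _ + _]addrC. Qed.

Hypothesis sD : lin_sub D.
Hypothesis fN : forall x, D x -> N x <-> N' (f x).

(** [f] induces an isomorphism of [D/N] onto [D'/N']. For the converse direction a basis of [D'/N']
    is lifted to [D], up to elements of [N']. *)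
Lemma dim_iso n : (forall y, D' y -> exists2 x, D x & N' (y - f x)) ->
  has_dim_mod D N n <-> has_dim_mod D' N' n.
Proof.
move=> fs; split=> /has_dim_modP[b [[Db sb] ib]]; apply/has_dim_modP.
  exists (fun i => f (b i)); split; first split.
  - by move=> i; exact: fD.
  - move=> y /fs[x Dx N'x]; have [c Nc] := sb _ Dx; exists c.
    rewrite -lc_linear -[y](subrK (f x)) -addrA -fB; apply: subD => //.
    by apply/fN => //; apply: subB => //; exact: sub_lc.
  - by move=> c; rewrite -lc_linear => /fN - /(_ (sub_lc _ sD Db)) /ib.
have /choice[e He] : forall i, exists x, D x /\ N' (b i - f x).
  by move=> i; have [x] := fs _ (Db i); exists x.
have E c : N' (lc c b - f (lc c e)).
  by rewrite lc_linear -lc_subf; apply: sub_lc => // i; case: (He i).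
exists e; split; first split.
- by move=> i; case: (He i).
- move=> x Dx; have [c Nc] := sb _ (fD Dx); exists c; apply/fN.
    by apply: subB => //; apply: sub_lc => // i; case: (He i).
  rewrite fB -[f x](subrK (lc c b)) -addrA; exact: subD.
- move=> c /fN h; apply: ib; apply/(sub_eqv sN' (E c)); apply: h.
  by apply: sub_lc => // i; case: (He i).
Qed.

End Isomorphism.

(** * Skew-Hermitian pairings of Lagrangian subspaces *)

Section SkewForms.
Variables (C : numClosedFieldType) (Z : lmodType C).
Variable om : {hermitian Z for true & @Num.conj C}.
Implicit Types (A B D N M : set Z).

Lemma om_skew x y : om y x = - (om x y)^*.
Proof. by rewrite hermC expr1 mulN1r. Qed.

Lemma om_sym0 x y : om x y = 0 -> om y x = 0.
Proof. by move=> h; rewrite om_skew h conjC0 oppr0. Qed.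

Lemma om_lcl n (c : 'rV[C]_n) (b : 'I_n -> Z) y :
  om (lc c b) y = \sum_i c 0 i * om (b i) y.
Proof. by rewrite /lc linear_sumlz; apply: eq_bigr => i _; rewrite linearZl_LR. Qed.

Lemma om_lcr n (c : 'rV[C]_n) (b : 'I_n -> Z) x :
  om x (lc c b) = \sum_i (c 0 i)^* * om x (b i).
Proof. by rewrite /lc linear_sumr; apply: eq_bigr => i _; rewrite linearZr_LR. Qed.

Lemma lin_sub_ann A : lin_sub (annihilator om A).
Proof.
split; first by move=> y _; rewrite linear0l.
move=> a x y hx hy z Az; by rewrite linearDl linearZl_LR /= hx // hy // mulr0 addr0.
Qed.

Lemma ann_anti A B : A `<=` B -> annihilator om B `<=` annihilator om A.
Proof. by move=> AB x h y /AB; exact: h. Qed.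

Lemma ann_sum A B : lin_sub A -> lin_sub B ->
  annihilator om (sumset A B) = annihilator om A `&` annihilator om B.
Proof.
move=> sA sB; apply/seteqP; split => [x h|x [hA hB] _ [a Aa [b Bb <-]]].
  by split=> y ?; apply: h; [exact: sumset_l|exact: sumset_r].
by rewrite linearDr /= hA // hB // addr0.
Qed.

Lemma lag_sub A : lagrangian om A -> lin_sub A.
Proof. by rewrite /lagrangian => ->; exact: lin_sub_ann. Qed.

Lemma lag_om A x y : lagrangian om A -> A x -> A y -> om x y = 0.
Proof. by move=> hA + Ay; rewrite {1}hA => /(_ _ Ay). Qed.

Lemma lag_in A x : lagrangian om A -> (forall y, A y -> om x y = 0) -> A x.
Proof. by move=> hA h; rewrite hA => y; exact: h. Qed.

(** A relation between the rows is a combination of [e] orthogonal to all of [D'], hence in [N]. The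
    argument uses non-degeneracy on the left and a finite spanning family, so it suits a form that
    is not onto the dual. *)
Lemma pairing_ker m n D N D' N' (e : 'I_m -> Z) (b : 'I_n -> Z) :
  lin_sub D -> (forall i, D (e i)) -> indep_mod N e -> spans_mod D' N' b ->
  (forall x y, D x -> N' y -> om x y = 0) ->
  (forall x, D x -> (forall y, D' y -> om x y = 0) -> N x) ->
  row_free (\matrix_(i < m, j < n) om (e i) (b j)).
Proof.
move=> sD De ie [D'b sb] v0 nd; apply: row_free_kernel => c c0; apply: ie.
have Dc : D (lc c e) by exact: sub_lc.
apply: nd => // y /sb[c' N'y]; rewrite -[y](subrK (lc c' b)) linearDr /= v0 // add0r.
rewrite om_lcr big1 // => j _; rewrite om_lcl; move/rowP: c0 => /(_ j).
rewrite !mxE => c0j; rewrite -[RHS](mulr0 ((c' 0 j)^*)) -[in RHS]c0j; congr (_ * _).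
by apply: eq_bigr => i _; rewrite mxE.
Qed.

Lemma pairing_le m n D N D' N' : lin_sub D ->
  has_dim_mod D N m -> has_dim_mod D' N' n ->
  (forall x y, D x -> N' y -> om x y = 0) ->
  (forall x, D x -> (forall y, D' y -> om x y = 0) -> N x) ->
  (m <= n)%N.
Proof.
move=> sD /has_dim_modP[e [[De _] ie]] /has_dim_modP[b [sb _]] v0 nd.
by have := pairing_ker sD De ie sb v0 nd; rewrite /row_free => /eqP <-; exact: rank_leq_col.
Qed.

Lemma pairing_findim n D N D' N' : lin_sub D -> lin_sub N ->
  has_dim_mod D' N' n ->
  (forall x y, D x -> N' y -> om x y = 0) ->
  (forall x, D x -> (forall y, D' y -> om x y = 0) -> N x) ->
  exists2 m, (m <= n)%N & has_dim_mod D N m.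
Proof.
move=> sD sN /has_dim_modP[b [sb _]] v0 nd; apply: exists_basis => // m e De ie.
by have := pairing_ker sD De ie sb v0 nd; rewrite /row_free => /eqP <-; exact: rank_leq_col.
Qed.

(** With equal dimensions the Gram matrix is square, so injectivity on the left makes it invertible
    and gives non-degeneracy on the right. This takes the place of double annihilators. *)
Lemma pairing_right n D N D' N' y : lin_sub D -> lin_sub D' -> lin_sub N' ->
  has_dim_mod D N n -> has_dim_mod D' N' n ->
  (forall x y, D x -> N' y -> om x y = 0) ->
  (forall x, D x -> (forall y, D' y -> om x y = 0) -> N x) ->
  D' y -> (forall x, D x -> om x y = 0) -> N' y.
Proof.
move=> sD sD' sN' /has_dim_modP[e [[De _] ie]] /has_dim_modP[b [[D'b sb] ib]] v0 nd D'y hy.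
have := pairing_ker sD De ie (conj D'b sb) v0 nd; set G := \matrix_(i, j) _.
rewrite row_free_unit -unitmx_tr -row_free_unit => fG.
have [c N'y] := sb _ D'y.
suff c0 : map_mx Num.conj c = 0.
  move: N'y; have -> : c = 0.
    by apply/rowP => i; move/rowP: c0 => /(_ i); rewrite !mxE => /eqP; rewrite conjC_eq0 => /eqP.
  by rewrite lc0 subr0.
apply: (row_free_inj fG); rewrite mul0mx; apply/rowP => i; rewrite !mxE.
have := hy _ (De i); rewrite -[y](subrK (lc c b)) linearDr /= v0 // add0r om_lcr => h.
by rewrite -[RHS]h; apply: eq_bigr => j _; rewrite !mxE.
Qed.

End SkewForms.

Section Pointwise.
Variables (C : numClosedFieldType) (Z : lmodType C).
Variable om : {hermitian Z for true & @Num.conj C}.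
Hypothesis om_nd : forall x, (forall y, om x y = 0) -> x = 0.
Variables (lam mu Y : set Z).
Hypotheses (lam_lag : lagrangian om lam) (mu_lag : lagrangian om mu) (Y_lag : lagrangian om Y).

Definition diff_in (P : set Z) : set (Z * Z) :=
  [set e | [/\ lam e.1, mu e.2 & P (e.1 - e.2)]].

Let slam := lag_sub lam_lag.
Let smu := lag_sub mu_lag.
Let sY := lag_sub Y_lag.

Lemma lin_sub_diff_in P : lin_sub P -> lin_sub (diff_in P).
Proof.
move=> sP; split; first by split; rewrite /= ?subrr; exact: sub0.
move=> a [x1 x2] [y1 y2] [/= l1 m1 p1] [/= l2 m2 p2].
split => /=; [by apply: subD => //; exact: subZ|by apply: subD => //; exact: subZ|].
by rewrite opprD addrACA -scalerBr; apply: subD => //; exact: subZ.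
Qed.

Local Notation A := (lam `&` Y).
Local Notation B := (mu `&` Y).
Let sA : lin_sub A := lin_subI slam sY.
Let sB : lin_sub B := lin_subI smu sY.
Let sAB : lin_sub (sumset A B) := lin_sub_sumset sA sB.

Variables (d j k : nat).
Hypotheses (dimI : has_dim_mod (lam `&` mu) [set 0] d)
  (dimS : has_dim_mod [set: Z] (sumset lam mu) d)
  (dimAB : has_dim_mod (A `&` B) [set 0] j)
  (dimY : has_dim_mod Y (sumset A B) k).

Let Lmu := sumset lam mu.
(** If [X] is a complement of [Y], this is the preimage of [dom lam /\ dom mu] under the projection
    to [X] along [Y], described without [X]. *)
Let P := sumset lam Y `&` sumset mu Y.

Let sP : lin_sub P.
Proof. by apply: lin_subI; exact: lin_sub_sumset. Qed.

Lemma om_DY x y : P x -> Y y -> sumset A B y -> om x y = 0.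
Proof.
move=> [[l Ll [y1 Yy1 <-]] [m Mm [y2 Yy2 E]]] Yy [a [la Ya] [b [mb Yb <-]]].
rewrite linearDr /= -{2}E !linearDl /=.
by rewrite (lag_om lam_lag Ll la) (lag_om mu_lag Mm mb) (lag_om Y_lag Yy1 Ya) (lag_om Y_lag Yy2 Yb) !addr0.
Qed.

Lemma P_nd x : P x -> (forall y, Y y -> om x y = 0) -> Y x.
Proof. by move=> _ h; exact: (lag_in Y_lag). Qed.

Let AB_Y : sumset A B `<=` Y.
Proof. by apply: sumset_sub => // x []. Qed.

(** Here [c] is the codimension of [lam + mu + Y], [d] splits as [c + e] and [k] as [e + r]. Pairing
    [P/Y] with [Y/(A + B)] gives [r + dj <= k]; pairing [A /\ B] with [Z/(lam + mu + Y)] gives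
    [j <= c]. Since [d] is both the dimension of [lam /\ mu] and the codimension of [lam + mu], the
    first inequality amounts to [c <= j], and both are equalities. *)
Let main : exists r c e,
  [/\ has_dim_mod [set: Z] (sumset Lmu Y) c,
      (c + e)%N = d, (e + r)%N = k, has_dim_mod (diff_in Y) (diff_in (sumset A B)) r
    & c = j /\ has_dim_mod P Y k /\ exists2 dj, has_dim_mod (lam `&` mu) (A `&` B) dj
       & (dj + j)%N = d /\ (r + dj)%N = k].
Proof.
have sLmu : lin_sub Lmu by exact: lin_sub_sumset.
have sLY : lin_sub (sumset Lmu Y) by exact: lin_sub_sumset.
have [c [e [hc he E1]]] := dim_split (@lin_subT _ _) sLY sLmu (@sumset_l _ _ _ _ sY) (@subsetT _ _) dimS.
have sYL : lin_sub (Y `&` Lmu) by exact: lin_subI.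
have AB_L : sumset A B `<=` Lmu.
  apply: sumset_sub => // x [lx _]; [exact: sumset_l|exact: sumset_r].
have [e' [r [he' hr E2]]] : exists a b, [/\ has_dim_mod Y (Y `&` Lmu) a,
    has_dim_mod (Y `&` Lmu) (sumset A B) b & (a + b)%N = k].
  by apply: dim_split => // x h; split; [exact: AB_Y|exact: AB_L].
have ee : e' = e.
  apply: (dim_uniq sYL he').
  apply/(@dim_iso _ _ _ idfun _ Y _ (sumset Lmu Y) Lmu) => //.
  - by move=> x; exact: sumset_r.
  - by move=> x Yx; split=> [[]//|Lx]; split.
  - move=> _ [z Lz [y Yy <-]]; exists y => //=; by rewrite addrK.
have sE0 : lin_sub (diff_in Y) by exact: lin_sub_diff_in.
have sE1 : lin_sub (diff_in (sumset A B)) by exact: lin_sub_diff_in.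
have hE : has_dim_mod (diff_in Y) (diff_in (sumset A B)) r.
  pose f (e : Z * Z) := e.1 - e.2.
  have flin : linear f by move=> a x y; rewrite /f /= scalerBr opprD addrACA.
  apply/(@dim_iso _ _ _ f flin _ _ (Y `&` Lmu) (sumset A B)) => //.
  - move=> [l m] [/= lx my Yx]; split => //=; exists l => //; exists (- m) => //.
    exact: subN.
  - by move=> [l m] [/= lx my Yx]; split => [[]|h] //; split.
  - move=> y [Yy [l ll [m mm E]]]; exists (l, - m).
      by split => //=; [exact: subN|rewrite opprK E].
    by rewrite /f /= opprK E subrr; exact: sub0.
have sI : lin_sub (lam `&` mu) by exact: lin_subI.
have sAB' : lin_sub (A `&` B) by exact: lin_subI.
have s0 := @lin_sub0 _ Z.
have [dj [j' [hdj hj' E3]]] : exists a b, [/\ has_dim_mod (lam `&` mu) (A `&` B) a,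
    has_dim_mod (A `&` B) [set 0] b & (a + b)%N = d].
  apply: dim_split => //; first by move=> x ->; exact: sub0.
  by move=> x [[? ?] [? ?]].
have jj : j' = j by exact: dim_uniq hj' dimAB.
(* Modulo [A x B] the pairs with difference in [Y] become [P/Y] through their first component; the
   filtration by the difference gives the dimension [r + dj]. *)
pose N2 := [set e : Z * Z | A e.1 /\ B e.2].
have sN2 : lin_sub N2.
  split; first by split; exact: sub0.
  move=> a [x1 x2] [y1 y2] [/= h1 h2] [/= h3 h4]; split => /=.
    exact: (subD sA (subZ _ sA _)).
  exact: (subD sB (subZ _ sB _)).
have h2 : has_dim_mod (diff_in (sumset A B)) N2 dj.
  apply/(@dim_iso _ _ _ (fun x : Z => (x, x)) _ (lam `&` mu) (A `&` B)) => //.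
  - by move=> x [lx mx]; split => //=; rewrite subrr; exact: sub0.
  - move=> [l m] [/= ll mm [a Aa [b Bb E]]].
    exists (l - a).
      split; first by apply: subB => //; case: Aa.
      by rewrite -[l](subrK m) -E addrAC [a + b]addrC addrK addrC; apply: subD => //; case: Bb.
    split => /=; first by rewrite subKr.
    rewrite opprB addrCA -[m - l]opprB -E opprD addrA subrr add0r.
    exact: (subN sB Bb).
have hEN : has_dim_mod (diff_in Y) N2 (r + dj).
  apply: (dim_add _ _ _ _ hE h2) => //.
  - move=> [a b] [/= Aa Bb]; split => //=; [by case: Aa|by case: Bb|].
    by exists a => //; exists (- b) => //; exact: subN.
  - by move=> [l m] [/= ? ? ?]; split => //=; exact: AB_Y.
have hP : has_dim_mod P Y (r + dj).
  apply/(@dim_iso _ _ _ (fun e : Z * Z => e.1) _ (diff_in Y) N2) => //.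
  - move=> [l m] [/= ll mm Yx]; split => /=; first exact: sumset_l.
    by exists m => //; exists (l - m) => //; rewrite addrC subrK.
  - move=> [l m] [/= ll mm Yx]; split => [[/= [? ?] _]//|/= Yl]; split => //=; split => //.
    by rewrite -[m](subKr l); apply: subB.
  - move=> x [[l ll [y1 Yy1 E]] [m mm [y2 Yy2 E']]]; exists (l, m).
      split => //=; have -> : l - m = y2 - y1.
        have -> : l = x - y1 by rewrite -E addrK.
        have -> : m = x - y2 by rewrite -E' addrK.
        by rewrite opprB addrC addrA subrK.
      exact: (subB sY).
    by rewrite /= -E addrAC subrr add0r.
have rk : (r + dj <= k)%N.
  apply: (pairing_le (om := om) sP hP dimY); last exact: P_nd.
  by move=> x y Px h; apply: om_DY => //; exact: AB_Y.
have jc : (j <= c)%N.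
  apply: (pairing_le (om := om) _ dimAB hc) => //.
    move=> x y [[lx Yx] [mx _]] [z [l ll [m mm <-]] [y' Yy' <-]].
    by rewrite !linearDr /= (lag_om lam_lag lx ll) (lag_om mu_lag mx mm) (lag_om Y_lag Yx Yy') !addr0.
  by move=> x _ h; apply: om_nd => y; exact: h.
have cj : c = j by lia.
exists r, c, e; split => //; [by rewrite -ee|].
have E4 : (r + dj)%N = k by lia.
by split => //; split; [rewrite -E4|exists dj => //; split; lia].
Qed.

(** [r] will be the rank of [qhat] on the pairs with difference in [Y]; the third statement provides
    the [j] vectors that complete [lam + mu + Y] to [Z]. *)
Lemma relation_rank : exists r, [/\ has_dim_mod (diff_in Y) (diff_in (sumset A B)) r,
  (r + d = k + j)%N, has_dim_mod [set: Z] (sumset (sumset lam mu) Y) j &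
  has_dim_mod (sumset lam Y `&` sumset mu Y) Y k].
Proof.
have [r [c [e [h1 h2 h3 h4 [h5 [h6 [dj h7 [h8 h9]]]]]]]] := main.
by exists r; split; rewrite -?h5 //; lia.
Qed.

Lemma quotient_dim : exists2 dj, has_dim_mod (lam `&` mu) (A `&` B) dj & (dj + j = d)%N.
Proof.
have [r [c [e [h1 h2 h3 h4 [h5 [h6 [dj h7 [h8 h9]]]]]]]] := main.
by exists dj.
Qed.

(** The double annihilator property of [A + B] inside [Y]: [P/Y] and [Y/(A + B)] have the same
    finite dimension [k], so their pairing is non-degenerate on both sides. *)
Lemma relation_kernel y : Y y -> (forall x, P x -> om x y = 0) -> sumset A B y.
Proof.
have [r [c [e [h1 h2 h3 h4 [h5 [h6 _]]]]]] := main.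
apply: (pairing_right (om := om) sP sY sAB h6 dimY); last exact: P_nd.
by move=> x y' Px h; apply: om_DY => //; exact: AB_Y.
Qed.

End Pointwise.

(** * Hermitian forms and Morse indices *)

Local Notation "M ^t*" := (map_mx Num.conj (M ^T)) (at level 30).

Section HermitianForms.
Variables (C : numClosedFieldType) (V : lmodType C).
Implicit Types (h : V -> V -> C) (E N : set V).

Definition herm_form h : Prop :=
  (forall a x x' y, h (a *: x + x') y = a * h x y + h x' y) /\
  (forall x y, h y x = (h x y)^*).

Definition signed (neg : bool) h : V -> V -> C := fun x y => (-1) ^+ neg * h x y.

Lemma signed_herm neg h : herm_form h -> herm_form (signed neg h).
Proof.
move=> [lh hh]; split=> [a x x' y|x y]; rewrite /signed.
  by rewrite lh mulrDr mulrCA.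
by rewrite hh rmorphM /= rmorph_sign.
Qed.

Lemma herm0l h y : herm_form h -> h 0 y = 0.
Proof. by move=> [lh _]; have := lh (-1) 0 0 y; rewrite scaler0 addr0 mulN1r addNr. Qed.

Lemma hermDl h x x' y : herm_form h -> h (x + x') y = h x y + h x' y.
Proof. by move=> [lh _]; have := lh 1 x x' y; rewrite scale1r mul1r. Qed.

Lemma hermZl h a x y : herm_form h -> h (a *: x) y = a * h x y.
Proof. by move=> hh; have := hh.1 a x 0 y; rewrite addr0 herm0l // addr0. Qed.

Lemma hermDr h x y y' : herm_form h -> h x (y + y') = h x y + h x y'.
Proof. by move=> hh; rewrite hh.2 hermDl // rmorphD /= -!hh.2. Qed.

Lemma hermZr h a x y : herm_form h -> h x (a *: y) = a^* * h x y.
Proof. by move=> hh; rewrite hh.2 hermZl // rmorphM /= -hh.2. Qed.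

Lemma hermNl h x y : herm_form h -> h (- x) y = - h x y.
Proof. by move=> hh; rewrite -scaleN1r hermZl // mulN1r. Qed.

Lemma hermNr h x y : herm_form h -> h x (- y) = - h x y.
Proof. by move=> hh; rewrite -scaleN1r hermZr // rmorphN1 mulN1r. Qed.

Lemma herm_lcl h n (c : 'rV[C]_n) (e : 'I_n -> V) y : herm_form h ->
  h (lc c e) y = \sum_i c 0 i * h (e i) y.
Proof.
move=> hh; rewrite /lc.
elim/big_rec2: _ => [|i y' y'' _ <-]; first exact: herm0l.
by rewrite hh.1.
Qed.

Lemma herm_lcr h n (c : 'rV[C]_n) (e : 'I_n -> V) x : herm_form h ->
  h x (lc c e) = \sum_i (c 0 i)^* * h x (e i).
Proof.
move=> hh; rewrite hh.2 herm_lcl // rmorph_sum; apply: eq_bigr => i _.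
by rewrite rmorphM /= -hh.2.
Qed.

Definition gram h m n (e : 'I_m -> V) (f : 'I_n -> V) : 'M[C]_(m, n) :=
  \matrix_(i, j) h (e i) (f j).

Lemma herm_lc h m n (c : 'rV[C]_m) (c' : 'rV[C]_n) (e : 'I_m -> V) (f : 'I_n -> V) :
  herm_form h -> h (lc c e) (lc c' f) = (c *m gram h e f *m c'^t*) 0 0.
Proof.
move=> hh; rewrite herm_lcr // mxE; apply: eq_bigr => j _; rewrite !mxE mulrC.
by rewrite herm_lcl //; congr (_ * _); apply: eq_bigr => i _; rewrite mxE.
Qed.

Lemma gram_lc h m n (P : 'M[C]_(m, n)) (e : 'I_n -> V) : herm_form h ->
  gram h (fun i => lc (row i P) e) (fun i => lc (row i P) e) = P *m gram h e e *m P^t*.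
Proof.
move=> hh; apply/matrixP => i j; rewrite mxE herm_lc // mxE [RHS]mxE.
apply: eq_bigr => k _; rewrite !mxE; congr (_ * _).
by apply: eq_bigr => l _; rewrite !mxE.
Qed.

Definition pos_fam h n (e : 'I_n -> V) : Prop :=
  forall c : 'rV[C]_n, c != 0 -> 0 < h (lc c e) (lc c e).

Definition ortho_fam h n (e : 'I_n -> V) : Prop :=
  forall i j, h (e i) (e j) = (i == j)%:R.

Lemma rV_neq0P n (c : 'rV[C]_n) : c != 0 -> exists i, c 0 i != 0.
Proof.
move=> c0; apply: contrapT => /forallNP h; move: c0; apply/negP; rewrite negbK.
by apply/eqP/rowP => i; rewrite mxE; apply/eqP; move: (h i) => /negP; rewrite negbK.
Qed.

Lemma diag_value h n (e : 'I_n -> V) (D : 'I_n -> C) (c : 'rV[C]_n) : herm_form h ->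
  (forall i j, h (e i) (e j) = (D i) *+ (i == j)) ->
  h (lc c e) (lc c e) = \sum_i D i * `|c 0 i| ^+ 2.
Proof.
move=> hh he; rewrite herm_lcr //; apply: eq_bigr => j _.
rewrite herm_lcl // (bigD1 j) //= he eqxx mulr1n big1 ?addr0.
  by rewrite normCK mulrA mulrC; congr (_ * _); rewrite mulrC.
by move=> i /negbTE ij; rewrite he ij mulr0.
Qed.

Lemma ortho_pos h n (e : 'I_n -> V) : herm_form h -> ortho_fam h e -> pos_fam h e.
Proof.
move=> hh he c /rV_neq0P[i ci].
rewrite (@diag_value h n e (fun=> 1)) //.
rewrite (bigD1 i) //=; apply: ltr_pwDl; first by rewrite mul1r exprn_gt0 // normr_gt0.
by apply: sumr_ge0 => k _; rewrite mul1r exprn_ge0.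
Qed.

Lemma pos_fam_lc h m n (K : 'M[C]_(m, n)) (e : 'I_n -> V) : row_free K ->
  pos_fam h e -> pos_fam h (fun i => lc (row i K) e).
Proof.
move=> fK he c c0; rewrite -lc_mul; apply: he; apply: contra c0 => /eqP cK.
by apply/eqP; apply: (row_free_inj fK); rewrite cK mul0mx.
Qed.

Lemma spectral_family h r (e : 'I_r -> V) : herm_form h ->
  exists (P : 'M[C]_r) (D : 'I_r -> C), [/\ P *m P^t* = 1%:M, forall i, D i \is Num.real
    & forall i j, h (lc (row i P) e) (lc (row j P) e) = D i *+ (i == j)].
Proof.
move=> hh; set G := gram h e e.
have Gh : G \is hermsymmx.
  rewrite is_hermitianmxE expr0 scale1r; apply/eqP/matrixP => i j.
  by rewrite !mxE hh.2.
exists (spectralmx G), (fun i => spectral_diag G 0 i); split.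
- by apply/unitarymxP; exact: spectral_unitarymx.
- by move=> i; have /mxOverP/(_ 0 i) := hermitian_spectral_diag_real Gh.
- move=> i j; have /matrixP/(_ i j) := gram_lc (spectralmx G) e hh; rewrite mxE => ->.
  rewrite -/G.
  have /hermitian_normalmx/orthomx_spectralP {2}-> := Gh.
  have U := spectral_unitarymx G.
  rewrite invmx_unitary // !mulmxA (unitarymxP U) mul1mx.
  by rewrite -mulmxA (unitarymxP U) mulmx1 mxE eq_sym; case: eqP => // ->.
Qed.

(** If a combination [x + y] of the two families lies in the radical [N], then
    [h x x = - h y x = h y y], which contradicts the signs unless both parts vanish. The joined
    family is therefore independent modulo [N]. *)
Lemma pos_neg_le h E N r a b (f : 'I_a -> V) (g : 'I_b -> V) : herm_form h ->
  lin_sub E -> lin_sub N -> has_dim_mod E N r ->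
  (forall x y, N x -> E y -> h x y = 0) ->
  (forall i, E (f i)) -> (forall i, E (g i)) ->
  pos_fam h f -> pos_fam (fun x y => - h x y) g -> (a + b <= r)%N.
Proof.
move=> hh sE sN hr v0 Ef Eg pf pg.
apply: (dim_le_indep sN hr (cat_famP (P := E) Ef Eg)) => c; rewrite lc_cat => Nc.
set x := lc _ f in Nc; set y := lc _ g in Nc.
have Ex : E x by exact: sub_lc.
have Ey : E y by exact: sub_lc.
have xx : h x x = h y y.
  have h1 : h x x = - h y x.
    by apply/eqP; rewrite -subr_eq0 opprK -hermDl // v0.
  have h2 : h y y = - h y x.
    by apply/eqP; rewrite -subr_eq0 opprK addrC -hermDr // hh.2 v0 // conjC0.
  by rewrite h1 h2.
have lx : lsubmx c = 0.
  apply/eqP/negP => /negP/pf; rewrite -/x xx => p1.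
  have : rsubmx c != 0.
    by apply/eqP => r0; move: p1; rewrite /y r0 lc0 herm0l // ltxx.
  by move=> /pg; rewrite -/y oppr_gt0 => /(lt_trans p1); rewrite ltxx.
have ry : rsubmx c = 0.
  apply/eqP/negP => /negP/pg; rewrite -/y -xx /x lx lc0 herm0l // oppr0 ltxx.
  by [].
by rewrite -(hsubmxK c) lx ry row_mx0.
Qed.

(** No eigenvalue vanishes, since its eigenvector would lie in [N]. The eigenvectors are divided by
    the square roots of the moduli of their eigenvalues. *)
Lemma inertia h E N r : herm_form h -> lin_sub E -> lin_sub N -> N `<=` E ->
  has_dim_mod E N r -> (forall x y, N x -> E y -> h x y = 0) ->
  (forall x, E x -> (forall y, E y -> h x y = 0) -> N x) ->
  exists p n (ep : 'I_p -> V) (en : 'I_n -> V), [/\ (p + n = r)%N,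
    (forall i, E (ep i)) /\ (forall i, E (en i)), ortho_fam h ep &
    ortho_fam (fun x y => - h x y) en].
Proof.
move=> hh sE sN NE hr v0 nd.
have [e [se ie]] := (has_dim_modP _ _ _).1 hr.
have [P [D [PP Dr hD]]] := spectral_family e hh.
pose e' i := lc (row i P) e.
have Ee' i : E (e' i) by apply: sub_lc => // j; case: se.
have D0 i : D i != 0.
  apply/eqP => Di.
  have : N (e' i).
    apply: nd => // y Ey; have [c Nc] := se.2 _ Ey.
    rewrite -[y](subrK (lc c e)) hermDr // hh.2 (v0 _ _ Nc) // conjC0 add0r.
    have -> : lc c e = lc (c *m P^t*) e'.
      rewrite -lc_mul -mulmxA.
      have -> : P^t* *m P = 1%:M by apply: mulmx1C.
      by rewrite mulmx1.
    rewrite herm_lcr // big1 // => j _; rewrite hD.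
    by case: eqP; rewrite ?mulr0 // Di mul0rn mulr0.
  move=> /ie; move=> /rowP Pi0; have := PP => /matrixP/(_ i i).
  rewrite !mxE eqxx big1 => [/esym/eqP|j _]; first by rewrite oner_eq0.
  by have := Pi0 j; rewrite !mxE => ->; rewrite mul0r.
pose A := [pred i | 0 < D i]; pose B := [pred i | D i < 0].
exists #|A|, #|B|.
exists (fun i : 'I_#|A| => (sqrtC (D (enum_val i)))^-1 *: e' (enum_val i)).
exists (fun i : 'I_#|B| => (sqrtC (- D (enum_val i)))^-1 *: e' (enum_val i)).
split.
- rewrite -[RHS]card_ord -(cardC A); congr (_ + _)%N; apply: eq_card => i.
  by rewrite !inE -real_leNgt ?real0 // le_eqVlt (negbTE (D0 i)).
- by split=> i; apply: subZ.
- move=> i j; rewrite hermZl // hermZr // hD.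
  case: eqP => [/enum_val_inj ->|ij].
    rewrite eqxx mulr1n mulrA.
    have Dj : 0 < D (enum_val j) by have := enum_valP j; rewrite inE.
    have sq : 0 <= (sqrtC (D (enum_val j)))^-1 by rewrite invr_ge0 sqrtC_ge0 ltW.
    by rewrite (CrealP (ger0_real sq)) -expr2 exprVn sqrtCK mulVf // gt_eqF.
  by rewrite !mulr0; case: eqP => // ij'; case: ij; rewrite ij'.
- move=> i j; rewrite hermZl // hermZr // hD.
  case: eqP => [/enum_val_inj ->|ij].
    rewrite eqxx mulr1n mulrA.
    have Dj : 0 < - D (enum_val j) by have := enum_valP j; rewrite inE oppr_gt0.
    have sq : 0 <= (sqrtC (- D (enum_val j)))^-1 by rewrite invr_ge0 sqrtC_ge0 ltW.
    by rewrite (CrealP (ger0_real sq)) -expr2 exprVn sqrtCK -mulrN mulVf // gt_eqF.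
  by rewrite !mulr0 oppr0; case: eqP => // ij'; case: ij; rewrite ij'.
Qed.

(** The maximum is attained on an orthonormal family because orthonormality survives a small
    perturbation with explicit bounds, while maximality is tested against all positive families. *)
Definition max_pos h E (p : nat) : Prop :=
  (exists2 e : 'I_p -> V, forall i, E (e i) & ortho_fam h e) /\
  forall n (e : 'I_n -> V), (forall i, E (e i)) -> pos_fam h e -> (n <= p)%N.

Lemma opp_herm h : herm_form h -> herm_form (fun x y => - h x y).
Proof.
move=> [lh hh]; split=> [a x x' y|x y]; first by rewrite lh opprD mulrN.
by rewrite hh rmorphN.
Qed.

Lemma max_pos_exists h E N r : herm_form h -> lin_sub E -> lin_sub N -> N `<=` E ->
  has_dim_mod E N r -> (forall x y, N x -> E y -> h x y = 0) ->
  (forall x, E x -> (forall y, E y -> h x y = 0) -> N x) ->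
  exists p n, [/\ max_pos h E p, max_pos (fun x y => - h x y) E n & (p + n = r)%N].
Proof.
move=> hh sE sN NE hr v0 nd.
have [p [n [ep [en [pn [Eep Een] op on]]]]] := inertia hh sE sN NE hr v0 nd.
have hh' := opp_herm hh.
exists p, n; split => //; split.
- by exists ep.
- move=> m e Ee pe.
  have := pos_neg_le hh sE sN hr v0 Ee Een pe (ortho_pos hh' on).
  by rewrite -pn leq_add2r.
- by exists en.
- move=> m e Ee pe.
  have := pos_neg_le hh sE sN hr v0 Eep Ee (ortho_pos hh op) pe.
  by rewrite -pn leq_add2l.
Qed.

Lemma max_pos_uniq h E p p' : herm_form h -> max_pos h E p -> max_pos h E p' -> p = p'.
Proof.
move=> hh [[e Ee oe] m] [[e' Ee' oe'] m'].
apply/eqP; rewrite eqn_leq (m' _ e) ?(m _ e') //; exact: ortho_pos.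
Qed.

End HermitianForms.

Section MorseTransfer.
Variables (C : numClosedFieldType) (Z V : lmodType C).
Variables (neg : bool) (D N : set Z) (q : Z -> Z -> C) (h : V -> V -> C) (E : set V).
(** A relation and not a map, since one vector may correspond to many pairs. It is applied between
    [be/N] and the pairs with difference in [L], and between the domain of [Q] and the pairs with
    difference in [Y]. *)
Variable rel : Z -> V -> Prop.
Hypotheses (hh : herm_form h) (sD : lin_sub D) (sN : lin_sub N) (ND : N `<=` D).
Hypothesis q_inv : forall x y, D x -> N y -> q (x + y) (x + y) = q x x.
Hypothesis rel_lc : forall n (c : 'rV[C]_n) b e,
  (forall i, rel (b i) (e i)) -> rel (lc c b) (lc c e).
Hypothesis rel_D : forall x, D x -> exists2 e, E e & rel x e.
Hypothesis rel_E : forall e, E e -> exists2 x, D x & rel x e.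
Hypothesis rel_q : forall x e, D x -> rel x e -> q x x = (-1) ^+ neg * h e e.

Let rel0 : rel 0 0.
Proof. by have := @rel_lc 0 0 (fun=> 0) (fun=> 0); rewrite !lc0; apply => -[]. Qed.

(** A basis of a definite subspace modulo [N] transports to a positive family; conversely the
    subspace is rebuilt as [N] plus the span of preimages of the family. *)
Lemma definite_family n : has_definite_dim neg D N q n <->
  exists2 e : 'I_n -> V, forall i, E (e i) & pos_fam h e.
Proof.
have s2 : (-1) ^+ neg * (-1) ^+ neg = 1 :> C by rewrite -expr2 sqrr_sign.
split.
  move=> [P [/lin_subP sP NP PD /has_dim_modP[b [[Pb _] ib]] pos]].
  have /choice[e He] : forall i, exists e, E e /\ rel (b i) e.
    by move=> i; have [e] := rel_D (PD _ (Pb i)); exists e.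
  exists e; first by move=> i; case: (He i).
  move=> c c0; have Pc : P (lc c b) by exact: sub_lc.
  have Nc : ~ N (lc c b) by move=> /ib c0'; rewrite c0' eqxx in c0.
  have := pos _ Pc Nc.
  rewrite (rel_q (PD _ Pc) (rel_lc c (fun i => proj2 (He i)))).
  by rewrite mulrA s2 mul1r.
move=> [e Ee pe].
have /choice[b Hb] : forall i, exists x, D x /\ rel x (e i).
  by move=> i; have [x] := rel_E (Ee i); exists x.
have Db i : D (b i) by case: (Hb i).
have val c : q (lc c b) (lc c b) = (-1) ^+ neg * h (lc c e) (lc c e).
  apply: rel_q; first exact: sub_lc.
  by apply: rel_lc => i; case: (Hb i).
exists [set x | exists c, N (x - lc c b)]; split.
- apply/lin_subP; split; first by exists 0; rewrite lc0 subr0; exact: sub0.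
  move=> a x y [c Nc] [c' Nc']; exists (a *: c + c').
  by rewrite lcP opprD addrACA -scalerBr; apply: subD => //; exact: subZ.
- by move=> x Nx; exists 0; rewrite lc0 subr0.
- move=> x [c /ND]; rewrite -{2}[x](subrK (lc c b)) => h1.
  by apply: subD => //; exact: sub_lc.
- apply/has_dim_modP; exists b; split; first split.
  + by move=> i; exists (delta_mx 0 i); rewrite lc_delta subrr; exact: sub0.
  + by move=> x.
  (* [q_inv] at [0] shows that [q] vanishes on the diagonal of [N], so a nontrivial combination in
     [N] contradicts positivity. *)
  + move=> c Nc; apply/eqP/negP => /negP/pe.
    have := q_inv (sub0 sD) Nc; rewrite add0r val (rel_q (sub0 sD) rel0) herm0l // mulr0.
    move=> /(congr1 (fun z => (-1) ^+ neg * z)); rewrite mulr0 mulrA s2 mul1r => ->.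
    by rewrite ltxx.
- move=> x [c Nc] Nx.
  have c0 : c != 0 by apply/eqP => c0; move: Nc; rewrite c0 lc0 subr0.
  have := q_inv (sub_lc c sD Db) Nc; rewrite addrC subrK => ->.
  by rewrite val mulrA s2 mul1r; exact: pe.
Qed.

Lemma morse_modE p : max_pos h E p -> morse_mod neg D N q = p.
Proof.
move=> [[e Ee oe] mp].
have H : has_definite_dim neg D N q p /\
    forall n', has_definite_dim neg D N q n' -> (n' <= p)%N.
  split; first by apply/definite_family; exists e => //; exact: ortho_pos.
  by move=> n' /definite_family[e' Ee' pe']; exact: (mp _ e').
rewrite /morse_mod; case: xgetP => [n _ /= [h1 h2]|/(_ p) //].
by apply/eqP; rewrite eqn_leq; apply/andP; split; [exact: H.2|apply: h2; case: H].
Qed.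

End MorseTransfer.

(** * Uniform solvability in Banach spaces *)

Section RealNorm.
Variables (R : realType).
Implicit Types (V : normedZmodType R[i]).

Lemma normE V (x : V) : `|x| = (rnorm x)%:C%C.
Proof.
by rewrite /rnorm; have := normr_ge0 x; case: `|x| => a b; rewrite lecE /= => /andP[/eqP -> _].
Qed.

Lemma rnorm_ge0 V (x : V) : 0 <= rnorm x.
Proof. by have := normr_ge0 x; rewrite normE lecR. Qed.

Lemma rnormD V (x y : V) : rnorm (x + y) <= rnorm x + rnorm y.
Proof. by have := ler_normD x y; rewrite !normE -rmorphD /= lecR. Qed.

Lemma rnormN V (x : V) : rnorm (- x) = rnorm x.
Proof. by rewrite /rnorm normrN. Qed.

Lemma rnorm0 V : rnorm (0 : V) = 0.
Proof. by rewrite /rnorm normr0. Qed.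

Lemma rnorm_eq0 V (x : V) : rnorm x = 0 -> x = 0.
Proof. by move=> h; apply/normr0_eq0; rewrite normE h. Qed.

Lemma rnormBC V (x y : V) : rnorm (x - y) = rnorm (y - x).
Proof. by rewrite -rnormN opprB. Qed.

Lemma rnorm_tri V (y x z : V) : rnorm (x - z) <= rnorm (x - y) + rnorm (y - z).
Proof. by rewrite -[x - z](subrKA y); exact: rnormD. Qed.

Lemma rnormB V (x y : V) : rnorm (x - y) <= rnorm x + rnorm y.
Proof. by rewrite -(rnormN y); exact: rnormD. Qed.

Lemma rnorm_sum V I (r : seq I) (P : pred I) (F : I -> V) :
  rnorm (\sum_(i <- r | P i) F i) <= \sum_(i <- r | P i) rnorm (F i).
Proof.
elim/big_rec2: _ => [|i y x _ h]; first by rewrite rnorm0.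
by apply: le_trans (rnormD _ _) _; rewrite lerD2l.
Qed.

Lemma rnormM (a b : R[i]) : rnorm (a * b) = rnorm a * rnorm b.
Proof. by apply/complexI; rewrite -normE normrM !normE -rmorphM. Qed.

Lemma rnormC (a : R) : rnorm (a%:C%C) = `|a|.
Proof. by apply/complexI; rewrite -normE normc_def /= expr0n /= addr0 sqrtr_sqr. Qed.

Lemma rnorm_conj (a : R[i]) : rnorm (a^*) = rnorm a.
Proof. by rewrite /rnorm norm_conjC. Qed.

Lemma rnorm_Re (a : R[i]) : `|complex.Re a| <= rnorm a.
Proof. by have := normc_ge_Re a; rewrite normE lecR. Qed.

Lemma rnormZ (Z : normedModType R[i]) (a : R[i]) (x : Z) : rnorm (a *: x) = rnorm a * rnorm x.
Proof. by apply/complexI; rewrite -normE normrZ !normE -rmorphM. Qed.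

Lemma rnorm1 : rnorm (1 : R[i]) = 1.
Proof. by rewrite /rnorm normr1. Qed.

End RealNorm.

Section Completeness.
Variables (R : realType) (Z : completeNormedModType R[i]).
Implicit Types (A : set Z) (x y z : Z).

Lemma closedP A x : closed A -> (forall e : R, 0 < e -> exists2 a, A a & rnorm (x - a) < e) -> A x.
Proof.
move=> cA h; apply: cA => B /nbhs_ballP[e /= e0 eB].
have e0' : 0 < complex.Re e by move: e0; rewrite ltcE /= => /andP[].
have [a Aa ha] := h _ e0'; exists a; split => //; apply: eB.
rewrite -ball_normE /ball_ /= normE.
have -> : e = (complex.Re e)%:C%C.
  by move: e0; case: (e) => u v; rewrite ltcE /= => /andP[/eqP ->].
by rewrite ltcR.
Qed.

Lemma closed_of_approx A :
  (forall x, (forall e : R, 0 < e -> exists2 a, A a & rnorm (x - a) < e) -> A x) -> closed A.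
Proof.
move=> h x cx; apply: h => e e0.
have [] := cx (ball x (e%:C%C)); first by apply: nbhsx_ballx; rewrite ltcR.
move=> a [Aa]; rewrite -ball_normE /ball_ /= normE ltcR => ha.
by exists a.
Qed.

Lemma half_pow_small (c e : R) : 0 < e -> exists n, c / 2 ^+ n < e.
Proof.
move=> e0; have [n cn] : exists n : nat, `|c| / e < n%:R.
  exists (Num.truncn (`|c| / e)).+1; exact: truncnS_gt.
exists n; rewrite ltr_pdivrMr ?exprn_gt0 // mulrC -ltr_pdivrMr //.
apply: le_lt_trans (_ : `|c| / e < _); first by rewrite ler_pM2r ?invr_gt0 // ler_norm.
apply: lt_le_trans cn _; rewrite -natrX ler_nat; exact/ltnW/ltn_expl.
Qed.

Lemma geometric_limit (u : nat -> Z) (c : R) :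
  (forall n m, (n <= m)%N -> rnorm (u m - u n) <= c / 2 ^+ n) ->
  exists l, forall n, rnorm (l - u n) <= c / 2 ^+ n.
Proof.
move=> hu.
have : cvg (u @ \oo).
  apply: cauchy_cvg; apply: cauchy_exP => e e0.
  have e0' : 0 < complex.Re e by move: e0; rewrite ltcE /= => /andP[].
  have [n hn] := half_pow_small c e0'.
  exists (u n), n => // m /= nm; rewrite -ball_normE /ball_ /= distrC normE.
  have -> : e = (complex.Re e)%:C%C.
    by move: e0; case: (e) => a b; rewrite ltcE /= => /andP[/eqP ->].
  by rewrite ltcR; exact: le_lt_trans (hu _ _ nm) hn.
move=> /cvg_ex[l ul]; exists l => n; apply/ler_addgt0Pr => e e0.
have : \forall m \near \oo, `|l - u m| < e%:C%C.
  by move/cvgrPdist_lt : ul; apply; rewrite ltcR.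
move=> [N _ hN]; have := hN (maxn N n) (leq_maxl _ _); rewrite normE ltcR => h1.
apply: le_trans (rnorm_tri (u (maxn N n)) _ _) _; rewrite addrC lerD //; last exact: ltW.
by apply: hu; exact: leq_maxr.
Qed.

(** Baire's theorem in the form that one of the sets is dense in some ball. Otherwise every ball
    contains a smaller closed ball that avoids the next set, and the centres converge to a point
    outside all of them. *)
Lemma baire_cover (B : nat -> set Z) : (forall z, exists n, B n z) ->
  exists n z (r : R), 0 < r /\ forall y, rnorm (y - z) < r ->
    forall e : R, 0 < e -> exists2 b, B n b & rnorm (y - b) < e.
Proof.
move=> cov; apply: contrapT => hn.
have step (p : nat * (Z * R)) : exists q : Z * R, 0 < p.2.2 ->
    [/\ 0 < q.2, q.2 <= p.2.2 / 2, forall x, rnorm (x - q.1) <= q.2 -> rnorm (x - p.2.1) <= p.2.2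
    & forall x, rnorm (x - q.1) <= q.2 -> ~ B p.1 x].
  case: p => n [z r] /=; have [r0|] := pselect (0 < r); last by move=> h; exists (0, 0).
  have : exists y, rnorm (y - z) < r /\ exists2 e : R, 0 < e & forall b, B n b -> e <= rnorm (y - b).
    apply: contrapT => h; apply: hn; exists n, z, r; split => // y yr e e0.
    apply: contrapT => h'; apply: h; exists y; split => //; exists e => // b Bb.
    by rewrite leNgt; apply/negP => yb; apply: h'; exists b.
  move=> [y [yr [e e0 he]]].
  (* [e / 2] keeps the closed ball off [B n], the second bound keeps it inside the old ball, the
     third makes the radii decrease geometrically. *)
  pose r' := Num.min (e / 2) (Num.min (r - rnorm (y - z)) (r / 2)).
  have r'e : r' <= e / 2 by rewrite ge_min lexx.
  have r'r : r' <= r - rnorm (y - z) by rewrite !ge_min lexx /= orbT.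
  have r'2 : r' <= r / 2 by rewrite !ge_min lexx !orbT.
  exists (y, r') => _ /=; split => //.
  - by rewrite !lt_min subr_gt0 yr !divr_gt0.
  - by move=> x xy; apply: le_trans (rnorm_tri y _ _) _; lra.
  - move=> x xy /he; rewrite rnormBC => ex; lra.
have [f hf] := choice step.
pose s := fix s n := if n is m.+1 then f (m, s m) else (0 : Z, 1 : R).
have s0 n : 0 < (s n).2.
  by elim: n => [|n IH] //=; have [] := hf (n, s n) IH.
have s2 n : (s n).2 <= 1 / 2 ^+ n.
  elim: n => [|n IH] /=; first by rewrite expr0 divr1.
  have [_ h _ _] := hf (n, s n) (s0 n); apply: le_trans h _ => /=.
  by rewrite exprS invfM mulrA [X in _ <= X]mulrAC ler_pM2r // invr_gt0.
have nest n m : (n <= m)%N -> forall x, rnorm (x - (s m).1) <= (s m).2 ->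
    rnorm (x - (s n).1) <= (s n).2.
  move=> /subnK <-; elim: (m - n)%N => [|k IH] // x; rewrite addSn /= => h.
  apply: IH; have [_ _ h' _] := hf ((k + n)%N, s (k + n)%N) (s0 _); exact: h'.
have nest' n m : (n <= m)%N -> rnorm ((s m).1 - (s n).1) <= (s n).2.
  by move=> nm; apply: (nest n m nm); rewrite subrr rnorm0 ltW.
have [l hl] := @geometric_limit (fun n => (s n).1) 1
  (fun n m nm => le_trans (nest' n m nm) (s2 n)).
have [n Bn] := cov l.
have [_ _ _] := hf (n, s n) (s0 n); apply; last exact: Bn.
rewrite -[f _]/(s n.+1); apply/ler_addgt0Pr => e e0.
have [k hk] := half_pow_small 1 e0.
apply: le_trans (rnorm_tri (s (maxn k n.+1)).1 _ _) _; rewrite addrC lerD //.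
  by apply: nest'; exact: leq_maxr.
apply: le_trans (hl _) (le_trans _ (ltW hk)).
by rewrite !mul1r lef_pV2 ?posrE ?exprn_gt0 // ler_weXn2l // ?ler1n // leq_maxl.
Qed.

Section Sums.
Variables (I : finType).
Implicit Types (M : I -> set Z).

Definition approx_solvable M (c : R) : Prop := forall z, exists x : I -> Z,
  [/\ forall i, M i (x i), forall i, rnorm (x i) <= c * rnorm z
    & rnorm (z - \sum_i x i) <= rnorm z / 2].

Definition solvable M (c : R) : Prop := forall z, exists x : I -> Z,
  [/\ forall i, M i (x i), forall i, rnorm (x i) <= c * rnorm z & z = \sum_i x i].

(** The residue is halved at each step, so the corrections to one summand form a geometric series of
    total at most [2 * c * rnorm z]; closedness keeps its limit in [M i]. *)
Lemma successive_approximation M c : 0 <= c -> (forall i, lin_sub (M i)) ->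
  (forall i, closed (M i)) -> approx_solvable M c -> solvable M (2 * c).
Proof.
move=> c0 sM cM /choice[f hf] z.
pose w := fix w n := if n is m.+1 then w m - \sum_i f (w m) i else z.
have wn n : rnorm (w n) <= rnorm z / 2 ^+ n.
  elim: n => [|n IH] /=; first by rewrite expr0 divr1.
  have [_ _ h] := hf (w n); apply: le_trans h _.
  by rewrite exprS invfM [2^-1 * _]mulrC mulrA ler_pM2r // invr_gt0.
pose S i n := \sum_(k < n) f (w k) i.
have Sstep i n : rnorm (f (w n) i) <= c * rnorm z / 2 ^+ n.
  have [_ h _] := hf (w n); apply: le_trans (h i) _.
  by rewrite -mulrA ler_wpM2l.
have Sc i n m : (n <= m)%N -> rnorm (S i m - S i n) <= 2 * c * rnorm z / 2 ^+ n.
  move=> /subnK <-; set k := (m - n)%N.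
  have : rnorm (S i (k + n)%N - S i n) <= 2 * c * rnorm z / 2 ^+ n - 2 * c * rnorm z / 2 ^+ (k + n).
    elim: k => [|k IH]; first by rewrite add0n !subrr rnorm0.
    rewrite addSn {1}/S big_ord_recr /= -/(S i (k + n)%N) addrAC.
    apply: le_trans (rnormD _ _) _; apply: le_trans (lerD IH (Sstep i _)) _.
    rewrite exprS invfM.
    have : 0 <= (2 ^+ (k + n))^-1 :> R by rewrite invr_ge0 exprn_ge0.
    set a := (2 ^+ (k + n))^-1; set b := (2 ^+ n)^-1 => a0.
    by rewrite le_eqVlt; apply/orP; left; apply/eqP; field.
  move=> h; apply: le_trans h _; rewrite gerBl //.
  by rewrite !mulr_ge0 ?rnorm_ge0 // invr_ge0 exprn_ge0.
have /choice[x hx] : forall i, exists l, forall n, rnorm (l - S i n) <= 2 * c * rnorm z / 2 ^+ n.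
  by move=> i; apply: geometric_limit => n m; exact: Sc.
have zS n : z - \sum_i S i n = w n.
  elim: n => [|n IH] /=; first by rewrite big1 ?subr0 // => i _; rewrite /S big_ord0.
  rewrite -{1}IH -addrA -opprD -big_split /=; congr (z - _); apply: eq_bigr => i _.
  by rewrite /S big_ord_recr.
exists x; split.
- move=> i; apply: closedP => // e e0.
  have [n hn] := half_pow_small (2 * c * rnorm z) e0.
  exists (S i n); last exact: le_lt_trans (hx i n) hn.
  by apply: sub_sum => // k _; have [h _ _] := hf (w k).
- by move=> i; have := hx i 0%N; rewrite /S big_ord0 subr0 expr0 divr1.
- apply/eqP; rewrite -subr_eq0; apply/eqP/rnorm_eq0/le_anti; rewrite rnorm_ge0 andbT.
  apply/ler_addgt0Pr => e e0; rewrite add0r.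
  pose b := rnorm z + \sum_(i : I) (2 * c * rnorm z).
  have [n hn] := half_pow_small b e0; apply: le_trans (ltW hn).
  have -> : z - \sum_i x i = (z - \sum_i S i n) - \sum_i (x i - S i n).
    by rewrite sumrB opprB addrA subrK.
  apply: le_trans (rnormB _ _) _; rewrite zS /b mulrDl lerD // mulr_suml.
  by apply: le_trans (rnorm_sum _ _ _) _; apply: ler_sum => i _.
Qed.

(** The open mapping theorem for the addition map on a product of closed subspaces. *)
Lemma open_mapping M : (forall i, lin_sub (M i)) -> (forall i, closed (M i)) ->
  (forall z, exists2 x : I -> Z, forall i, M i (x i) & z = \sum_i x i) ->
  exists2 c : R, 0 <= c & solvable M c.
Proof.
move=> sM cM sol.
pose B n : set Z := [set z | exists x : I -> Z,
  [/\ forall i, M i (x i), forall i, rnorm (x i) <= n%:R & z = \sum_i x i]].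
have cov z : exists n, B n z.
  have [x Mx zx] := sol z; exists (Num.truncn (\sum_i rnorm (x i))).+1, x; split => // i.
  apply: le_trans (ltW (truncnS_gt _)); rewrite (bigD1 i) //= lerDl.
  by apply: sumr_ge0 => j _; exact: rnorm_ge0.
have [n [z0 [r [r0 hr]]]] := baire_cover cov.
exists (2 * (4 * n%:R / r)); first by rewrite !mulr_ge0 // invr_ge0 ltW.
apply: successive_approximation => //; first by rewrite !mulr_ge0 // invr_ge0 ltW.
move=> z; have [->|z1] := eqVneq z 0.
  exists (fun=> 0); split => [i|i|]; first exact: sub0.
    by rewrite !rnorm0 mulr0.
  by rewrite big1 // subr0 rnorm0 mul0r.
have zp : 0 < rnorm z.
  by rewrite lt_neqAle rnorm_ge0 andbT; apply: contra z1 => /eqP h; rewrite (rnorm_eq0 (esym h)).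
(* [a z] has norm [r / 2], so [z0] and [a z + z0] both lie in the ball. The difference of their
   approximate decompositions, each within [a * rnorm z / 4], divided by [a], decomposes [z] up to
   half its norm, with summands at most [2 n / a = (4 n / r) * rnorm z]. *)
pose a : R := r / (2 * rnorm z).
have a0 : 0 < a by rewrite divr_gt0 // mulr_gt0.
have az : rnorm (a%:C%C *: z) = r / 2.
  by rewrite rnormZ rnormC gtr0_norm // /a invfM -!mulrA mulVf ?mulr1 // gt_eqF.
have e0 : 0 < a * rnorm z / 4 by rewrite divr_gt0 // mulr_gt0.
have h1 : rnorm (z0 - z0) < r by rewrite subrr rnorm0.
have h2 : rnorm (a%:C%C *: z + z0 - z0) < r.
  by rewrite addrK az ltr_pdivrMr // ltr_pMr // ltr1n.
have [b [x [Mx xn ->]] hb] := hr _ h1 _ e0.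
have [b' [x' [Mx' xn' ->]] hb'] := hr _ h2 _ e0.
exists (fun i => (a^-1)%:C%C *: (x' i - x i)); split.
- by move=> i; apply: subZ => //; exact: subB.
- move=> i; rewrite rnormZ rnormC gtr0_norm ?invr_gt0 //.
  rewrite mulrC ler_pdivrMr //; apply: le_trans (rnormB _ _) _.
  apply: le_trans (lerD (xn' i) (xn i)) _; rewrite /a.
  rewrite le_eqVlt; apply/orP; left; apply/eqP; field.
  by rewrite !gt_eqF.
- rewrite -scaler_sumr sumrB.
  have -> : z = (a^-1)%:C%C *: (a%:C%C *: z).
    by rewrite scalerA -rmorphM mulVf ?gt_eqF // scale1r.
  rewrite -scalerBr !(rnormZ (a^-1)%:C%C) rnormC gtr0_norm ?invr_gt0 //.
  rewrite -mulrA ler_pM2l ?invr_gt0 //.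
  have -> : a%:C%C *: z - (\sum_i x' i - \sum_i x i) =
     (a%:C%C *: z + z0 - \sum_i x' i) - (z0 - \sum_i x i).
    by rewrite !opprB addrA [RHS]addrAC [X in _ = X - _]addrACA subrr addr0.
  apply: le_trans (rnormB _ _) _; rewrite rnormZ rnormC gtr0_norm //.
  lra.
Qed.

End Sums.
End Completeness.

(** * One-sided convergence of subspaces and uniform decompositions *)

Section Convergence.
Variables (R : realType) (Z : completeNormedModType R[i]).
Variables (T : Type) (F : set_system T) (FF : Filter F).
Implicit Types (M N : set Z) (P : T -> set Z).

(** The homogeneous form of a bound on the semigap; [lsc] and [usc] are the two halves of gap
    convergence. *)
Definition near_sub (e : R) M N : Prop :=
  forall x, M x -> exists2 y, N y & rnorm (x - y) <= e * rnorm x.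

Definition lsc P M : Prop := forall e : R, 0 < e -> \forall t \near F, near_sub e M (P t).
Definition usc P M : Prop := forall e : R, 0 < e -> \forall t \near F, near_sub e (P t) M.

Lemma lsc_cst M : lsc (fun=> M) M.
Proof.
move=> e e0; apply: filterE => t x Mx; exists x => //.
by rewrite subrr rnorm0 mulr_ge0 ?rnorm_ge0 // ltW.
Qed.

Lemma lsc_eq P P' M : (\forall t \near F, P t = P' t) -> lsc P M -> lsc P' M.
Proof. by move=> E l e e0; apply: filterS2 E (l e e0) => t ->. Qed.

Lemma usc_eq P P' M : (\forall t \near F, P t = P' t) -> usc P M -> usc P' M.
Proof. by move=> E l e e0; apply: filterS2 E (l e e0) => t ->. Qed.

Lemma lsc_point P M x (e : R) : lsc P M -> M x -> 0 < e ->
  \forall t \near F, exists2 y, P t y & rnorm (x - y) <= e.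
Proof.
move=> h Mx e0; have d0 : 0 < e / (rnorm x + 1).
  by rewrite divr_gt0 // ltr_wpDl ?rnorm_ge0.
apply: filterS (h _ d0) => t /(_ x Mx)[y Py hy]; exists y => //; apply: le_trans hy _.
have x0 := rnorm_ge0 x; rewrite mulrAC ler_pdivrMr; last by lra.
by rewrite ler_pM2l //; lra.
Qed.

Section Solvability.
Variables (I : finType) (P : I -> T -> set Z) (M : I -> set Z).
Hypotheses (sM : forall i, lin_sub (M i)) (cM : forall i, closed (M i)).
Hypothesis sP : \forall t \near F, forall i, lin_sub (P i t) /\ closed (P i t).
Hypothesis lscP : forall i, lsc (P i) (M i).
Hypothesis sol : forall z, exists2 x : I -> Z, forall i, M i (x i) & z = \sum_i x i.

(** A decomposition along the limits [M i] is moved into the [P i t]. The error is a small multiple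
    of [rnorm z], which successive approximation removes. *)
Lemma uniform_solvability : exists2 c : R, 0 <= c & \forall t \near F, solvable (fun i => P i t) c.
Proof.
have [c c0 hc] := open_mapping sM cM sol.
exists (2 * (2 * c)); first by rewrite !mulr_ge0.
pose n : R := #|I|%:R; have n0 : 0 <= n by exact: ler0n.
(* This makes the total error [n * e * c * rnorm z] at most half of [rnorm z]. In the final constant
   one factor 2 pays for moving the summands ([e <= 1]), the other for the iteration. *)
pose e : R := (2 * (n + 1) * (c + 1))^-1.
have e0 : 0 < e by rewrite invr_gt0 !mulr_gt0 //; lra.
have e1 : e <= 1.
  rewrite invf_le1; last by rewrite !mulr_gt0 //; lra.
  have : 0 <= n * c by exact: mulr_ge0.
  by nra.
have : \forall t \near F, forall i, near_sub e (M i) (P i t).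
  by apply: filter_forall => i; exact: lscP.
apply: filterS2 sP => t sPt close.
apply: successive_approximation; [by rewrite mulr_ge0|by move=> i; case: (sPt i)|by move=> i; case: (sPt i)|].
move=> z; have [x [Mx xc zx]] := hc z.
have /choice[y hy] : forall i, exists y, P i t y /\ rnorm (x i - y) <= e * rnorm (x i).
  by move=> i; have [y] := close i _ (Mx i); exists y.
have z0 := rnorm_ge0 z.
exists y; split.
- by move=> i; case: (hy i).
- move=> i; have -> : y i = x i - (x i - y i) by rewrite subKr.
  apply: le_trans (rnormB _ _) _; have [_ h] := hy i; have := xc i.
  have := rnorm_ge0 (x i); nra.
- rewrite {1}zx -sumrB; apply: le_trans (rnorm_sum _ _ _) _.
  apply: (@le_trans _ _ (\sum_(i : I) (e * (c * rnorm z)))).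
    apply: ler_sum => i _; have [_ h] := hy i; apply: le_trans h _.
    by rewrite ler_pM2l.
  have -> : \sum_(i : I) (e * (c * rnorm z)) = n * (e * (c * rnorm z)).
    by rewrite sumr_const -mulr_natl.
  have E : e * (2 * (n + 1) * (c + 1)) = 1.
    by rewrite mulVf // gt_eqF // !mulr_gt0 //; lra.
  have -> : n * (e * (c * rnorm z)) = (e * (2 * n * c)) * rnorm z / 2 by field.
  rewrite ler_pM2r ?invr_gt0 // -[leRHS]mul1r ler_wpM2r //.
  have := mulr_ge0 (ltW e0) n0; have := mulr_ge0 (ltW e0) c0.
  by lra.
Qed.

(** The summands are approximated one by one; the defect of their sum is decomposed with a uniform
    bound and added back. As the sum is kept exactly, linear relations can be carried from one time
    to another. *)
Lemma lift_decomposition (x : I -> Z) (e : R) : (forall i, M i (x i)) -> 0 < e ->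
  \forall t \near F, exists y : I -> Z,
    [/\ forall i, P i t (y i), forall i, rnorm (x i - y i) <= e & \sum_i y i = \sum_i x i].
Proof.
move=> Mx e0; have [c c0 hc] := uniform_solvability.
pose n : R := #|I|%:R; have n0 : 0 <= n by exact: ler0n.
pose d : R := e / (1 + c * n).
have q0 : 0 < 1 + c * n by rewrite ltr_pwDl // mulr_ge0.
have d0 : 0 < d by rewrite divr_gt0.
have : \forall t \near F, forall i, exists2 y, P i t y & rnorm (x i - y) <= d.
  by apply: filter_forall => i; apply: (lsc_point (lscP i)).
apply: filterS3 sP hc => t sPt hct ht.
have /choice[y hy] : forall i, exists y, P i t y /\ rnorm (x i - y) <= d.
  by move=> i; have [y] := ht i; exists y.
have [w [Pw wc wE]] := hct (\sum_i (x i - y i)).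
exists (fun i => y i + w i); split.
- by move=> i; apply: subD => //; [case: (sPt i)|case: (hy i)].
- move=> i; rewrite opprD addrA; apply: le_trans (rnormB _ _) _.
  have [_ h1] := hy i.
  have h2 : rnorm (\sum_i (x i - y i)) <= n * d.
    apply: le_trans (rnorm_sum _ _ _) _; rewrite /n mulr_natl -sumr_const.
    by apply: ler_sum => k _; case: (hy k).
  have h3 := wc i.
  have h4 : c * rnorm (\sum_i (x i - y i)) <= c * (n * d) by exact: ler_wpM2l.
  have : d * (1 + c * n) = e by rewrite divfK // gt_eqF.
  lra.
- by rewrite big_split /= -wE sumrB addrC subrK.
Qed.

End Solvability.
End Convergence.

(** * The Hermitian form of a pair of Lagrangian subspaces *)

Section Dual.
Variables (C : numClosedFieldType) (Z : lmodType C).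
Variable om : {hermitian Z for true & @Num.conj C}.

Definition fspan n (v : 'I_n -> Z) : set Z := [set x | exists c, x = lc c v].

Lemma lin_sub_fspan n (v : 'I_n -> Z) : lin_sub (fspan v).
Proof.
split; first by exists 0; rewrite lc0.
by move=> a x y [c ->] [c' ->]; exists (a *: c + c'); rewrite lcP.
Qed.

Lemma fspan_in n (v : 'I_n -> Z) i : fspan v (v i).
Proof. by exists (delta_mx 0 i); rewrite lc_delta. Qed.

Lemma fspan_sub n (v : 'I_n -> Z) (A : set Z) : lin_sub A -> (forall i, A (v i)) -> fspan v `<=` A.
Proof. by move=> sA Av _ [c ->]; exact: sub_lc. Qed.

Lemma fspan_dim n (v : 'I_n -> Z) : indep_mod [set 0] v -> has_dim_mod (fspan v) [set 0] n.
Proof.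
move=> iv; apply/has_dim_modP; exists v; split => //; split; first exact: fspan_in.
by move=> _ [c ->]; exists c; rewrite subrr.
Qed.

(** The Gram matrix of [e] against a basis of [D'] modulo the annihilator of the span of [e] is row
    free. The columns of a right inverse, conjugated because [om] is conjugate-linear in its second
    variable, give the dual vectors. *)
Lemma dual_family m (D N D' : set Z) (e : 'I_m -> Z) :
  lin_sub D -> lin_sub N -> lin_sub D' -> (forall i, D (e i)) -> indep_mod N e ->
  (forall x, D x -> (forall y, D' y -> om x y = 0) -> N x) ->
  exists2 z : 'I_m -> Z, forall j, D' (z j) & forall i j, om (e i) (z j) = (i == j)%:R.
Proof.
move=> sD sN sD' De ie nd.
pose N' := D' `&` annihilator om (fspan e).
have i0 : indep_mod [set 0] e by move=> c /= c0; apply: ie; rewrite c0; exact: sub0.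
have sN' : lin_sub N' by apply: lin_subI => //; exact: lin_sub_ann.
have [m' _ hm'] : exists2 m', (m' <= m)%N & has_dim_mod D' N' m'.
  apply: (pairing_findim (om := om) sD' sN' (fspan_dim i0)) => //.
  by move=> x y _ ->; rewrite linear0r.
have [b [sb _]] := (has_dim_modP _ _ _).1 hm'.
have sE := lin_sub_fspan e.
have : row_free (\matrix_(i, j) om (e i) (b j)).
  apply: (pairing_ker sE (@fspan_in _ e) ie sb).
    by move=> x y Ex [_ h]; apply: om_sym0; exact: h.
  by move=> x /(fspan_sub sD De); exact: nd.
set G := \matrix_(i, j) _ => fG.
exists (fun j => lc (\row_k ((pinvmx G) k j)^*) b).
  by move=> j; apply: sub_lc => // k; case: sb.
move=> i j; rewrite om_lcr; have /matrixP/(_ i j) := mulmxVp fG; rewrite !mxE => <-.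
by apply: eq_bigr => k _; rewrite !mxE conjCK mulrC.
Qed.

End Dual.

(** * Estimates for coefficient vectors *)

Section EllOne.
Variable R : realType.

Definition l1 n (c : 'rV[R[i]]_n) : R := \sum_i rnorm (c 0 i).

Lemma l1_ge0 n (c : 'rV[R[i]]_n) : 0 <= l1 c.
Proof. by apply: sumr_ge0 => i _; exact: rnorm_ge0. Qed.

Lemma l1_eq0 n (c : 'rV[R[i]]_n) : l1 c <= 0 -> c = 0.
Proof.
move=> h; have /eqP : l1 c = 0 by apply/eqP; rewrite eq_le h l1_ge0.
rewrite psumr_eq0 => [/allP h0|i _]; last exact: rnorm_ge0.
apply/rowP => i; rewrite mxE; apply: rnorm_eq0; apply/eqP.
by apply: h0; rewrite mem_index_enum.
Qed.

Lemma l1D n (c c' : 'rV[R[i]]_n) : l1 (c + c') <= l1 c + l1 c'.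
Proof. by rewrite -big_split; apply: ler_sum => i _; rewrite mxE; exact: rnormD. Qed.

Lemma l1N n (c : 'rV[R[i]]_n) : l1 (- c) = l1 c.
Proof. by apply: eq_bigr => i _; rewrite mxE rnormN. Qed.

Lemma rnorm_dot n (c d : 'I_n -> R[i]) (b : R) : (forall i, rnorm (d i) <= b) ->
  rnorm (\sum_i c i * d i) <= (\sum_i rnorm (c i)) * b.
Proof.
move=> h; apply: le_trans (rnorm_sum _ _ _) _; rewrite mulr_suml.
by apply: ler_sum => i _; rewrite rnormM ler_wpM2l ?rnorm_ge0.
Qed.

Lemma l1_mul m n (c : 'rV[R[i]]_m) (E : 'M[R[i]]_(m, n)) (eta : R) :
  (forall i j, rnorm (E i j) <= eta) -> l1 (c *m E) <= n%:R * eta * l1 c.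
Proof.
move=> h; apply: (@le_trans _ _ (\sum_(j < n) (l1 c * eta))).
  apply: ler_sum => j _; rewrite mxE; exact: rnorm_dot.
by rewrite sumr_const card_ord -[X in X <= _]mulr_natl mulrA mulrAC.
Qed.

Lemma near_id n (c : 'rV[R[i]]_n) (M : 'M[R[i]]_n) (eta : R) :
  (forall i j, rnorm (M i j - (i == j)%:R) <= eta) ->
  (1 - n%:R * eta) * l1 c <= l1 (c *m M).
Proof.
move=> h; have : l1 (c *m (M - 1%:M)) <= n%:R * eta * l1 c.
  by apply: l1_mul => i j; rewrite !mxE; exact: h.
have -> : c *m M = c + c *m (M - 1%:M) by rewrite mulmxBr mulmx1 addrC subrK.
have : l1 c <= l1 (c + c *m (M - 1%:M)) + l1 (c *m (M - 1%:M)).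
  rewrite -{1}[c](addrK (c *m (M - 1%:M))); apply: le_trans (l1D _ _) _.
  by rewrite l1N.
lra.
Qed.

Lemma near_id_inj n (c : 'rV[R[i]]_n) (M : 'M[R[i]]_n) (eta : R) :
  (forall i j, rnorm (M i j - (i == j)%:R) <= eta) -> n%:R * eta < 1 ->
  c *m M = 0 -> c = 0.
Proof.
move=> h e1 cM; apply: l1_eq0; have := near_id c h; rewrite cM.
have -> : l1 (0 : 'rV[R[i]]_n) = 0 by apply: big1 => i _; rewrite mxE rnorm0.
by rewrite pmulr_rle0 // subr_gt0.
Qed.

Lemma sum_sqr n (a : 'I_n -> R) : (\sum_i a i) ^+ 2 <= n%:R * \sum_i a i ^+ 2.
Proof.
elim: n a => [|n IH] a; first by rewrite !big_ord0 expr0n mulr0.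
rewrite !big_ord_recr /=; set s := \sum_(i < n) _; set q := \sum_(i < n) _ ^+ 2.
have h : s ^+ 2 <= n%:R * q := IH (fun i => a (widen_ord (leqnSn n) i)).
set x := a ord_max.
have h2 : 2 * s * x <= q + n%:R * x ^+ 2.
  have : 0 <= \sum_(i < n) (a (widen_ord (leqnSn n) i) - x) ^+ 2.
    by apply: sumr_ge0 => i _; exact: sqr_ge0.
  rewrite (_ : \sum_(i < n) _ = q + (- (2 * x)) * s + n%:R * x ^+ 2); first by lra.
  rewrite /q /s mulr_sumr -big_split /=.
  have -> : n%:R * x ^+ 2 = \sum_(i < n) x ^+ 2 by rewrite sumr_const card_ord mulr_natl.
  by rewrite -big_split; apply: eq_bigr => i _ /=; ring.
rewrite -natr1; lra.
Qed.

Variable Z : normedModType R[i].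

Lemma rnorm_lc n (c : 'rV[R[i]]_n) (b : 'I_n -> Z) (B : R) :
  (forall i, rnorm (b i) <= B) -> rnorm (lc c b) <= l1 c * B.
Proof.
move=> h; apply: le_trans (rnorm_sum _ _ _) _; rewrite mulr_suml.
by apply: ler_sum => i _; rewrite rnormZ ler_wpM2l ?rnorm_ge0.
Qed.

Lemma family_bound n (b : 'I_n -> Z) : exists2 B : R, 0 <= B & forall i, rnorm (b i) <= B.
Proof.
exists (\sum_i rnorm (b i)); first by apply: sumr_ge0 => i _; exact: rnorm_ge0.
by move=> i; rewrite (bigD1 i) //= lerDl; apply: sumr_ge0 => j _; exact: rnorm_ge0.
Qed.

End EllOne.

Section BoundedForms.
Variables (R : realType) (Z : completeNormedModType R[i]).
Variable om : {hermitian Z for true & @Num.conj R[i]}.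

Definition om_bound (B : R) : Prop := 0 <= B /\ forall x y, rnorm (om x y) <= B * rnorm x * rnorm y.

Lemma om_boundP : form_bounded om -> exists B, om_bound B.
Proof.
move=> [B hB]; exists `|B|; split => // x y; apply: le_trans (hB _ _) _.
by rewrite -!mulrA ler_wpM2r ?mulr_ge0 ?rnorm_ge0 // ler_norm.
Qed.

Lemma closed_ann A : form_bounded om -> closed (annihilator om A).
Proof.
move=> /om_boundP[B [B0 hB]]; apply: closed_of_approx => x hx y Ay.
apply/rnorm_eq0/le_anti; rewrite rnorm_ge0 andbT; apply/ler_addgt0Pr => e e0; rewrite add0r.
have y0 := rnorm_ge0 y.
have p : 0 < B * rnorm y + 1 by rewrite ltr_wpDl // mulr_ge0.
have [a Aa ha] := hx _ (divr_gt0 e0 p).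
have -> : om x y = om (x - a) y by rewrite linearBl /= (Aa _ Ay) subr0.
apply: le_trans (hB _ _) _.
have : rnorm (x - a) * (B * rnorm y + 1) <= e by rewrite -ler_pdivlMr // ltW.
have := rnorm_ge0 (x - a).
lra.
Qed.

Hypothesis om_symp : symplectic om.

(** A dual family defines a bounded projection [L] onto the span, and the span is its set of fixed
    points. *)
Lemma closed_fspan n (v : 'I_n -> Z) : indep_mod [set 0] v -> closed (fspan v).
Proof.
move=> iv; have [bd nd] := om_symp.
have [z _ hz] : exists2 z : 'I_n -> Z, forall j, [set: Z] (z j) &
    forall i j, om (v i) (z j) = (i == j)%:R.
  apply: (@dual_family _ _ _ _ setT [set 0]) => //.
  - exact: lin_sub0.
  - by move=> x _ h; apply: nd => y; exact: h.
have [B [B0 hB]] := om_boundP bd.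
pose L x := lc (\row_j om x (z j)) v.
have LB x y : L (x - y) = L x - L y.
  by rewrite /L -lcB; congr lc; apply/rowP => j; rewrite !mxE linearBl.
have Lv c : L (lc c v) = lc c v.
  rewrite /L; congr lc; apply/rowP => j; rewrite mxE om_lcl (bigD1 j) //=.
  by rewrite hz eqxx mulr1 big1 ?addr0 // => i /negbTE ij; rewrite hz ij mulr0.
have [V V0 hV] := family_bound v; have [W W0 hW] := family_bound z.
pose K := n%:R * (B * W) * V.
have K0 : 0 <= K by rewrite !mulr_ge0.
have LK x : rnorm (L x) <= K * rnorm x.
  apply: le_trans (rnorm_lc _ hV) _; rewrite /K mulrAC ler_wpM2r //.
  apply: (@le_trans _ _ (\sum_(i < n) (B * W * rnorm x))).
    apply: ler_sum => i _; rewrite mxE; apply: le_trans (hB _ _) _.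
    by rewrite mulrAC ler_wpM2r ?rnorm_ge0 // ler_wpM2l.
  by rewrite sumr_const card_ord -[X in X <= _]mulr_natl mulrA.
apply: closed_of_approx => x hx; exists (\row_j om x (z j)); rewrite -/(L x).
apply/eqP; rewrite -subr_eq0; apply/eqP/rnorm_eq0/le_anti; rewrite rnorm_ge0 andbT.
apply/ler_addgt0Pr => e e0; rewrite add0r.
have p : 0 < 1 + K by rewrite ltr_pwDl.
have [a [c ac] ha] := hx _ (divr_gt0 e0 p).
have -> : x - L x = (x - a) - L (x - a).
  by rewrite LB ac Lv opprB addrA subrK.
apply: le_trans (rnormB _ _) _; have := LK (x - a).
have : rnorm (x - a) * (1 + K) <= e by rewrite -ler_pdivlMr // ltW.
lra.
Qed.

End BoundedForms.

Section Qhat.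
Variables (C : numClosedFieldType) (Z : lmodType C).
Variable om : {hermitian Z for true & @Num.conj C}.

(* For e = (x + y, x + y') and f = (x' + z, x' + z') in lam x mu, where x and x' are
   in X and the other vectors in Y, this is om x (z - z') = Q(x, x'). *)
Definition qhat (e f : Z * Z) : C := 2^-1 * (om e.2 f.1 - om e.1 f.2).

Lemma qhat_herm : herm_form qhat.
Proof.
split=> [a [x1 x2] [y1 y2] [z1 z2]|[x1 x2] [y1 y2]]; rewrite /qhat /=.
  by rewrite !linearDl /= !linearZl_LR /=; ring.
rewrite [in LHS](om_skew om x1) [in LHS](om_skew om x2) rmorphM rmorphB fmorphV rmorph_nat /=.
by congr (_ * _); rewrite opprK addrC.
Qed.

Variables (lam mu : set Z).
Hypotheses (lam_lag : lagrangian om lam) (mu_lag : lagrangian om mu).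

(** In this form the second pair enters only through its difference: a product with a pair of small
    difference is small, however large that pair is. *)
Lemma qhat_diff e f : lam e.1 -> mu e.2 -> lam f.1 -> mu f.2 ->
  qhat e f = 2^-1 * om (e.1 + e.2) (f.1 - f.2).
Proof.
move=> l1 m1 l2 m2; rewrite /qhat linearDl /= !linearBr /=.
rewrite (lag_om lam_lag l1 l2) (lag_om mu_lag m1 m2) sub0r subr0 addrC.
by rewrite mulrDr mulrN.
Qed.

(** As [om] vanishes on [Y], the vectors [e.1] and [e.2] pair equally with [f.1 - f.2]; this absorbs
    the factor one half. *)
Lemma qhat_lag (Y : set Z) e f : lagrangian om Y -> diff_in lam mu Y e -> diff_in lam mu Y f ->
  qhat e f = om e.1 (f.1 - f.2).
Proof.
move=> Y_lag [l1 m1 y1] [l2 m2 y2]; rewrite qhat_diff //.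
have := lag_om Y_lag y1 y2; rewrite linearBl /= => /eqP; rewrite subr_eq0 => /eqP h.
rewrite linearDl /= -h; apply: (mulfI (_ : 2 != 0)); first by rewrite pnatr_eq0.
by rewrite mulrA mulfV ?pnatr_eq0 // mul1r mulr2n mulrDl mul1r.
Qed.

End Qhat.

(** * The dimensions at one time and the sum of the two indices *)

Section Moments.
Variables (C : numClosedFieldType) (Z : lmodType C).
Variable om : {hermitian Z for true & @Num.conj C}.
Implicit Types (X Y lam mu : set Z).

(* The data at one time: d is the dimension of lam `&` mu and, the index being 0,
   also the codimension of lam + mu; j and k are the dimensions of A `&` B and of
   Y / (A + B), where A = lam `&` Y and B = mu `&` Y. *)
Definition moment X Y lam mu (d j k : nat) : Prop :=
  [/\ forall x, (forall y, om x y = 0) -> x = 0,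
      [/\ lagrangian om X, lagrangian om Y, lagrangian om lam & lagrangian om mu],
      direct_sum X Y,
      has_dim_mod (lam `&` mu) [set 0] d /\ has_dim_mod [set: Z] (sumset lam mu) d
    & has_dim_mod (lam `&` Y `&` (mu `&` Y)) [set 0] j /\
      has_dim_mod Y (sumset (lam `&` Y) (mu `&` Y)) k].

(** By [om_DY] and [relation_kernel], the radical of [qhat] on the pairs with difference in [Y]
    consists of those with difference in [A + B]; the rank is given by [relation_rank]. *)
Lemma moment_index X Y lam mu d j k : moment X Y lam mu d j k ->
  exists p n, [/\ max_pos (signed false (qhat om)) (diff_in lam mu Y) p,
    max_pos (signed true (qhat om)) (diff_in lam mu Y) n & (p + n + d = k + j)%N].
Proof.
move=> [nd [X_lag Y_lag lam_lag mu_lag] XY [hd hd'] [hj hk]].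
have [r [hr E _ hP]] := relation_rank nd lam_lag mu_lag Y_lag hd hd' hj hk.
have slam := lag_sub lam_lag; have smu := lag_sub mu_lag; have sY := lag_sub Y_lag.
have sAB : lin_sub (sumset (lam `&` Y) (mu `&` Y)).
  by apply: lin_sub_sumset; exact: lin_subI.
have AB_Y : sumset (lam `&` Y) (mu `&` Y) `<=` Y by apply: sumset_sub => // x [].
have sE := lin_sub_diff_in lam_lag mu_lag sY.
have sN := lin_sub_diff_in lam_lag mu_lag sAB.
have NE : diff_in lam mu (sumset (lam `&` Y) (mu `&` Y)) `<=` diff_in lam mu Y.
  by move=> e [l m /AB_Y y].
have PE e : diff_in lam mu Y e -> (sumset lam Y `&` sumset mu Y) e.1.
  move=> [l m y]; split; first exact: sumset_l.
  by exists e.2 => //; exists (e.1 - e.2) => //; rewrite addrC subrK.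
have hh := qhat_herm om.
have [p [n [hp hn pn]]] : exists p n, [/\ max_pos (qhat om) (diff_in lam mu Y) p,
    max_pos (fun x y => - qhat om x y) (diff_in lam mu Y) n & (p + n = r)%N].
  apply: (max_pos_exists hh sE sN NE hr).
    move=> x y /[dup] Nx /NE Ex Ey; rewrite hh.2 (qhat_lag lam_lag mu_lag Y_lag Ey Ex).
    case: Nx => _ _ h; rewrite (om_DY lam_lag mu_lag Y_lag (PE _ Ey) (AB_Y _ h) h).
    by rewrite conjC0.
  move=> x Ex h; have [l m y] := Ex; split => //.
  apply: (relation_kernel nd lam_lag mu_lag Y_lag hd hd' hj hk y).
  move=> z [[l' ll' [y1 Yy1 E1]] [m' mm' [y2 Yy2 E2]]].
  have Ee : diff_in lam mu Y (l', m').
    split => //=; have -> : l' - m' = y2 - y1.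
      have -> : l' = z - y1 by rewrite -E1 addrK.
      have -> : m' = z - y2 by rewrite -E2 addrK.
      by rewrite opprB addrC addrA subrK.
    exact: (subB sY).
  rewrite -E1 linearDl /= (lag_om Y_lag Yy1 y) addr0.
  have := h _ Ee; rewrite hh.2 => /eqP; rewrite conjC_eq0 => /eqP.
  by rewrite (qhat_lag lam_lag mu_lag Y_lag Ee Ex).
have -> : signed false (qhat om) = qhat om.
  by apply/funext => x; apply/funext => y; rewrite /signed expr0 mul1r.
have -> : signed true (qhat om) = (fun x y => - qhat om x y).
  by apply/funext => x; apply/funext => y; rewrite /signed expr1 mulN1r.
by exists p, n; split => //; rewrite pn E.
Qed.

End Moments.

Section FourFamilies.
Variables (R : realType) (Z : completeNormedModType R[i]).
Variables (T : Type) (F : set_system T) (FF : Filter F).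
Variables (P1 P2 P3 P4 : T -> set Z) (M1 M2 M3 M4 : set Z).

(** The decompositions to be perturbed have at most four summands, as in [X + A + B + span v] or
    [lam + mu + Y + span u]; shorter ones are padded with a repeated or a null subspace. *)
Definition good_family (P : T -> set Z) (M : set Z) : Prop :=
  [/\ lin_sub M, closed M, \forall t \near F, lin_sub (P t) /\ closed (P t) & lsc F P M].

Lemma good_cst M : lin_sub M -> closed M -> good_family (fun=> M) M.
Proof. by move=> sM cM; split => //; [exact: filterE|exact: lsc_cst]. Qed.

Hypotheses (g1 : good_family P1 M1) (g2 : good_family P2 M2)
  (g3 : good_family P3 M3) (g4 : good_family P4 M4).
Hypothesis sol : forall z, exists x1 x2 x3 x4,
  [/\ M1 x1, M2 x2, M3 x3 & M4 x4] /\ z = x1 + x2 + x3 + x4.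

Let P (i : 'I_4) := nth P1 [:: P1; P2; P3; P4] i.
Let M (i : 'I_4) := nth M1 [:: M1; M2; M3; M4] i.
Let i0 : 'I_4 := inord 0. Let i1 : 'I_4 := inord 1.
Let i2 : 'I_4 := inord 2. Let i3 : 'I_4 := inord 3.

Let sum4 (x : 'I_4 -> Z) : \sum_i x i = x i0 + x i1 + x i2 + x i3.
Proof.
rewrite !big_ord_recl big_ord0 addr0 !addrA.
by congr (x _ + x _ + x _ + x _); apply: val_inj; rewrite /= inordK.
Qed.

Let good i : good_family (P i) (M i).
Proof. by case: i => [[|[|[|[|]]]]] //. Qed.

Let sM i : lin_sub (M i). Proof. by case: (good i). Qed.
Let cM i : closed (M i). Proof. by case: (good i). Qed.
Let lscP i : lsc F (P i) (M i). Proof. by case: (good i). Qed.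

Let sP : \forall t \near F, forall i, lin_sub (P i t) /\ closed (P i t).
Proof. by apply: filter_forall => i; case: (good i). Qed.

Let fam (x1 x2 x3 x4 : Z) (i : 'I_4) := nth 0 [:: x1; x2; x3; x4] i.

Let famE x1 x2 x3 x4 : \sum_i fam x1 x2 x3 x4 i = x1 + x2 + x3 + x4.
Proof. by rewrite sum4 /fam !inordK. Qed.

Let famM x1 x2 x3 x4 : M1 x1 -> M2 x2 -> M3 x3 -> M4 x4 -> forall i, M i (fam x1 x2 x3 x4 i).
Proof. by move=> ? ? ? ? [[|[|[|[|]]]]] //. Qed.

Let solM z : exists2 x : 'I_4 -> Z, forall i, M i (x i) & z = \sum_i x i.
Proof.
have [x1 [x2 [x3 [x4 [[? ? ? ?] ->]]]]] := sol z.
by exists (fam x1 x2 x3 x4); [exact: famM|rewrite famE].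
Qed.

Let get (Q : 'I_4 -> set Z) (x : 'I_4 -> Z) : (forall i, Q i (x i)) ->
  [/\ Q i0 (x i0), Q i1 (x i1), Q i2 (x i2) & Q i3 (x i3)].
Proof. by move=> h; split; exact: h. Qed.

Lemma solvability4 : exists2 c : R, 0 <= c & \forall t \near F, forall z, exists x1 x2 x3 x4,
  [/\ [/\ P1 t x1, P2 t x2, P3 t x3 & P4 t x4],
    [/\ rnorm x1 <= c * rnorm z, rnorm x2 <= c * rnorm z, rnorm x3 <= c * rnorm z
      & rnorm x4 <= c * rnorm z] & z = x1 + x2 + x3 + x4].
Proof.
have [c c0 hc] := uniform_solvability FF sM cM sP lscP solM; exists c => //.
apply: filterS hc => t ht z; have [x [Px xc zx]] := ht z.
exists (x i0), (x i1), (x i2), (x i3); rewrite zx -sum4 -zx; split => //.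
by have := @get (fun i => P i t) x Px; rewrite /P !inordK.
Qed.

Lemma lift4 x1 x2 x3 x4 (e : R) : M1 x1 -> M2 x2 -> M3 x3 -> M4 x4 -> 0 < e ->
  \forall t \near F, exists y1 y2 y3 y4,
  [/\ [/\ P1 t y1, P2 t y2, P3 t y3 & P4 t y4],
    [/\ rnorm (x1 - y1) <= e, rnorm (x2 - y2) <= e, rnorm (x3 - y3) <= e & rnorm (x4 - y4) <= e]
    & y1 + y2 + y3 + y4 = x1 + x2 + x3 + x4].
Proof.
move=> h1 h2 h3 h4 e0.
have := lift_decomposition FF sM cM sP lscP solM (famM h1 h2 h3 h4) e0.
apply: filterS => t [y [Py ye yE]]; exists (y i0), (y i1), (y i2), (y i3); split.
- by have := @get (fun i => P i t) y Py; rewrite /P !inordK.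
- by split; [have := ye i0|have := ye i1|have := ye i2|have := ye i3]; rewrite /fam inordK.
- by rewrite -sum4 yE famE.
Qed.

End FourFamilies.

Section FormContinuity.
Variables (R : realType) (Z : completeNormedModType R[i]).
Variables (T : Type) (F : set_system T) (FF : Filter F).
Variables (om : T -> {hermitian Z for true & @Num.conj R[i]}) (t0 : T).

Definition form_cvg : Prop := forall e : R, 0 < e -> \forall t \near F, forall x y,
  rnorm (om t x y - om t0 x y) <= e * rnorm x * rnorm y.

Hypotheses (om_cvg : form_cvg) (om0 : form_bounded (om t0)).

Lemma bound_near : exists2 B : R, 0 <= B & \forall t \near F, om_bound (om t) B.
Proof.
have [B [B0 hB]] := om_boundP om0; exists (B + 1); first by rewrite addr_ge0.
apply: filterS (om_cvg (ltr01)) => t ht; split; first by rewrite addr_ge0.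
move=> x y; rewrite -[om t x y](subrK (om t0 x y)); apply: le_trans (rnormD _ _) _.
have := ht x y; have := hB x y; rewrite mul1r => h1 h2.
by apply: le_trans (lerD h2 h1) _; rewrite addrC -!mulrA -[X in _ + X <= _]mul1r -mulrDl.
Qed.

Lemma form_close (W eta : R) : 0 < eta -> exists2 e : R, 0 < e & \forall t \near F,
  forall x y x' y', rnorm x <= W -> rnorm y <= W -> rnorm (x - x') <= e -> rnorm (y - y') <= e ->
  rnorm (om t x' y' - om t0 x y) <= eta.
Proof.
move=> eta0; have [B [B0 hB]] := om_boundP om0.
pose V := `|W| + 1; have V0 : 1 <= V by rewrite lerDr.
have p : 0 < V * V + 2 * B * V.
  by apply: ltr_pwDl; [rewrite mulr_gt0 //; lra|rewrite !mulr_ge0 //; lra].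
pose e := Num.min 1 (eta / (V * V + 2 * B * V)).
have e0 : 0 < e by rewrite lt_min ltr01 divr_gt0.
have e1 : e <= 1 by rewrite ge_min lexx.
have ee : e * (V * V + 2 * B * V) <= eta by rewrite -ler_pdivlMr // ge_min lexx orbT.
exists e => //; apply: filterS (om_cvg e0) => t ht x y x' y' xW yW xx yy.
have WV : W <= `|W| by exact: ler_norm.
have x'V : rnorm x' <= V.
  have := rnormB x (x - x'); rewrite subKr /V; lra.
have y'V : rnorm y' <= V.
  have := rnormB y (y - y'); rewrite subKr /V; lra.
have xV : rnorm x <= V by rewrite /V; lra.
have -> : om t x' y' - om t0 x y = (om t x' y' - om t0 x' y') -
    (om t0 (x - x') y' + om t0 x (y - y')).
  by rewrite linearBl linearBr /=; ring.
apply: le_trans (rnormB _ _) _; apply: le_trans (lerD (ht _ _) (rnormD _ _)) _.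
apply: le_trans (lerD (lexx _) (lerD (hB _ _) (hB _ _))) _.
have a0 := rnorm_ge0 x; have b0 := rnorm_ge0 y'; have c0 := rnorm_ge0 x'.
have d0 := rnorm_ge0 (x - x'); have f0 := rnorm_ge0 (y - y').
have h1 : e * rnorm x' * rnorm y' <= e * (V * V).
  by rewrite -mulrA ler_pM2l // ler_pM.
have h2 : B * rnorm (x - x') * rnorm y' <= e * (B * V).
  by rewrite -mulrA mulrCA; apply: ler_pM; rewrite ?mulr_ge0 // ler_wpM2l.
have h3 : B * rnorm x * rnorm (y - y') <= e * (B * V).
  by rewrite mulrC; apply: ler_pM; rewrite ?mulr_ge0 // ler_wpM2l.
lra.
Qed.

End FormContinuity.

Local Notation "M ^t*" := (map_mx Num.conj (M ^T)) (at level 30).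

(** * Rank counts for transported families *)

Section Counting.
Variables (C : numClosedFieldType) (Z : lmodType C).
Variable om : {hermitian Z for true & @Num.conj C}.

Lemma rank_annihilated m n p (W : 'M[C]_(m, n)) (K : 'M[C]_(p, n)) :
  row_free W -> W *m K^t* = 0 -> (m + \rank K <= n)%N.
Proof.
move=> /eqP fW /mulmx0_rank_max; rewrite fW.
by rewrite mxrank_map mxrank_tr.
Qed.

Lemma kernel_family m n (K : 'M[C]_(m, n)) : exists r (S : 'M[C]_(r, m)),
  [/\ row_free S, S *m K = 0 & (r + \rank K = m)%N].
Proof.
exists (\rank (kermx K)), (row_base (kermx K)); split.
- exact: row_base_free.
- by apply/sub_kermxP; rewrite eq_row_base.
- by rewrite mxrank_ker subnK // rank_leq_row.
Qed.

Lemma matrix_of_rows m n (v : 'I_n -> Z) (P : 'I_m -> Z -> Prop) :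
  (forall i, exists c, P i (lc c v)) -> exists K : 'M[C]_(m, n), forall i, P i (lc (row i K) v).
Proof.
move=> /choice[c hc]; exists (\matrix_i c i) => i.
by rewrite rowK.
Qed.

(** [X /\ P] has dimension [k] and is separated by [v], since it annihilates [X + A + B]. It
    annihilates the combinations of [v] given by the rows of [K] too, so [k + rank K <= k0]. A
    combination of the relations with no [v] part has [x = 0] because [X] and [Y] meet trivially, so
    its [a] part lies in [A /\ B]; hence [j0 - rank K <= j]. *)
Lemma index_count X Y lam mu d j k j0 k0 (v : 'I_k0 -> Z) (x a b : 'I_j0 -> Z)
    (K : 'M[C]_(j0, k0)) : moment om X Y lam mu d j k ->
  (forall z, exists x a b c, [/\ X x, (lam `&` Y) a & (mu `&` Y) b] /\ z = x + a + b + lc c v) ->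
  (forall i, [/\ X (x i), (lam `&` Y) (a i) & (mu `&` Y) (b i)]) ->
  (forall i, x i + a i + b i + lc (row i K) v = 0) ->
  (forall c, lc c a = 0 -> c = 0) -> (k + j0 <= k0 + j)%N.
Proof.
move=> [nd [X_lag Y_lag lam_lag mu_lag] [XY0 XYT] [hd hd'] [hj hk]] sol hxab hsum inda.
have [r [_ _ _ hP]] := relation_rank nd lam_lag mu_lag Y_lag hd hd' hj hk.
have slam := lag_sub lam_lag; have smu := lag_sub mu_lag.
have sX := lag_sub X_lag; have sY := lag_sub Y_lag.
have sA : lin_sub (lam `&` Y) by exact: lin_subI.
have sB : lin_sub (mu `&` Y) by exact: lin_subI.
pose P := sumset lam Y `&` sumset mu Y.
have YP : Y `<=` P by move=> y Yy; split; exact: sumset_r.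
have sP : lin_sub P by apply: lin_subI; exact: lin_sub_sumset.
have sXP : lin_sub (X `&` P) by exact: lin_subI.
have s0 := @lin_sub0 _ Z.
have hXP : has_dim_mod (X `&` P) [set 0] k.
  apply/(@dim_iso _ _ _ idfun _ (X `&` P) [set 0] P Y) => //.
  - by move=> z [].
  - move=> z [Xz Pz]; split=> [->|Yz]; first exact: sub0.
    by have : (X `&` Y) z by []; rewrite XY0.
  - move=> z Pz; have : [set: Z] z by []; rewrite -XYT => -[x' Xx' [y Yy E]].
    exists x'; last by rewrite /= -E addrAC subrr add0r.
    split => //; have -> : x' = z - y by rewrite -E addrK.
    by apply: subB => //; exact: YP.
have [w [[Dw sw] iw]] := (has_dim_modP _ _ _).1 hXP.
pose N' := sumset X (sumset (lam `&` Y) (mu `&` Y)).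
have vanish z y : (X `&` P) z -> N' y -> om z y = 0.
  move=> [Xz Pz] [x' Xx' [y' AB <-]]; rewrite linearDr /= (lag_om X_lag Xz Xx') add0r.
  apply: (om_DY lam_lag mu_lag Y_lag Pz _ AB).
  by case: AB => a' [_ Ya'] [b' [_ Yb'] <-]; exact: subD.
have sv : spans_mod [set: Z] N' v.
  split=> // z _; have [x' [a' [b' [c [[Xx' Aa' Bb'] ->]]]]] := sol z.
  exists c; rewrite addrK -addrA; exists x' => //; exists (a' + b') => //.
  by exists a' => //; exists b'.
have free : row_free (\matrix_(s, t) om (w s) (v t)).
  apply: (pairing_ker (om := om) sXP Dw iw sv vanish).
  by move=> z _ h; apply: nd => y; exact: h.
have WK : (\matrix_(s, t) om (w s) (v t)) *m K^t* = 0.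
  apply/matrixP => s i; rewrite !mxE.
  have : om (w s) (lc (row i K) v) = 0.
    have -> : lc (row i K) v = - (x i + a i + b i) by apply/eqP; rewrite -addr_eq0 addrC hsum.
    rewrite linearNr /= vanish ?oppr0 //.
    have [Xx Aa Bb] := hxab i.
    by rewrite -addrA; exists (x i) => //; exists (a i + b i) => //; exists (a i) => //; exists (b i).
  by rewrite om_lcr => h0; rewrite -[RHS]h0; apply: eq_bigr => t _; rewrite !mxE mulrC.
have rk := rank_annihilated free WK.
have [q [S [fS SK qE]]] := kernel_family K.
suff : (q <= j)%N by lia.
apply: (dim_le_indep s0 hj (e := fun i => lc (row i S) a)); last first.
  move=> c /=; rewrite -lc_mul => /inda cS; apply: (row_free_inj fS).
  by rewrite cS mul0mx.
move=> i /=; set c := row i S.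
have Ax : (lam `&` Y) (lc c a) by apply: sub_lc => // s; case: (hxab s).
have Bx : (mu `&` Y) (lc c b) by apply: sub_lc => // s; case: (hxab s).
have Xx : X (lc c x) by apply: sub_lc => // s; case: (hxab s).
have E : lc c x + (lc c a + lc c b) = 0.
  have cK : c *m K = 0 by rewrite /c -row_mul SK row0.
  have : lc c (fun s => x s + a s + b s + lc (row s K) v) = 0.
    by rewrite {1}/lc big1 // => s _; rewrite hsum scaler0.
  by rewrite lc_addf -lc_mul cK lc0 addr0 !lc_addf addrA.
have Y0 : Y (lc c a + lc c b) by case: Ax Bx => [_ ?] [_ ?]; exact: subD.
have x0 : lc c x = 0.
  have : (X `&` Y) (lc c x); last by rewrite XY0.
  split => //; rewrite -[lc c x](addrK (lc c a + lc c b)) E sub0r; exact: subN.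
split => //; move: E; rewrite x0 add0r => /eqP; rewrite addr_eq0 => /eqP ->.
exact: (subN sB Bx).
Qed.

(** The combinations kept are those whose difference has no [u] part. The [u] parts that occur lie
    in [lam + mu + Y], which [A /\ B] annihilates; as [u] separates [A /\ B], this gives
    [j + rank K <= j0], and at least [m + j - j0] independent combinations remain. *)
Lemma restrict_family h lam mu Y d j k m j0 (u : 'I_j0 -> Z) (e : 'I_m -> Z * Z) :
  (forall x, (forall y, om x y = 0) -> x = 0) ->
  lagrangian om lam -> lagrangian om mu -> lagrangian om Y ->
  has_dim_mod (lam `&` mu) [set 0] d -> has_dim_mod [set: Z] (sumset lam mu) d ->
  has_dim_mod (lam `&` Y `&` (mu `&` Y)) [set 0] j ->
  has_dim_mod Y (sumset (lam `&` Y) (mu `&` Y)) k ->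
  (forall z, exists l m' y c, [/\ lam l, mu m' & Y y] /\ z = l + m' + y + lc c u) ->
  (forall i, diff_in lam mu (sumset Y (fspan u)) (e i)) -> pos_fam h e ->
  exists m' (f : 'I_m' -> Z * Z), [/\ (m + j <= m' + j0)%N,
    forall i, diff_in lam mu Y (f i) & pos_fam h f].
Proof.
move=> nd lam_lag mu_lag Y_lag hd hd' hj hk sol De pe.
have slam := lag_sub lam_lag; have smu := lag_sub mu_lag; have sY := lag_sub Y_lag.
have sAB : lin_sub (lam `&` Y `&` (mu `&` Y)) by do ?apply: lin_subI.
have [w [[Dw sw] iw]] := (has_dim_modP _ _ _).1 hj.
pose N' := sumset (sumset lam mu) Y.
have vanish z y : (lam `&` Y `&` (mu `&` Y)) z -> N' y -> om z y = 0.
  move=> [[lz Yz] [mz _]] [y' [l ll [m' mm <-]] [y'' Yy <-]].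
  by rewrite !linearDr /= (lag_om lam_lag lz ll) (lag_om mu_lag mz mm) (lag_om Y_lag Yz Yy) !addr0.
have sv : spans_mod [set: Z] N' u.
  split=> // z _; have [l [m' [y [c [[ll mm Yy] ->]]]]] := sol z.
  exists c; rewrite addrK; exists (l + m'); last by exists y.
  by exists l => //; exists m'.
have free : row_free (\matrix_(s, t) om (w s) (u t)).
  apply: (pairing_ker (om := om) sAB Dw iw sv vanish).
  by move=> z _ h'; apply: nd => y; exact: h'.
have [K hK] : exists K : 'M[C]_(m, j0), forall i, Y ((e i).1 - (e i).2 - lc (row i K) u).
  apply: (@matrix_of_rows m j0 u (fun i z => Y ((e i).1 - (e i).2 - z))) => i.
  have [_ _ [y Yy [_ [c ->] <-]]] := De i; exists c.
  by rewrite addrK.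
have WK : (\matrix_(s, t) om (w s) (u t)) *m K^t* = 0.
  apply/matrixP => s i; rewrite !mxE.
  have : om (w s) (lc (row i K) u) = 0.
    have [ll mm _] := De i.
    have -> : lc (row i K) u = (e i).1 + (- (e i).2) + - ((e i).1 - (e i).2 - lc (row i K) u).
      by rewrite opprB addrC subrK.
    apply: vanish => //; exists ((e i).1 - (e i).2).
      by exists (e i).1 => //; exists (- (e i).2) => //; exact: subN.
    by exists (- ((e i).1 - (e i).2 - lc (row i K) u)) => //; apply: subN => //; exact: hK.
  by rewrite om_lcr => h0; rewrite -[RHS]h0; apply: eq_bigr => t _; rewrite !mxE mulrC.
have rk := rank_annihilated free WK.
have [q [S [fS SK qE]]] := kernel_family K.
exists q, (fun i => lc (row i S) e); split; [by lia| |exact: pos_fam_lc].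
move=> i; set c := row i S.
have fst_lc : (lc c e).1 = lc c (fun s => (e s).1).
  by apply: (@lc_linear _ _ _ (fun p : Z * Z => p.1)).
have snd_lc : (lc c e).2 = lc c (fun s => (e s).2).
  by apply: (@lc_linear _ _ _ (fun p : Z * Z => p.2)).
split.
- by rewrite fst_lc; apply: sub_lc => // s; case: (De s).
- by rewrite snd_lc; apply: sub_lc => // s; case: (De s).
- have -> : (lc c e).1 - (lc c e).2 = lc c (fun s => (e s).1 - (e s).2 - lc (row s K) u).
    by rewrite !lc_subf -lc_mul /c -row_mul SK row0 lc0 subr0 fst_lc snd_lc.
  exact: sub_lc.
Qed.

End Counting.

(** * Local comparison of indices *)

Section QhatBounds.
Variables (R : realType) (Z : completeNormedModType R[i]).

Lemma rnorm_half : rnorm (2^-1 : R[i]) = 2^-1.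
Proof.
have -> : (2^-1 : R[i]) = (2^-1 : R)%:C%C by rewrite fmorphV rmorph_nat.
by rewrite rnormC ger0_norm // invr_ge0.
Qed.

Lemma ReD (x y : R[i]) : complex.Re (x + y) = complex.Re x + complex.Re y.
Proof. by case: x y => [? ?] [? ?]. Qed.

Lemma ReB (x y : R[i]) : complex.Re (x - y) = complex.Re x - complex.Re y.
Proof. by case: x y => [? ?] [? ?]. Qed.

Lemma rnorm_signed (V : lmodType R[i]) neg (h : V -> V -> R[i]) x y :
  rnorm (signed neg h x y) = rnorm (h x y).
Proof. by rewrite /signed rnormM /rnorm normrX normrN1 expr1n mul1r. Qed.

Variable om : {hermitian Z for true & @Num.conj R[i]}.
Variables (B : R) (omB : om_bound om B).

Lemma qhat_bound (V : R) (e f : Z * Z) : rnorm e.1 <= V -> rnorm e.2 <= V ->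
  rnorm f.1 <= V -> rnorm f.2 <= V -> rnorm (qhat om e f) <= B * V * V.
Proof.
move=> e1 e2 f1 f2; rewrite rnormM rnorm_half.
have [B0 hB] := omB.
have hV x y : rnorm x <= V -> rnorm y <= V -> rnorm (om x y) <= B * V * V.
  move=> xV yV; apply: le_trans (hB _ _) _; rewrite -!mulrA ler_wpM2l // ler_pM ?rnorm_ge0 //.
have := rnormB (om e.2 f.1) (om e.1 f.2); have := hV _ _ e2 f1; have := hV _ _ e1 f2.
lra.
Qed.

Lemma qhat_diff_bound (lam mu : set Z) (V : R) (e f : Z * Z) :
  lagrangian om lam -> lagrangian om mu -> lam e.1 -> mu e.2 -> lam f.1 -> mu f.2 ->
  rnorm e.1 <= V -> rnorm e.2 <= V -> rnorm (qhat om e f) <= B * V * rnorm (f.1 - f.2).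
Proof.
move=> lam_lag mu_lag l1 m1 l2 m2 e1 e2; rewrite (qhat_diff lam_lag mu_lag) // rnormM rnorm_half.
have [B0 hB] := omB; have := hB (e.1 + e.2) (f.1 - f.2).
have f0 := rnorm_ge0 (f.1 - f.2).
have : rnorm (e.1 + e.2) * (B * rnorm (f.1 - f.2)) <= (V + V) * (B * rnorm (f.1 - f.2)).
  apply: ler_wpM2r; first exact: mulr_ge0.
  by apply: le_trans (rnormD _ _) _; exact: lerD.
lra.
Qed.

End QhatBounds.

Section HermBounds.
Variables (R : realType) (V : lmodType R[i]) (h : V -> V -> R[i]).
Hypothesis hh : herm_form h.

Lemma herm_lc_le n (c : 'rV[R[i]]_n) (e : 'I_n -> V) y (b : R) :
  (forall i, rnorm (h (e i) y) <= b) -> rnorm (h (lc c e) y) <= l1 c * b.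
Proof. by move=> hb; rewrite herm_lcl //; exact: rnorm_dot. Qed.

Lemma herm_swap x y : rnorm (h x y) = rnorm (h y x).
Proof. by rewrite hh.2 rnorm_conj. Qed.

Lemma herm_expand x y z : h (x + (y - z)) (x + (y - z)) =
  h x x + h y y + h z z + (h x y + h y x) - (h x z + h z x) - (h y z + h z y).
Proof.
rewrite !(hermDl _ _ _ hh) !(hermDr _ _ _ hh) !(hermNl _ _ hh) !(hermNr _ _ hh).
move: (h x x) (h x y) (h x z) (h y x) (h y y) (h y z) (h z x) (h z y) (h z z) => *.
by ring.
Qed.

Lemma herm_real x : h x x = (complex.Re (h x x))%:C%C.
Proof. by rewrite RRe_real //; apply/CrealP; rewrite -hh.2. Qed.

Lemma herm_near_ortho n (c : 'rV[R[i]]_n) (e : 'I_n -> V) (eta : R) :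
  (forall i j, rnorm (h (e i) (e j) - (i == j)%:R) <= eta) ->
  \sum_i rnorm (c 0 i) ^+ 2 - eta * l1 c ^+ 2 <= complex.Re (h (lc c e) (lc c e)).
Proof.
move=> he; set s := \sum_i _.
have hs : s%:C%C = \sum_i c 0 i * (c 0 i)^*.
  rewrite /s rmorph_sum; apply: eq_bigr => i _.
  by rewrite -normCK normE rmorphXn.
have h1 : rnorm (h (lc c e) (lc c e) - s%:C%C) <= l1 c * (l1 c * eta).
  rewrite herm_lcl // hs -sumrB.
  under eq_bigr do rewrite -mulrBr.
  apply: rnorm_dot => i; rewrite herm_lcr //.
  have -> : (c 0 i)^* = \sum_j (c 0 j)^* * (i == j)%:R.
    rewrite (bigD1 i) //= eqxx mulr1 big1 ?addr0 // => j /negbTE ji.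
    by rewrite eq_sym ji mulr0.
  rewrite -sumrB; under eq_bigr do rewrite -mulrBr.
  apply: le_trans (rnorm_dot (b := eta) _ _) _ => //.
  by rewrite ler_wpM2r // ?(le_trans (rnorm_ge0 _) (he i i)) // /l1; apply: ler_sum => j _; rewrite rnorm_conj.
have := rnorm_Re (h (lc c e) (lc c e) - s%:C%C).
rewrite raddfB /= ler_norml => /andP[h2 _]; rewrite expr2; lra.
Qed.

End HermBounds.

Section Estimates.
Variable R : realType.
Implicit Types (a b c : R).

Lemma half_diff_le a b c eta : a <= b + c -> b <= eta -> c <= eta -> 2^-1 * a <= eta.
Proof. lra. Qed.

Lemma sum5_le (w1 w2 w3 w4 w5 : R) : 0 <= w1 -> 0 <= w2 -> 0 <= w3 -> 0 <= w4 -> 0 <= w5 ->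
  let v := w1 + w2 + w3 + w4 + w5 + 1 in
  [/\ w1 + 1 <= v, w2 + 1 <= v, w3 + 1 <= v, w4 + 1 <= v & w5 <= v].
Proof. by move=> ? ? ? ? ? v; rewrite /v; split; lra. Qed.

Lemma close_le (Z : normedModType R[i]) (x y : Z) (W V e : R) :
  rnorm x <= W -> rnorm (x - y) <= e -> e <= 1 -> W + 1 <= V -> rnorm y <= V.
Proof. by move=> h1 h2 h3 h4; have := rnormB x (x - y); rewrite subKr; lra. Qed.

(* Young's inequality: [4 C s1 s2 <= s1^2 / (4 p) + 16 p C^2 s2^2] absorbs the
   cross terms. *)
Lemma absorb_cross_terms (S H s1 s2 C p eta M a k b1 b2 c1 c2 d1 d2 : R) :
  0 < eta -> eta * (4 * p) = 1 -> s1 ^+ 2 <= p * S -> M = 2 * (16 * p * C ^+ 2 + 3 * C) ->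
  M * s2 ^+ 2 <= H -> S - eta * s1 ^+ 2 <= a ->
  - (s1 * (C * s2)) <= b1 -> - (s1 * (C * s2)) <= b2 ->
  c1 <= s1 * (s2 * C) -> c2 <= s1 * (s2 * C) ->
  d1 <= s2 * (C * s2) -> d2 <= s2 * (C * s2) -> - (s2 * (s2 * C)) <= k ->
  S / 2 + H / 2 <= a + H + k + (b1 + b2) - (c1 + c2) - (d1 + d2).
Proof.
move=> eta0 E1 SS -> HG PP *.
have a1 : eta * s1 ^+ 2 <= S / 4.
  have : eta * s1 ^+ 2 <= eta * (p * S) by rewrite ler_pM2l.
  have -> : eta * (p * S) = (eta * (4 * p)) * S / 4 by field.
  by rewrite E1 mul1r.
have a2 : 4 * C * s1 * s2 <= S / 4 + 16 * p * C ^+ 2 * s2 ^+ 2.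
  have : 0 <= eta * (s1 - 8 * p * C * s2) ^+ 2.
    by rewrite mulr_ge0 ?sqr_ge0 // ltW.
  have -> : eta * (s1 - 8 * p * C * s2) ^+ 2 = eta * s1 ^+ 2 -
     (eta * (4 * p)) * (4 * C * s1 * s2) + (eta * (4 * p)) * (16 * p * C ^+ 2 * s2 ^+ 2) by ring.
  rewrite E1; lra.
lra.
Qed.

End Estimates.

Section Local.
Variables (R : realType) (Z : completeNormedModType R[i]).
Variables (T : Type) (F : set_system T) (FF : Filter F) (t0 : T).
Variable om : T -> {hermitian Z for true & @Num.conj R[i]}.
Variables (X Y lam mu : T -> set Z) (d j k : T -> nat).

Let A t := lam t `&` Y t.
Let B t := mu t `&` Y t.

Hypotheses (mom0 : moment (om t0) (X t0) (Y t0) (lam t0) (mu t0) (d t0) (j t0) (k t0))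
  (symp0 : symplectic (om t0)).
Hypotheses (mom : \forall t \near F, moment (om t) (X t) (Y t) (lam t) (mu t) (d t) (j t) (k t))
  (symp : \forall t \near F, symplectic (om t)).
Hypothesis om_cvg : form_cvg F om t0.
Hypotheses (lX : lsc F X (X t0)) (lY : lsc F Y (Y t0)) (llam : lsc F lam (lam t0))
  (lmu : lsc F mu (mu t0)) (lA : lsc F A (A t0)) (lB : lsc F B (B t0)).

Lemma lag_good (om' : {hermitian Z for true & @Num.conj R[i]}) (P : set Z) :
  symplectic om' -> lagrangian om' P -> lin_sub P /\ closed P.
Proof. by move=> [bd _] h; split; [exact: lag_sub h|rewrite h; exact: closed_ann]. Qed.

Let goodX : good_family F X (X t0).
Proof.
have [_ [h _ _ _] _ _ _] := mom0; have [? ?] := lag_good symp0 h; split => //.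
by apply: filterS2 mom symp => t [_ [h' _ _ _] _ _ _] st; exact: (lag_good st).
Qed.

Let goodY : good_family F Y (Y t0).
Proof.
have [_ [_ h _ _] _ _ _] := mom0; have [? ?] := lag_good symp0 h; split => //.
by apply: filterS2 mom symp => t [_ [_ h' _ _] _ _ _] st; exact: (lag_good st).
Qed.

Let goodlam : good_family F lam (lam t0).
Proof.
have [_ [_ _ h _] _ _ _] := mom0; have [? ?] := lag_good symp0 h; split => //.
by apply: filterS2 mom symp => t [_ [_ _ h' _] _ _ _] st; exact: (lag_good st).
Qed.

Let goodmu : good_family F mu (mu t0).
Proof.
have [_ [_ _ _ h] _ _ _] := mom0; have [? ?] := lag_good symp0 h; split => //.
by apply: filterS2 mom symp => t [_ [_ _ _ h'] _ _ _] st; exact: (lag_good st).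
Qed.

Let good_cap (P1 P2 : T -> set Z) : good_family F P1 (P1 t0) -> good_family F P2 (P2 t0) ->
  lsc F (fun t => P1 t `&` P2 t) (P1 t0 `&` P2 t0) ->
  good_family F (fun t => P1 t `&` P2 t) (P1 t0 `&` P2 t0).
Proof.
move=> [s1 c1 h1 _] [s2 c2 h2 _] l; split => //; [exact: lin_subI|exact: closedI|].
apply: filterS2 h1 h2 => t [? ?] [? ?]; split; [exact: lin_subI|exact: closedI].
Qed.

Let goodA : good_family F A (A t0). Proof. exact: good_cap. Qed.
Let goodB : good_family F B (B t0). Proof. exact: good_cap. Qed.

Let good_span n (v : 'I_n -> Z) : indep_mod [set 0] v -> good_family F (fun=> fspan v) (fspan v).
Proof. by move=> iv; apply: good_cst => //; [exact: lin_sub_fspan|exact: (closed_fspan symp0)]. Qed.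

Let indep0 n (N : set Z) (v : 'I_n -> Z) : lin_sub N -> indep_mod N v -> indep_mod [set 0] v.
Proof. by move=> sN iv c /= h; apply: iv; rewrite h; exact: sub0. Qed.

(** For a basis [x] of [A /\ B] at [t0], the relations [0 + x i - x i + 0 = 0] are lifted exactly to
    [X + A + B + span v] at time [t], where [index_count] applies. The dual family [z] keeps the
    lifts of the [x i] independent. *)
Lemma index_semicontinuity : \forall t \near F, (k t + j t0 <= k t0 + j t)%N.
Proof.
have [nd [X_lag Y_lag lam_lag mu_lag] [_ XYT] [hd hd'] [hj hk]] := mom0.
have sA : lin_sub (A t0) by case: goodA.
have sB : lin_sub (B t0) by case: goodB.
have [v [[Yv sv] iv]] := (has_dim_modP _ _ _).1 hk.
have iv0 := indep0 (lin_sub_sumset sA sB) iv.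
have sol0 z : exists x1 x2 x3 x4,
    [/\ X t0 x1, A t0 x2, B t0 x3 & fspan v x4] /\ z = x1 + x2 + x3 + x4.
  have : [set: Z] z by []; rewrite -XYT => -[x Xx [y Yy <-]].
  have [c [a Aa [b Bb E]]] := sv _ Yy.
  exists x, a, b, (lc c v); split; first by split => //; exists c.
  by rewrite -[x + a + b]addrA -addrA E subrK.
have [x [[Dx sx] ix]] := (has_dim_modP _ _ _).1 hj.
have [z _ hz] : exists2 z : 'I_(j t0) -> Z, forall i, [set: Z] (z i) &
    forall i l, om t0 (x i) (z l) = (i == l)%:R.
  apply: (@dual_family _ _ _ _ setT [set 0]) => //; first exact: lin_sub0.
  by move=> y _ h; apply: nd => y'; exact: h.
have [W1 W10 hW1] := family_bound x; have [W2 W20 hW2] := family_bound z.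
pose eta : R := (2 * ((j t0)%:R + 1))^-1.
have n0 : 0 <= (j t0)%:R :> R by exact: ler0n.
have eta0 : 0 < eta by rewrite invr_gt0 mulr_gt0 //; lra.
have eta1 : (j t0)%:R * eta < 1.
  by rewrite /eta mulrC ltr_pdivrMl ?mulr1; [lra|rewrite mulr_gt0 //; lra].
have [e e0 he] := form_close FF om_cvg symp0.1 (W1 + W2) eta0.
have lifts : \forall t \near F, forall i : 'I_(j t0), exists y1 y2 y3 y4,
    [/\ [/\ X t y1, A t y2, B t y3 & fspan v y4],
     [/\ rnorm (0 - y1) <= e, rnorm (x i - y2) <= e, rnorm (- x i - y3) <= e & rnorm (0 - y4) <= e]
    & y1 + y2 + y3 + y4 = 0].
  apply: filter_forall => i; have [[lx Yx] [mx _]] := Dx i.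
  have := lift4 FF goodX goodA goodB (good_span iv0) sol0 (x1 := 0) (x2 := x i) (x3 := - x i) (x4 := 0).
  rewrite add0r subrr add0r; apply => //.
  - by case: goodX => s _ _ _; exact: sub0.
  - by apply: subN => //; split.
  - exact: (sub0 (lin_sub_fspan v)).
have [c c0 hc] := solvability4 FF goodX goodA goodB (good_span iv0) sol0.
apply: filter_app he; apply: filterS3 mom lifts hc => t momt lt ct het.
have /choice[y1 hy1] := lt.
have /choice[y2 hy2] := hy1.
have /choice[y3 hy3] := hy2.
have [K hK] : exists K : 'M[R[i]]_(j t0, k t0), forall i, y1 i + y2 i + y3 i + lc (row i K) v = 0.
  apply: (@matrix_of_rows _ _ _ _ v (fun i w => y1 i + y2 i + y3 i + w = 0)) => i.
  by have [y4 [[_ _ _ [cc E]] _ hs]] := hy3 i; exists cc; rewrite -E.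
apply: (index_count momt _ _ hK).
- move=> w; have [x1 [x2 [x3 [x4 [[h1 h2 h3 [cc E]] _ ->]]]]] := ct w.
  by exists x1, x2, x3, cc; rewrite -E.
- by move=> i; have [y4 [[? ? ? _] _ _]] := hy3 i.
- move=> cc cy; apply: (near_id_inj (M := \matrix_(i, l) om t (y2 i) (z l)) _ eta1) => //.
    move=> i l; rewrite mxE -hz; have [y4 [_ [_ ye _ _] _]] := hy3 i.
    apply: het => //; [have := hW1 i; lra|have := hW2 l; lra|].
    by rewrite subrr rnorm0 ltW.
  apply/rowP => l; have : om t (lc cc y2) (z l) = 0 by rewrite cy linear0l.
  by rewrite om_lcl !mxE => h; rewrite -[RHS]h; apply: eq_bigr => i _; rewrite mxE.
Qed.

(** Row [i] of [nu] holds the coordinates of the difference of [G i]. The pairs [G i] themselves are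
    not bounded. *)
Definition graph_family t n (v : 'I_n -> Z) g (G : 'I_g -> Z * Z) (nu : 'M[R[i]]_(g, n)) : Prop :=
  forall i, [/\ lam t (G i).1, mu t (G i).2 & (G i).1 - (G i).2 = lc (row i nu) v].

(* The margin M makes it possible to correct the differences, which lie in the span
   of v, into Y without losing positivity. *)
Definition strongly_positive t neg (M : R) n g (G : 'I_g -> Z * Z) (nu : 'M[R[i]]_(g, n)) : Prop :=
  forall c : 'rV_g, c != 0 ->
    0 < complex.Re (signed neg (qhat (om t)) (lc c G) (lc c G)) /\
    M * l1 (c *m nu) ^+ 2 <= complex.Re (signed neg (qhat (om t)) (lc c G) (lc c G)).

Lemma lc_pair n (c : 'rV[R[i]]_n) (e : 'I_n -> Z * Z) :
  lc c e = (lc c (fun i => (e i).1), lc c (fun i => (e i).2)).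
Proof.
rewrite [LHS]surjective_pairing; congr (_, _).
  exact: (@lc_linear _ _ _ (fun p : Z * Z => p.1)).
exact: (@lc_linear _ _ _ (fun p : Z * Z => p.2)).
Qed.

(** The family [p] is transported to time [t], and each [G i] is corrected by bounded pairs with the
    same [v] part, so that all differences lie in [Y + span u], where [u] completes [lam + mu + Y]
    at [t0]. The correction is controlled by the l1 norm of the coordinates of the differences, and
    the margin [M] pays for it and for the cross terms. [restrict_family] then removes [u]; since
    [u] has [j t0] members, this accounts for the terms in [j]. *)
Lemma positive_near neg p0 n (v : 'I_n -> Z) (p : 'I_p0 -> Z * Z) :
  (forall i, diff_in (lam t0) (mu t0) (Y t0) (p i)) ->
  ortho_fam (signed neg (qhat (om t0))) p ->
  exists2 M : R, 0 <= M & \forall t \near F, forall g (G : 'I_g -> Z * Z) nu,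
    graph_family t v G nu -> strongly_positive t neg M G nu ->
    exists m (e : 'I_m -> Z * Z), [/\ (p0 + g + j t <= m + j t0)%N,
      forall i, diff_in (lam t) (mu t) (Y t) (e i) & pos_fam (signed neg (qhat (om t))) e].
Proof.
move=> Ep op.
have [nd [X_lag Y_lag lam_lag mu_lag] [_ XYT] [hd hd'] [hj hk]] := mom0.
have [r [_ _ hu _]] := relation_rank nd lam_lag mu_lag Y_lag hd hd' hj hk.
have slam := lag_sub lam_lag; have smu := lag_sub mu_lag; have sY := lag_sub Y_lag.
have sLMY : lin_sub (sumset (sumset (lam t0) (mu t0)) (Y t0)).
  by do ?apply: lin_sub_sumset.
have [u [[_ su] iu]] := (has_dim_modP _ _ _).1 hu.
have iu0 := indep0 sLMY iu.
have sol0 z : exists x1 x2 x3 x4,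
    [/\ lam t0 x1, mu t0 x2, Y t0 x3 & fspan u x4] /\ z = x1 + x2 + x3 + x4.
  have [c [_ [l ll [m mm <-]] [y Yy E]]] := su z Logic.I.
  exists l, m, y, (lc c u); split; first by split => //; exists c.
  by rewrite E subrK.
have solk i : exists x : Z * Z * (Z * Z),
    [/\ lam t0 x.1.1, mu t0 x.1.2, Y t0 x.2.1 & fspan u x.2.2] /\
    v i = x.1.1 + x.1.2 + x.2.1 + x.2.2.
  by have [x1 [x2 [x3 [x4 h]]]] := sol0 (v i); exists ((x1, x2), (x3, x4)).
have /choice[ka hka] := solk.
have [W1 W10 hW1] := family_bound (fun i => (p i).1).
have [W2 W20 hW2] := family_bound (fun i => (p i).2).
have [W3 W30 hW3] := family_bound (fun i => (ka i).1.1).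
have [W4 W40 hW4] := family_bound (fun i => (ka i).1.2).
have [W5 W50 hW5] := family_bound v.
pose V := W1 + W2 + W3 + W4 + W5 + 1.
have [B0 B00 hB] := bound_near FF om_cvg symp0.1.
pose C1 := B0 * V * V.
have [WV1 WV2 WV3 WV4 WV5] : [/\ W1 + 1 <= V, W2 + 1 <= V, W3 + 1 <= V, W4 + 1 <= V & W5 <= V].
  exact: sum5_le.
have V0 : 0 <= V by exact: le_trans WV5.
have C10 : 0 <= C1 by rewrite !mulr_ge0.
pose p' : R := p0%:R + 1.
have p'0 : 1 <= p' by rewrite lerDr.
(* With Cauchy-Schwarz, [eta * s1 ^ 2] is at most a quarter of the sum of squares [S]. [M] is twice
   the coefficient of [s2 ^ 2] left by Young's inequality ([16 p' C1 ^ 2]) and by the products with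
   the correction ([3 C1]), so that half of the form on [G] covers these terms. *)
pose eta : R := (4 * p')^-1.
have eta0 : 0 < eta by rewrite invr_gt0 mulr_gt0 // (lt_le_trans ltr01).
pose M := 2 * (16 * p' * C1 ^+ 2 + 3 * C1).
have M0 : 0 <= M.
  by rewrite !(mulr_ge0, addr_ge0) ?exprn_ge0 // (le_trans ler01).
exists M => //.
have [e' e'0 he'] := form_close FF om_cvg symp0.1 (W1 + W2) eta0.
pose e := Num.min e' 1.
have e0 : 0 < e by rewrite lt_min e'0 ltr01.
have ee' : e <= e' by rewrite ge_min lexx.
have e1 : e <= 1 by rewrite ge_min lexx orbT.
have gU := good_span iu0.
have su0 := sub0 (lin_sub_fspan u).
have lp : \forall t \near F, forall i : 'I_p0, exists q : Z * Z,
    [/\ diff_in (lam t) (mu t) (sumset (Y t) (fspan u)) q,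
      rnorm ((p i).1 - q.1) <= e & rnorm ((p i).2 - q.2) <= e].
  apply: filter_forall => i; have [l0 m0 y0] := Ep i.
  have := lift4 FF goodlam goodmu goodY gU sol0 l0 (subN smu m0) (subN sY y0) su0 e0.
  apply: filter_app; apply: filterS2 mom symp => t momt sympt.
  have [_ [_ Yt_lag lamt mut] _ _ _] := momt.
  move=> [y1 [y2 [y3 [y4 [[h1 h2 h3 h4] [b1 b2 _ _] E]]]]].
  exists (y1, - y2); split => //=.
  - split => //=; first by apply: subN => //; exact: lag_sub mut.
    exists (- y3); first by apply: subN => //; exact: lag_sub Yt_lag.
    exists (- y4); first by apply: subN => //; exact: lin_sub_fspan.
    rewrite opprK; move: E; rewrite addr0 subrr -addrA => /eqP; rewrite addr_eq0 => /eqP ->.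
    by rewrite opprD.
  - by rewrite -rnormN opprB addrC.
(* These are the correcting pairs: bounded by [V], with difference equal to [v i] modulo
   [Y t + span u]. *)
have lk : \forall t \near F, forall i : 'I_n, exists q : Z * Z,
    [/\ lam t q.1, mu t q.2, sumset (Y t) (fspan u) (v i - (q.1 - q.2)),
      rnorm q.1 <= V & rnorm q.2 <= V].
  apply: filter_forall => i; have [[l0 m0 y0 u0] vE] := hka i.
  have := lift4 FF goodlam goodmu goodY gU sol0 l0 m0 y0 u0 (ltr01).
  apply: filter_app; apply: filterS2 mom symp => t momt sympt.
  have [_ [_ Yt_lag lamt mut] _ _ _] := momt.
  move=> [y1 [y2 [y3 [y4 [[h1 h2 h3 h4] [b1 b2 _ _] E]]]]].
  exists (y1, - y2); split => //=.
  - by apply: subN => //; exact: lag_sub mut.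
  - exists y3 => //; exists y4 => //.
    by rewrite opprK vE -E -[y1 + y2 + y3 + y4]addrA [y1 + y2 + _]addrC addrK.
  - exact: close_le (hW3 i) b1 (lexx _) WV3.
  - by rewrite rnormN; exact: close_le (hW4 i) b2 (lexx _) WV4.
have [c0 _ hsol] := solvability4 FF goodlam goodmu goodY gU sol0.
apply: filter_app hsol; apply: filter_app hB; apply: filter_app he'.
apply: filterS3 mom lp lk => t momt lpt lkt het Bt solt g G nu gG posG.
have [ndt [_ Yt_lag lamt mut] _ [hdt hdt'] [hjt hkt]] := momt.
have slt := lag_sub lamt; have smt := lag_sub mut; have sYt := lag_sub Yt_lag.
have sYU : lin_sub (sumset (Y t) (fspan u)).
  by apply: lin_sub_sumset => //; exact: lin_sub_fspan.
have sE := lin_sub_diff_in lamt mut sYU.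
have /choice[q hq] := lpt.
have /choice[kp hkp] := lkt.
pose h := signed neg (qhat (om t)).
have hh : herm_form h by apply: signed_herm; exact: qhat_herm.
pose gt i := G i - lc (row i nu) kp.
have kapV (c : 'rV_n) : lam t (lc c kp).1 /\ mu t (lc c kp).2.
  by rewrite lc_pair /=; split; apply: sub_lc => // i; case: (hkp i).
have gtE i : diff_in (lam t) (mu t) (sumset (Y t) (fspan u)) (gt i).
  have [l m E] := gG i; have [kl km] := kapV (row i nu).
  split; [exact: subB|exact: subB|].
  rewrite /gt lc_pair /= opprD opprK addrACA E -lc_oppf -!lc_addf.
  apply: sub_lc => // s; have [_ _ h' _ _] := hkp s.
  by congr (sumset _ _ _): h'; rewrite opprD opprK.
suff posE : pos_fam h (cat_fam q gt).
  apply: (restrict_family (u := u) (e := cat_fam q gt) ndt lamt mut Yt_lag hdt hdt' hjt hkt _ _ posE).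
    move=> z; have [x1 [x2 [x3 [x4 [[h1 h2 h3 [cc E]] _ ->]]]]] := solt z.
    by exists x1, x2, x3, cc; rewrite -E.
  by apply: (cat_famP (P := diff_in (lam t) (mu t) (sumset (Y t) (fspan u)))) => // i; case: (hq i).
move=> c cN0; rewrite herm_real // ltcR lc_cat.
set c1 := lsubmx c; set c2 := rsubmx c.
have -> : lc c2 gt = lc c2 G - lc (c2 *m nu) kp by rewrite /gt lc_subf -lc_mul.
set P := lc c1 q; set GG := lc c2 G; set KK := lc (c2 *m nu) kp.
pose s1 := l1 c1; pose s2 := l1 (c2 *m nu); pose S := \sum_i rnorm (c1 0 i) ^+ 2.
have s10 : 0 <= s1 by exact: l1_ge0.
have s20 : 0 <= s2 by exact: l1_ge0.
have qV i : [/\ lam t (q i).1, mu t (q i).2, rnorm (q i).1 <= V & rnorm (q i).2 <= V].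
  have [[l m _] b1 b2] := hq i; split => //.
    exact: close_le (hW1 i) b1 e1 WV1.
  exact: close_le (hW2 i) b2 e1 WV2.
have GGl : [/\ lam t GG.1, mu t GG.2 & GG.1 - GG.2 = lc (c2 *m nu) v].
  rewrite /GG lc_pair /=; split; [| |rewrite -lc_subf lc_mul].
  - by apply: sub_lc => // i; case: (gG i).
  - by apply: sub_lc => // i; case: (gG i).
  - by apply: eq_bigr => i _; case: (gG i) => _ _ ->.
have GGn : rnorm (GG.1 - GG.2) <= s2 * V.
  case: GGl => _ _ ->; apply: le_trans (rnorm_lc _ hW5) _.
  by rewrite ler_wpM2l.
(* [G] may be large; its products are estimated through its difference, of norm at most [s2 * V]. *)
have bG (x : Z * Z) : lam t x.1 -> mu t x.2 -> rnorm x.1 <= V -> rnorm x.2 <= V ->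
    rnorm (h x GG) <= C1 * s2.
  move=> x1 x2 x1V x2V; rewrite rnorm_signed; case: GGl => g1 g2 _.
  apply: le_trans (qhat_diff_bound Bt lamt mut x1 x2 g1 g2 x1V x2V) _.
  by rewrite /C1 -[leRHS]mulrA [V * s2]mulrC ler_wpM2l // mulr_ge0.
have bK (x : Z * Z) : rnorm x.1 <= V -> rnorm x.2 <= V -> rnorm (h x KK) <= s2 * C1.
  move=> x1V x2V; rewrite herm_swap //; apply: herm_lc_le => // i; rewrite rnorm_signed.
  by have [_ _ _ k1 k2] := hkp i; exact: qhat_bound.
have PG : rnorm (h P GG) <= s1 * (C1 * s2).
  by apply: herm_lc_le => // i; have [? ? ? ?] := qV i; exact: bG.
have PK : rnorm (h P KK) <= s1 * (s2 * C1).
  by apply: herm_lc_le => // i; have [? ? ? ?] := qV i; exact: bK.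
have KG : rnorm (h KK GG) <= s2 * (C1 * s2).
  by apply: herm_lc_le => // i; have [? ? _ ? ?] := hkp i; exact: bG.
have KK' : rnorm (h KK KK) <= s2 * (s2 * C1).
  by apply: herm_lc_le => // i; have [_ _ _ ? ?] := hkp i; exact: bK.
have PP : S - eta * s1 ^+ 2 <= complex.Re (h P P).
  apply: herm_near_ortho => // i l; rewrite -op /h /signed -mulrBr rnormM.
  have -> : rnorm ((-1) ^+ neg : R[i]) = 1 by rewrite /rnorm normrX normrN1 expr1n.
  rewrite mul1r /qhat -mulrBr rnormM rnorm_half.
  have [_ i1 i2] := hq i; have [_ l1' l2'] := hq l.
  have W12 x : x <= W1 -> x <= W1 + W2 by move=> h'; apply: le_trans h' _; rewrite lerDl.
  have W21 x : x <= W2 -> x <= W1 + W2 by move=> h'; apply: le_trans h' _; rewrite lerDr.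
  have a1 : rnorm (om t (q i).2 (q l).1 - om t0 (p i).2 (p l).1) <= eta.
    by apply: het; [exact: W21|exact: W12|exact: le_trans ee'|exact: le_trans ee'].
  have a2 : rnorm (om t (q i).1 (q l).2 - om t0 (p i).1 (p l).2) <= eta.
    by apply: het; [exact: W12|exact: W21|exact: le_trans ee'|exact: le_trans ee'].
  rewrite opprD addrACA -opprD.
  exact: half_diff_le (rnormB _ _) a1 a2.
have HG : M * s2 ^+ 2 <= complex.Re (h GG GG) /\ 0 <= complex.Re (h GG GG).
  have [c20|c20] := eqVneq c2 0.
    rewrite /GG /s2 c20 lc0 herm0l // mul0mx.
    have -> : l1 (0 : 'rV[R[i]]_n) = 0 by apply: big1 => i _; rewrite mxE rnorm0.
    by rewrite expr0n mulr0.
  by have [h1 h2] := posG _ c20; split => //; exact: ltW.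
have HG' : c2 != 0 -> 0 < complex.Re (h GG GG) by move=> /posG[].
have SS : s1 ^+ 2 <= p' * S.
  apply: le_trans (sum_sqr _) _; rewrite /p' mulrDl mul1r lerDl.
  by apply: sumr_ge0 => i _; exact: exprn_ge0 (rnorm_ge0 _).
have S0 : c1 != 0 -> 0 < S.
  move=> /rV_neq0P[i ci]; rewrite /S (bigD1 i) //=; apply: ltr_pwDl.
    rewrite exprn_gt0 // lt_neqAle rnorm_ge0 andbT; apply: contra ci => /eqP h0.
    by rewrite (rnorm_eq0 (esym h0)).
  by apply: sumr_ge0 => l _; exact: exprn_ge0 (rnorm_ge0 _).
have S00 : 0 <= S by apply: sumr_ge0 => l _; exact: exprn_ge0 (rnorm_ge0 _).
have key : S / 2 + complex.Re (h GG GG) / 2 <= complex.Re (h (P + (GG - KK)) (P + (GG - KK))).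
  rewrite herm_expand //.
  have re (x : R[i]) : - rnorm x <= complex.Re x /\ complex.Re x <= rnorm x.
    by have := rnorm_Re x; rewrite ler_norml => /andP[].
  have [r1 _] := re (h P GG); have [r2 _] := re (h GG P).
  have [_ r3] := re (h P KK); have [_ r4] := re (h KK P).
  have [_ r5] := re (h GG KK); have [_ r6] := re (h KK GG); have [r7 _] := re (h KK KK).
  rewrite (herm_swap hh GG P) in r2; rewrite (herm_swap hh KK P) in r4.
  rewrite (herm_swap hh GG KK) in r5.
  rewrite !(ReB, ReD).
  have [HG1 HG2] := HG.
  have E1 : eta * (4 * p') = 1 by rewrite mulVf // gt_eqF // mulr_gt0 // (lt_le_trans ltr01).
  have bd x y z : rnorm x <= y -> - rnorm x <= z -> - y <= z.
    by move=> xy; apply: le_trans; rewrite lerN2.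
  apply: (absorb_cross_terms eta0 E1 SS (erefl M) HG1 PP).
  - exact: bd PG r1.
  - exact: bd PG r2.
  - exact: le_trans r3 PK.
  - exact: le_trans r4 PK.
  - exact: le_trans r5 KG.
  - exact: le_trans r6 KG.
  - exact: bd KK' r7.
apply: lt_le_trans key.
have [c10|c10] := eqVneq c1 0; have [c20|c20] := eqVneq c2 0.
- by move: cN0; rewrite -(hsubmxK c) -/c1 -/c2 c10 c20 row_mx0 eqxx.
- by apply: ltr_wpDl; rewrite ?divr_ge0 // divr_gt0 // HG'.
- by apply: ltr_pwDl; [rewrite divr_gt0 // S0|rewrite divr_ge0 //; case: HG].
- by apply: ltr_pwDl; [rewrite divr_gt0 // S0|rewrite divr_ge0 //; case: HG].
Qed.

End Local.

Local Notation "M ^t*" := (map_mx Num.conj (M ^T)) (at level 30).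

Section Selection.
Variables (K : numFieldType) (n : nat).

Definition select_rows (A : pred 'I_n) : 'M[K]_(#|A|, n) :=
  \matrix_(r, i) (enum_val r == i)%:R.

Lemma select_in (A : pred 'I_n) (c : 'rV[K]_#|A|) r : (c *m select_rows A) 0 (enum_val r) = c 0 r.
Proof.
rewrite mxE (bigD1 r) //= mxE eqxx mulr1 big1 ?addr0 // => s sr.
by rewrite mxE (inj_eq enum_val_inj) (negbTE sr) mulr0.
Qed.

Lemma select_notin (A : pred 'I_n) (c : 'rV[K]_#|A|) i : ~~ A i -> (c *m select_rows A) 0 i = 0.
Proof.
move=> Ai; rewrite mxE big1 // => r _; rewrite mxE; case: eqP => [ri|]; last by rewrite mulr0.
by move: Ai; rewrite -ri; have := enum_valP r; rewrite -topredE /= => ->.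
Qed.

Lemma select_free (A : pred 'I_n) : row_free (select_rows A).
Proof.
apply: row_free_kernel => c c0; apply/rowP => r.
by rewrite -select_in c0 !mxE.
Qed.

End Selection.

(** * Spectral splitting of the form near a crossing *)

Section SpectralSplit.
Variables (R : realType) (V : lmodType R[i]) (h : V -> V -> R[i]).
Hypothesis hh : herm_form h.
Variables (n m : nat) (q : 'I_n -> V) (P : 'M[R[i]]_n) (D : 'I_n -> R[i]) (nu : 'M[R[i]]_(n, m)).
Hypotheses (PP : P *m P^t* = 1%:M)
  (hD : forall i l, h (lc (row i P) q) (lc (row l P) q) = D i *+ (i == l)).
Hypothesis nu_le : forall c, l1 (c *m nu) <= 2 * l1 (c *m gram h q q).
Variables (rho : R) (H_le : forall i l, rnorm (gram h q q i l) <= rho).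

Let H := gram h q q.

Lemma unitary_entry i l : rnorm (P i l) <= 1.
Proof.
have /matrixP/(_ i i) := PP; rewrite !mxE eqxx mulr1n => E.
have : rnorm (P i l) ^+ 2 <= 1.
  have : (rnorm (P i l) ^+ 2)%:C%C <= 1 :> R[i].
    rewrite -E (bigD1 l) //= !mxE -normCK rmorphXn /= -normE lerDl.
    by apply: sumr_ge0 => k _; rewrite !mxE -normCK exprn_ge0.
  by rewrite -[1]/((1 : R)%:C%C) lecR.
by rewrite expr_le1 // rnorm_ge0.
Qed.

Let PH : P *m H = diag_mx (\row_i D i) *m P.
Proof.
have E : P *m H *m P^t* = diag_mx (\row_i D i).
  by rewrite /H -gram_lc //; apply/matrixP => i l; rewrite !mxE hD.
by rewrite -E -mulmxA (mulmx1C PP) mulmx1.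
Qed.

Let D_le i : rnorm (D i) <= n%:R ^+ 2 * rho.
Proof.
have -> : D i = h (lc (row i P) q) (lc (row i P) q) by rewrite hD eqxx.
have lP : l1 (row i P) <= n%:R.
  rewrite /l1 -[n in n%:R]card_ord -sum1_card natr_sum; apply: ler_sum => l _.
  by rewrite mxE; exact: unitary_entry.
have rho0 : 0 <= rho by exact: le_trans (rnorm_ge0 _) (H_le i i).
have h1 k : rnorm (h (q k) (lc (row i P) q)) <= n%:R * rho.
  apply: (@le_trans _ _ (l1 (row i P) * rho)); last exact: ler_wpM2r.
  rewrite (herm_swap hh); apply: herm_lc_le => // l.
  by have := H_le l k; rewrite mxE.
apply: (@le_trans _ _ (l1 (row i P) * (n%:R * rho))); first exact: herm_lc_le.
by rewrite expr2 -mulrA ler_wpM2r // mulr_ge0.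
Qed.

(** By [PH] and [nu_le] the differences are bounded by the eigenvalues times the coordinates;
    squaring gains a further factor [rnorm (D i) <= n ^ 2 * rho]. Of the power [n ^ 5], two come
    from this factor, two from [l1_mul] and one from Cauchy-Schwarz. *)
Let nu_bound (a : 'rV[R[i]]_n) :
  l1 (a *m P *m nu) ^+ 2 <= 4 * n%:R ^+ 5 * rho * \sum_i (rnorm (D i) * rnorm (a 0 i) ^+ 2).
Proof.
have s0 : 0 <= \sum_i rnorm (a 0 i) * rnorm (D i).
  by apply: sumr_ge0 => i _; rewrite mulr_ge0 ?rnorm_ge0.
have h1 : l1 (a *m P *m nu) <= 2 * (n%:R * \sum_i rnorm (a 0 i) * rnorm (D i)).
  apply: le_trans (nu_le _) _; rewrite ler_pM2l // -/H -mulmxA PH mulmxA.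
  apply: le_trans (l1_mul _ unitary_entry) _; rewrite mulr1 ler_wpM2l //.
  by apply: ler_sum => i _; rewrite mul_mx_diag !mxE rnormM.
have h2 : l1 (a *m P *m nu) ^+ 2 <= (2 * (n%:R * \sum_i rnorm (a 0 i) * rnorm (D i))) ^+ 2.
  by rewrite ler_pXn2r // ?nnegrE ?l1_ge0 // !mulr_ge0.
apply: le_trans h2 _; rewrite !exprMn.
have h3 : (\sum_i rnorm (a 0 i) * rnorm (D i)) ^+ 2 <=
    n%:R * \sum_i (n%:R ^+ 2 * rho * (rnorm (D i) * rnorm (a 0 i) ^+ 2)).
  apply: le_trans (sum_sqr _) _; rewrite ler_wpM2l //; apply: ler_sum => i _.
  have -> : (rnorm (a 0 i) * rnorm (D i)) ^+ 2 = rnorm (D i) * (rnorm (D i) * rnorm (a 0 i) ^+ 2) by ring.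
  by rewrite ler_wpM2r ?D_le // mulr_ge0 ?exprn_ge0 ?rnorm_ge0.
rewrite -mulr_sumr in h3.
have -> : 4 * n%:R ^+ 5 * rho * \sum_i (rnorm (D i) * rnorm (a 0 i) ^+ 2) =
  2 ^+ 2 * (n%:R ^+ 2 * (n%:R * (n%:R ^+ 2 * rho * \sum_i rnorm (D i) * rnorm (a 0 i) ^+ 2))) by ring.
by rewrite ler_pM2l // ler_wpM2l // exprn_ge0.
Qed.

(** On the eigenvectors with positive eigenvalue the value of the form is exactly the sum in
    [nu_bound]; a small [rho] therefore yields any prescribed margin [M]. *)
Lemma positive_part (M : R) : 0 <= M -> M * (4 * n%:R ^+ 5 * rho) <= 1 ->
  let S := select_rows R[i] [pred i | 0 < D i] *m P in
  forall c, c != 0 -> let G i := lc (row i S) q in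
    0 < complex.Re (h (lc c G) (lc c G)) /\
    M * l1 (c *m (S *m nu)) ^+ 2 <= complex.Re (h (lc c G) (lc c G)).
Proof.
move=> M0 M1 S c c0 G; set A := [pred i | 0 < D i] in S c c0 G *.
set a := c *m select_rows R[i] A.
have a0 : a != 0.
  apply: contra c0 => /eqP h0; apply/eqP; apply: (row_free_inj (select_free R[i] A)).
  by rewrite mul0mx.
have E : h (lc c G) (lc c G) = (\sum_i (rnorm (D i) * rnorm (a 0 i) ^+ 2))%:C%C.
  rewrite /G -lc_mul /S mulmxA -/a lc_mul (@diag_value _ _ h n _ D) //.
  rewrite rmorph_sum; apply: eq_bigr => i _; rewrite rmorphM rmorphXn /= -!normE.
  have [Ai|Ai] := boolP (A i); first by rewrite (gtr0_norm (Ai : 0 < D i)).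
  by rewrite /a select_notin // normr0 expr0n !mulr0.
rewrite E /=; split.
  have [i ai] := rV_neq0P a0.
  have Ai : A i.
    by apply: contraT => Ai; rewrite /a select_notin ?eqxx in ai.
  have np (W : normedZmodType R[i]) (x : W) : x != 0 -> 0 < rnorm x.
    by move=> x0; rewrite lt_neqAle rnorm_ge0 andbT; apply: contra x0 => /eqP/esym/rnorm_eq0 ->.
  rewrite (bigD1 i) //=; apply: ltr_pwDl.
    by rewrite mulr_gt0 ?exprn_gt0 ?np // gt_eqF.
  by apply: sumr_ge0 => k _; rewrite mulr_ge0 ?exprn_ge0 ?rnorm_ge0.
rewrite /S !mulmxA -/a; set s := \sum_i _.
have s0 : 0 <= s by apply: sumr_ge0 => k _; rewrite mulr_ge0 ?exprn_ge0 ?rnorm_ge0.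
apply: (@le_trans _ _ (M * (4 * n%:R ^+ 5 * rho * s))); first by rewrite ler_wpM2l // nu_bound.
by rewrite mulrA -[leRHS]mul1r ler_wpM2r.
Qed.

(** For the eigenvalue 0 the same bound makes the differences vanish, so that in the application
    these combinations lie on the diagonal of [lam /\ mu]. *)
Lemma zero_part : select_rows R[i] [pred i | D i == 0] *m P *m nu = 0.
Proof.
apply/row_matrixP => r; rewrite row0 -mulmxA row_mul; set a := row r _.
have a0 i : D i != 0 -> a 0 i = 0.
  move=> Di; rewrite mxE mxE; case: eqP => // ri; move: Di; rewrite -ri.
  by have := enum_valP r; rewrite -topredE /= => ->.
apply: l1_eq0; rewrite mulmxA.
have := nu_bound a; rewrite big1; last first.
  move=> i _; have [->|Di] := eqVneq (D i) 0; first by rewrite rnorm0 mul0r.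
  by rewrite a0 // rnorm0 expr0n mulr0.
rewrite mulr0 => h0; rewrite leNgt; apply/negP => h1.
by move: h0; rewrite leNgt exprn_gt0.
Qed.

End SpectralSplit.

Lemma inv_double_le1 (R : realType) (x : R) : 1 <= x -> (2 * x)^-1 <= 1.
Proof. by move=> h; rewrite invf_le1; lra. Qed.

Lemma two_le (R : realType) (a b x : R) : 0 <= a -> x <= 2^-1 -> (1 - x) * a <= b -> a <= 2 * b.
Proof. by move=> a0 xh h; have : x * a <= 2^-1 * a by [exact: ler_wpM2r]; lra. Qed.

Section Crossing.
Variables (R : realType) (Z : completeNormedModType R[i]).
Variables (T : Type) (F : set_system T) (FF : Filter F) (t0 : T).
Variable om : T -> {hermitian Z for true & @Num.conj R[i]}.
Variables (lam mu : T -> set Z) (d : T -> nat).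
Hypotheses (lam0 : lagrangian (om t0) (lam t0)) (mu0 : lagrangian (om t0) (mu t0))
  (symp0 : symplectic (om t0))
  (hd : has_dim_mod (lam t0 `&` mu t0) [set 0] (d t0))
  (hd' : has_dim_mod [set: Z] (sumset (lam t0) (mu t0)) (d t0)).
Hypotheses (lamt : \forall t \near F, lagrangian (om t) (lam t))
  (mut : \forall t \near F, lagrangian (om t) (mu t))
  (symp : \forall t \near F, symplectic (om t))
  (dt : \forall t \near F, has_dim_mod (lam t `&` mu t) [set 0] (d t)).
Hypotheses (om_cvg : form_cvg F om t0) (llam : lsc F lam (lam t0)) (lmu : lsc F mu (mu t0)).
Variable v : 'I_(d t0) -> Z.
Hypotheses (sv : spans_mod [set: Z] (sumset (lam t0) (mu t0)) v)
  (iv : indep_mod (sumset (lam t0) (mu t0)) v).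

Let slam := lag_sub lam0.
Let smu := lag_sub mu0.

(** [lam /\ mu] has the dimension of [Z/(lam + mu)], so their pairing is perfect and [v],
    independent modulo [lam + mu], has a dual family in the intersection. *)
Lemma dual_in_intersection : exists2 z : 'I_(d t0) -> Z,
  forall i, (lam t0 `&` mu t0) (z i) & forall i l, om t0 (v i) (z l) = (i == l)%:R.
Proof.
have sI : lin_sub (lam t0 `&` mu t0) by exact: lin_subI.
have sS : lin_sub (sumset (lam t0) (mu t0)) by exact: lin_sub_sumset.
apply: (dual_family (D := setT) _ sS) => // x _ hx.
apply: (pairing_right (om := om t0) sI _ sS hd hd') => //.
- move=> y z [ly my] [l ll [m mm <-]].
  by rewrite linearDr /= (lag_om lam0 ly ll) (lag_om mu0 my mm) addr0.
- by move=> y _ hy; apply: symp0.2 => z; exact: hy.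
- by move=> y Iy; apply: om_sym0; exact: hx.
Qed.

(** Each [z i] is lifted to a pair of [lam t x mu t] with difference in the span of [v]. On these
    pairs [qhat] has the Gram matrix [- nu Th] with [Th] close to the identity, so the form controls
    the differences. Positive and negative eigenvectors give [Gp] and [Gn]; those of eigenvalue 0
    give independent vectors of [lam t /\ mu t], whence the inequality on [d]. *)
Lemma crossing (M : R) : 0 <= M -> \forall t \near F, exists gp gn
  (Gp : 'I_gp -> Z * Z) (Gn : 'I_gn -> Z * Z) nup nun,
  [/\ graph_family lam mu t v Gp nup /\ graph_family lam mu t v Gn nun,
    strongly_positive om t false M Gp nup, strongly_positive om t true M Gn nun
    & (d t0 <= gp + gn + d t)%N].
Proof.
move=> M0; have [z Kz vz] := dual_in_intersection.
have sS : lin_sub (sumset (lam t0) (mu t0)) by exact: lin_sub_sumset.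
have iv0 : indep_mod [set 0] v by move=> c /= h; apply: iv; rewrite h; exact: sub0.
have sol0 x : exists x1 x2 x3 x4,
    [/\ lam t0 x1, mu t0 x2, fspan v x3 & fspan v x4] /\ x = x1 + x2 + x3 + x4.
  have [c [l ll [m mm E]]] := sv.2 x Logic.I.
  exists l, m, (lc c v), 0; split; first by split => //; [exists c|exact: sub0 (lin_sub_fspan v)].
  by rewrite E subrK addr0.
have good P : (\forall t \near F, lagrangian (om t) (P t)) -> lagrangian (om t0) (P t0) ->
    lsc F P (P t0) -> good_family F P (P t0).
  move=> ht h0 lP; have [? ?] := lag_good symp0 h0; split => //.
  by apply: filterS2 ht symp => t h st; exact: (lag_good st).
have goodv : good_family F (fun=> fspan v) (fspan v).
  by apply: good_cst => //; [exact: lin_sub_fspan|exact: (closed_fspan symp0)].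
have [W1 W10 hW1] := family_bound v; have [W2 W20 hW2] := family_bound z.
have [B [B0 hB]] := om_boundP symp0.1.
pose N : R := (d t0)%:R + 1.
have N1 : 1 <= N by rewrite lerDr.
pose eta : R := (2 * N)^-1.
have eta0 : 0 < eta by rewrite invr_gt0 mulr_gt0 // (lt_le_trans ltr01).
have etan : (d t0)%:R * eta <= 2^-1.
  rewrite /eta invfM mulrCA ler_piMr ?invr_ge0 // ler_pdivrMr ?mul1r ?lerDl //.
  exact: lt_le_trans ltr01 N1.
(* The size of the Gram matrix at which [positive_part] provides the margin [M]; [rho1] is the size
   of the entries of [nu] that ensures it. *)
pose rho : R := (M * (4 * (d t0)%:R ^+ 5) + 1)^-1.
have rho0' : 0 < M * (4 * (d t0)%:R ^+ 5) + 1 by rewrite ltr_wpDl // !mulr_ge0 ?exprn_ge0.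
have rho0 : 0 < rho by rewrite invr_gt0.
have Mrho : M * (4 * (d t0)%:R ^+ 5 * rho) <= 1.
  by rewrite mulrA /rho ler_pdivrMr // mul1r lerDl.
pose rho1 : R := rho / (2 * N).
have rho10 : 0 < rho1 by rewrite divr_gt0 // mulr_gt0 // (lt_le_trans ltr01).
have [e' e'0 he'] := form_close FF om_cvg symp0.1 (W1 + W2) eta0.
pose e := Num.min e' (rho1 / (2 * (B * W2 + 1))).
have BW : 0 < B * W2 + 1 by rewrite ltr_wpDl // mulr_ge0.
have e0 : 0 < e by rewrite lt_min e'0 divr_gt0 // mulr_gt0.
have ee' : e <= e' by rewrite ge_min lexx.
have e1 : (e + e) * (B * W2) <= rho1.
  have : e * (2 * (B * W2 + 1)) <= rho1 by rewrite -ler_pdivlMr ?mulr_gt0 // ge_min lexx orbT.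
  apply: le_trans; have -> : (e + e) * (B * W2) = e * (2 * (B * W2)) by ring.
  by rewrite !ler_pM2l // lerDl.
have lifts : \forall t \near F, forall i : 'I_(d t0), exists q : Z * Z,
    [/\ lam t q.1, mu t q.2, fspan v (q.1 - q.2), rnorm (z i - q.1) <= e & rnorm (z i - q.2) <= e].
  apply: filter_forall => i; have [lz mz] := Kz i.
  have s0 := sub0 (lin_sub_fspan v).
  have := lift4 FF (good _ lamt lam0 llam) (good _ mut mu0 lmu) goodv goodv sol0 lz (subN smu mz) s0 s0 e0.
  apply: filter_app; apply: filterS mut => t mutt.
  move=> [y1 [y2 [y3 [y4 [[h1 h2 h3 h4] [b1 b2 _ _] E]]]]].
  exists (y1, - y2); split => //=.
  - by apply: subN => //; exact: lag_sub mutt.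
  - move: E; rewrite subrr !addr0 -addrA => /eqP; rewrite addr_eq0 => /eqP.
    rewrite opprK => ->; apply: subN; first exact: lin_sub_fspan.
    by apply: subD => //; exact: lin_sub_fspan.
  - by rewrite -rnormN opprB addrC.
apply: filter_app he'; apply: filter_app dt.
apply: filterS3 lamt mut lifts => t lam_t mu_t /choice[q hq] hdt het.
have [nu hnu] : exists nu : 'M[R[i]]_(d t0), forall i, (q i).1 - (q i).2 = lc (row i nu) v.
  apply: (@matrix_of_rows _ _ (d t0) (d t0) v (fun i x => (q i).1 - (q i).2 = x)) => i.
  by have [_ _ [c E] _ _] := hq i; exists c.
(* The midpoint of the pair is close to [z i] and is the vector that [qhat_diff] pairs with the
   differences. *)
pose f i := (2^-1 : R[i]) *: ((q i).1 + (q i).2).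
have zf i : rnorm (z i - f i) <= e.
  have -> : z i - f i = (2^-1 : R[i]) *: ((z i - (q i).1) + (z i - (q i).2)).
    have zz : z i = (2^-1 : R[i]) *: (z i + z i).
      rewrite scalerDr -scalerDl; have -> : 2^-1 + 2^-1 = 1 :> R[i] by field.
      by rewrite scale1r.
    by rewrite /f addrACA -opprD scalerBr -zz.
  rewrite rnormZ rnorm_half; have [_ _ _ h1 h2] := hq i.
  exact: half_diff_le (rnormD _ _) h1 h2.

pose Th := \matrix_(a, i) om t (v a) (f i).
have W12 x : x <= W1 -> x <= W1 + W2 by move=> h'; apply: le_trans h' _; rewrite lerDl.
have W21 x : x <= W2 -> x <= W1 + W2 by move=> h'; apply: le_trans h' _; rewrite lerDr.
have Th1 a i : rnorm (Th a i - (a == i)%:R) <= eta.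
  rewrite mxE -vz; apply: het; [exact: W12|exact: W21| |exact: le_trans ee'].
  by rewrite subrr rnorm0 ltW.
have gramE : gram (qhat (om t)) q q = - (nu *m Th).
  apply/matrixP => i l; rewrite !mxE.
  have [li mi _ _ _] := hq i; have [ll ml _ _ _] := hq l.
  have hh := qhat_herm (om t).
  rewrite hh.2 (qhat_diff lam_t mu_t) // hnu rmorphM fmorphV rmorph_nat /=.
  have -> : (om t ((q l).1 + (q l).2) (lc (row i nu) v))^* = - om t (lc (row i nu) v) ((q l).1 + (q l).2).
    by rewrite [in RHS]om_skew opprK.
  rewrite mulrN om_lcl mulr_sumr; congr (- _); apply: eq_bigr => a _.
  rewrite !mxE.
  have -> : om t (v a) (f l) = 2^-1 * om t (v a) ((q l).1 + (q l).2).
    by rewrite linearZr_LR /= fmorphV rmorph_nat.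
  by rewrite mulrCA.
have nu_small i a : rnorm (nu i a) <= rho1.
  have -> : nu i a = om t0 ((q i).1 - (q i).2) (z a).
    rewrite hnu om_lcl (bigD1 a) //= vz eqxx mulr1 mxE big1 ?addr0 // => b /negbTE ba.
    by rewrite vz ba mulr0.
  have -> : (q i).1 - (q i).2 = (z i - (q i).2) - (z i - (q i).1).
    by rewrite opprB [RHS]addrC addrA subrK.
  apply: le_trans (hB _ _) _; apply: le_trans e1.
  rewrite mulrAC [leRHS]mulrC; apply: ler_pM; rewrite ?mulr_ge0 ?rnorm_ge0 //.
    by rewrite ler_wpM2l.
  have [_ _ _ h1 h2] := hq i.
  by apply: le_trans (rnormB _ _) _; exact: lerD.
have nTh (c : 'rV_(d t0)) : l1 c <= 2 * l1 (c *m Th).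
  have := near_id c Th1; have := l1_ge0 c => h1 h2.
  exact: two_le h1 etan h2.
have nu_le (c : 'rV_(d t0)) : l1 (c *m nu) <= 2 * l1 (c *m gram (qhat (om t)) q q).
  by rewrite gramE mulmxN l1N mulmxA; exact: nTh.
have gram_small i l : rnorm (gram (qhat (om t)) q q i l) <= rho.
  rewrite gramE mxE rnormN mxE.
  have Thb a : rnorm (Th a l) <= 2.
    have := rnormD (Th a l - (a == l)%:R) (a == l)%:R; rewrite subrK => /le_trans; apply.
    have := Th1 a l => h1.
    have -> : (2 : R) = 1 + 1 by [].
    apply: lerD; last by case: eqP => _; rewrite ?rnorm1 ?rnorm0.
    by apply: le_trans h1 _; exact: inv_double_le1.
  apply: le_trans (rnorm_dot _ Thb) _.
  apply: (@le_trans _ _ ((d t0)%:R * rho1 * 2)).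
    have -> : (d t0)%:R * rho1 = \sum_(a < d t0) rho1 by rewrite sumr_const card_ord mulr_natl.
    by rewrite ler_wpM2r // ler_sum.
  rewrite /rho1 mulrAC mulrA ler_pdivrMr; last by rewrite mulr_gt0 // (lt_le_trans ltr01).
  by rewrite mulrC ler_pM2l // [_ * 2]mulrC ler_pM2l // /N lerDl.
have hh := qhat_herm (om t).
have [P [D [PP Dr hD]]] := spectral_family q hh.
pose sg (neg : bool) : R[i] := (-1) ^+ neg.
have hD' neg i l : signed neg (qhat (om t)) (lc (row i P) q) (lc (row l P) q) = (sg neg * D i) *+ (i == l).
  by rewrite /signed hD mulrnAr.
have l1s neg (c : 'rV[R[i]]_(d t0)) : l1 (sg neg *: c) = l1 c.
  by apply: eq_bigr => i _; rewrite mxE rnormM /rnorm normrX normrN1 expr1n mul1r.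
have nu_le' neg c : l1 (c *m nu) <= 2 * l1 (c *m gram (signed neg (qhat (om t))) q q).
  have -> : gram (signed neg (qhat (om t))) q q = sg neg *: gram (qhat (om t)) q q.
    by apply/matrixP => i l; rewrite !mxE.
  by rewrite -scalemxAr l1s; exact: nu_le.
have gram' neg i l : rnorm (gram (signed neg (qhat (om t))) q q i l) <= rho.
  by rewrite mxE rnorm_signed; have := gram_small i l; rewrite mxE.
pose S neg := select_rows R[i] [pred i | 0 < sg neg * D i] *m P.
have pos neg := positive_part (D := fun i => sg neg * D i) (signed_herm neg hh) PP (hD' neg) (nu_le' neg) (gram' neg) M0 Mrho.
have graph r (U : 'M[R[i]]_(r, d t0)) : graph_family lam mu t v (fun i => lc (row i U) q) (U *m nu).
  move=> i; rewrite lc_pair /=; split.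
  - by apply: sub_lc => [|l]; [exact: lag_sub lam_t|case: (hq l)].
  - by apply: sub_lc => [|l]; [exact: lag_sub mu_t|case: (hq l)].
  - by rewrite -lc_subf row_mul lc_mul; apply: eq_bigr => l _; rewrite hnu.
exists #|[pred i | 0 < sg false * D i]|, #|[pred i | 0 < sg true * D i]|.
exists (fun i => lc (row i (S false)) q), (fun i => lc (row i (S true)) q).
exists (S false *m nu), (S true *m nu); split; [by split; exact: graph|exact: (pos false)|exact: (pos true)|].
pose S0 := select_rows R[i] [pred i | D i == 0] *m P.
have S0nu : S0 *m nu = 0.
  exact: (zero_part hh PP hD nu_le gram_small).
have fS0 : row_free S0.
  apply: row_free_kernel => c; rewrite /S0 mulmxA => h.
  have : c *m select_rows R[i] [pred i | D i == 0] = 0.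
    by rewrite -[LHS]mulmx1 -PP mulmxA h mul0mx.
  move=> h'; apply: (row_free_inj (select_free R[i] [pred i | D i == 0])).
  by rewrite h' mul0mx.
have cardD : (#|[pred i | (0 < sg false * D i)%R]| + #|[pred i | (0 < sg true * D i)%R]| +
    #|[pred i | D i == 0%R]| = d t0)%N.
  rewrite -[RHS]card_ord -(cardC [pred i | D i == 0]) addnC; congr (_ + _)%N.
  rewrite -(cardID [pred i | 0 < D i] [predC [pred i | D i == 0]]); congr (_ + _)%N.
    apply: eq_card => l; rewrite !inE /sg expr0 mul1r.
    by case: (boolP (0 < D l)) => [h|_]; rewrite ?andbF // andbT gt_eqF.
  apply: eq_card => l; rewrite !inE /sg expr1 mulN1r oppr_gt0 -real_leNgt ?real0 //.
  by rewrite lt_neqAle andbC.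
suff : (#|[pred i | D i == 0%R]| <= d t)%N by move=> hz; apply: (@leq_trans _ _ _ (eq_leq (esym cardD))); rewrite leq_add2l.
apply: (dim_le_indep (@lin_sub0 _ Z) hdt (e := fun r => lc (row r S0) (fun i => (q i).1))).
  move=> r; have [] := graph _ S0 r; rewrite S0nu row0 lc0 lc_pair /= => h1 h2 h3.
  by split => //; rewrite -[lc _ _](subrK (lc (row r S0) (fun i => (q i).2))) h3 add0r.
move=> c /=; rewrite -lc_mul => c1; set c' := c *m S0 in c1.
have c2 : lc c' (fun i => (q i).2) = 0.
  have : lc c' (fun i => (q i).1 - (q i).2) = 0.
    have -> : lc c' (fun i => (q i).1 - (q i).2) = lc (c' *m nu) v.
      by rewrite lc_mul; apply: eq_bigr => l _; rewrite hnu.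
    by rewrite /c' -mulmxA S0nu mulmx0 lc0.
  by rewrite lc_subf c1 sub0r => /eqP; rewrite oppr_eq0 => /eqP.
have c'f : lc c' f = 0.
  have -> : lc c' f = (2^-1 : R[i]) *: lc c' (fun i => (q i).1 + (q i).2).
    by rewrite /lc scaler_sumr; apply: eq_bigr => l _; rewrite /f !scalerA mulrC.
  by rewrite lc_addf c1 c2 addr0 scaler0.
(* The midpoints pair with [v] by a matrix close to the identity, so they are independent. *)
have c'0 : c' = 0.
  have : map_mx Num.conj c' *m Th^T = 0.
    apply/rowP => a; have : om t (v a) (lc c' f) = 0 by rewrite c'f linear0r.
    by rewrite om_lcr !mxE => h; rewrite -[RHS]h; apply: eq_bigr => l _; rewrite !mxE.
  move=> h0; have : map_mx Num.conj c' = 0.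
    apply: (near_id_inj (M := Th^T) (eta := eta) _ _ h0).
      by move=> i l; rewrite mxE eq_sym; exact: Th1.
    by apply: le_lt_trans etan _; rewrite invf_lt1 // ltr1n.
  move=> /rowP h1; apply/rowP => l; have := h1 l; rewrite !mxE => /eqP.
  by rewrite conjC_eq0 => /eqP.
by apply: (row_free_inj fS0); rewrite -/c' c'0 mul0mx.
Qed.

End Crossing.

Section LocalComparison.
Variables (R : realType) (Z : completeNormedModType R[i]).
Variables (T : Type) (F : set_system T) (FF : Filter F) (t0 : T).
Variable om : T -> {hermitian Z for true & @Num.conj R[i]}.
Variables (lam mu : T -> set Z) (d : T -> nat).

(* Applied to the Y of the theorem, and also with mu and the complement L of the
   definition of the finite dimensional index in the roles of X and Y. *)
Definition admissible (X Y : T -> set Z) (j k : T -> nat) : Prop :=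
  [/\ moment (om t0) (X t0) (Y t0) (lam t0) (mu t0) (d t0) (j t0) (k t0),
      \forall t \near F, moment (om t) (X t) (Y t) (lam t) (mu t) (d t) (j t) (k t),
      lsc F X (X t0), lsc F Y (Y t0)
    & lsc F (fun t => lam t `&` Y t) (lam t0 `&` Y t0) /\
      lsc F (fun t => mu t `&` Y t) (mu t0 `&` Y t0)].

Definition index_at (Y : T -> set Z) neg t (p : nat) : Prop :=
  max_pos (signed neg (qhat (om t))) (diff_in (lam t) (mu t) (Y t)) p.

Hypotheses (symp0 : symplectic (om t0)) (symp : \forall t \near F, symplectic (om t)).
Hypotheses (om_cvg : form_cvg F om t0) (llam : lsc F lam (lam t0)) (lmu : lsc F mu (mu t0)).

Let le_max_fst (a b : R) : a <= Num.max a b. Proof. by rewrite le_max lexx. Qed.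
Let le_max_snd (a b : R) : b <= Num.max a b. Proof. by rewrite le_max lexx orbT. Qed.

Lemma strongly_positive_mono t neg (M M' : R) n g (G : 'I_g -> Z * Z) (nu : 'M[R[i]]_(g, n)) :
  M <= M' -> strongly_positive om t neg M' G nu -> strongly_positive om t neg M G nu.
Proof.
move=> MM h c /h[h1 h2]; split=> //; apply: le_trans h2.
by rewrite ler_wpM2r // exprn_ge0 // l1_ge0.
Qed.

(** [positive_near] gives one inequality for each sign. With the sums of the two indices at [t0] and
    at [t], [index_semicontinuity] and the inequality on [d], no slack is left. *)
Lemma index_jump X Y j k n (v : 'I_n -> Z) : admissible X Y j k ->
  exists2 M : R, 0 <= M & \forall t \near F, forall gp gn
    (Gp : 'I_gp -> Z * Z) (Gn : 'I_gn -> Z * Z) nup nun,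
    graph_family lam mu t v Gp nup -> graph_family lam mu t v Gn nun ->
    strongly_positive om t false M Gp nup -> strongly_positive om t true M Gn nun ->
    (d t0 <= gp + gn + d t)%N ->
    forall neg p0 p, index_at Y neg t0 p0 -> index_at Y neg t p ->
    (p + j t0 = p0 + (if neg then gn else gp) + j t)%N.
Proof.
move=> [mom0 mom lX lY [lA lB]].
have [p0 [n0 [hp0 hn0 E0]]] := moment_index mom0.
have [ep0 Eep0 oep0] := hp0.1; have [en0 Een0 oen0] := hn0.1.
have [M1 M10 pos1] := positive_near FF mom0 symp0 mom symp om_cvg lY llam lmu v Eep0 oep0.
have [M2 M20 pos2] := positive_near FF mom0 symp0 mom symp om_cvg lY llam lmu v Een0 oen0.
have sc := index_semicontinuity FF mom0 symp0 mom symp om_cvg lX lY llam lmu lA lB.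
exists (Num.max M1 M2); first by rewrite le_max M10.
apply: filter_app sc; apply: filterS3 mom pos1 pos2 => t momt ht1 ht2 sct.
move=> gp gn Gp Gn nup nun g1 g2 s1 s2 dE.
have [pt [nt [hpt hnt Et]]] := moment_index momt.
have hh neg := signed_herm neg (qhat_herm (om t)).
have hh0 neg := signed_herm neg (qhat_herm (om t0)).
have [m1 [e1 [m1E e1E e1p]]] := ht1 _ _ _ g1 (strongly_positive_mono (le_max_fst _ _) s1).
have [m2 [e2 [m2E e2E e2p]]] := ht2 _ _ _ g2 (strongly_positive_mono (le_max_snd _ _) s2).
have m1p := hpt.2 _ _ e1E e1p; have m2n := hnt.2 _ _ e2E e2p.
move=> [] q0 q h0 h.
  by rewrite (max_pos_uniq (hh0 true) h0 hn0) (max_pos_uniq (hh true) h hnt); lia.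
by rewrite (max_pos_uniq (hh0 false) h0 hp0) (max_pos_uniq (hh false) h hpt); lia.
Qed.

(** The jumps [gp] and [gn] are produced by [crossing] from [lam], [mu] and [om] alone, so the same
    families serve both complements once the larger of the two margins is imposed. *)
Lemma index_comparison X Y j k X' Y' j' k' :
  admissible X Y j k -> admissible X' Y' j' k' ->
  \forall t \near F, forall neg p0 p p0' p',
    index_at Y neg t0 p0 -> index_at Y neg t p ->
    index_at Y' neg t0 p0' -> index_at Y' neg t p' ->
    (p + j t0 + (p0' + j' t) = p0 + j t + (p' + j' t0))%N.
Proof.
move=> ad ad'; have [mom0 mom _ _ _] := ad.
have [nd [_ _ lam0 mu0] _ [hd hd'] _] := mom0.
have [v [sv iv]] := (has_dim_modP _ _ _).1 hd'.
have lamt : \forall t \near F, lagrangian (om t) (lam t) by apply: filterS mom => t [_ []].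
have mut : \forall t \near F, lagrangian (om t) (mu t) by apply: filterS mom => t [_ []].
have dt : \forall t \near F, has_dim_mod (lam t `&` mu t) [set 0] (d t).
  by apply: filterS mom => t [_ _ _ []].
have [M1 M10 h1] := index_jump v ad; have [M2 M20 h2] := index_jump v ad'.
have M0 : 0 <= Num.max M1 M2 by rewrite le_max M10.
have hc := crossing FF lam0 mu0 symp0 hd hd' lamt mut symp dt om_cvg llam lmu sv iv M0.
apply: filterS3 h1 h2 hc => t ht1 ht2 [gp [gn [Gp [Gn [nup [nun [[g1 g2] s1 s2 dE]]]]]]].
move=> neg p0 p p0' p' i0 i i0' i'.
have := ht1 _ _ _ _ _ _ g1 g2 (strongly_positive_mono (le_max_fst _ _) s1)
  (strongly_positive_mono (le_max_fst _ _) s2) dE _ _ _ i0 i.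
have := ht2 _ _ _ _ _ _ g1 g2 (strongly_positive_mono (le_max_snd _ _) s1)
  (strongly_positive_mono (le_max_snd _ _) s2) dE _ _ _ i0' i'.
lia.
Qed.

End LocalComparison.

(** * Symplectic reduction *)

Section LagrangianComplement.
Variables (C : numClosedFieldType) (Z : lmodType C).
Variable om : {hermitian Z for true & @Num.conj C}.

(** Modulo [N], [L] and [al] meet trivially and each is its own annihilator in [W], so they are dual
    to each other. Given [w] in [W], some [l] in [L] has the same pairings with [al], and [w - l]
    then lies in [al]. *)
Lemma complement_sum (W N al L : set Z) :
  lin_sub W -> lin_sub N -> findim_mod W N -> (forall x y, W x -> N y -> om x y = 0) ->
  N `<=` al -> N `<=` L -> al = W `&` annihilator om al -> L = W `&` annihilator om L ->
  L `&` al = N -> W `<=` sumset L al.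
Proof.
move=> sW sN [n hn] WN Nal NL alE LE LalN.
have sal : lin_sub al by rewrite alE; apply: lin_subI => //; exact: lin_sub_ann.
have sL : lin_sub L by rewrite LE; apply: lin_subI => //; exact: lin_sub_ann.
have alW : al `<=` W by rewrite alE => x [].
have LW : L `<=` W by rewrite LE => x [].
have [a _ ha] := dim_sub sal sN alW hn.
have [l _ hl] := dim_sub sL sN LW hn.
have nd1 x : L x -> (forall y, al y -> om x y = 0) -> N x.
  move=> Lx h; rewrite -LalN; split => //; rewrite alE; split; [exact: LW|exact: h].
have nd2 x : al x -> (forall y, L y -> om x y = 0) -> N x.
  move=> ax h; rewrite -LalN; split => //; rewrite LE; split; [exact: alW|exact: h].
have al_l : (l <= a)%N.
  by apply: (pairing_le (om := om) sL hl ha _ nd1) => x y /LW Wx; exact: WN.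
have la : a = l.
  apply/eqP; rewrite eqn_leq al_l andbT.
  by apply: (pairing_le (om := om) sal ha hl _ nd2) => x y /alW Wx; exact: WN.
rewrite la in ha.
have [e [[Le se] ie]] := (has_dim_modP _ _ _).1 hl.
have [b [[ab sb] ib]] := (has_dim_modP _ _ _).1 ha.
have free := pairing_ker (om := om) sL Le ie (conj ab sb)
  (fun x y Lx => WN x y (LW _ Lx)) nd1.
set G := \matrix_(i, j) om (e i) (b j) in free.
move=> w Ww.
have [c cG] : exists c, c *m G = \row_j om w (b j).
  exists ((\row_j om w (b j)) *m invmx G).
  by rewrite -mulmxA mulVmx ?mulmx1 // -row_free_unit.
have Lc : L (lc c e) by exact: sub_lc.
exists (lc c e) => //; exists (w - lc c e); last by rewrite addrC subrK.
rewrite alE; split; first by apply: subB => //; exact: LW.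
move=> y ay; have [c' Ny] := sb _ ay.
have Wwl : W (w - lc c e) by apply: subB => //; exact: LW.
rewrite -[y](subrK (lc c' b)) linearDr /= (WN _ _ Wwl Ny) add0r om_lcr big1 // => j _.
rewrite linearBl /= om_lcl; move/rowP: cG => /(_ j); rewrite [LHS]mxE [RHS]mxE => E.
have -> : \sum_i c 0 i * om (e i) (b j) = om w (b j).
  by rewrite -E; apply: eq_bigr => i _; rewrite mxE.
by rewrite subrr mulr0.
Qed.

End LagrangianComplement.

(** * Reduction modulo the annihilator of V + lam *)

Section Reduction.
Variables (R : realType) (Z : normedModType R[i]).
Variable om : {hermitian Z for true & @Num.conj R[i]}.
Hypothesis nd : forall x, (forall y, om x y = 0) -> x = 0.
Variables (lam mu V : set Z) (d n : nat).
Hypotheses (lam_lag : lagrangian om lam) (mu_lag : lagrangian om mu)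
  (hd : has_dim_mod (lam `&` mu) [set 0] d) (hd' : has_dim_mod [set: Z] (sumset lam mu) d).
Hypotheses (sV : lin_sub V) (hV : has_dim_mod V [set 0] n) (red : reducing om V lam mu).

Let W := sumset V lam.
Let N := annihilator om W.
Let slam := lag_sub lam_lag.
Let smu := lag_sub mu_lag.
Let s0 := @lin_sub0 _ Z.

Lemma lin_sub_W : lin_sub W. Proof. exact: lin_sub_sumset. Qed.
Lemma lin_sub_N : lin_sub N. Proof. exact: lin_sub_ann. Qed.
Let sW := lin_sub_W.
Let sN := lin_sub_N.
Let smW : lin_sub (mu `&` W). Proof. exact: lin_subI. Qed.

Lemma N_def : N = annihilator om V `&` lam.
Proof. by rewrite /N ann_sum // -lam_lag. Qed.

Lemma N_lam : N `<=` lam. Proof. by rewrite N_def => x []. Qed.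
Lemma lam_W : lam `<=` W. Proof. exact: sumset_r. Qed.
Lemma V_W : V `<=` W. Proof. exact: sumset_l. Qed.
Lemma N_W : N `<=` W. Proof. by move=> x /N_lam; exact: lam_W. Qed.

Lemma om_WN x y : W x -> N y -> om x y = 0.
Proof. by move=> Wx Ny; apply: om_sym0; exact: Ny. Qed.

Lemma VNmu z : exists v n m, [/\ V v, N n, mu m & z = v + n + m].
Proof.
have [_ _ E] := red; have : [set: Z] z by []; rewrite -E -N_def.
by move=> [_ [v Vv [n' Nn <-]] [m mm <-]]; exists v, n', m.
Qed.

Lemma Vlam0 x : V x -> lam x -> x = 0.
Proof. by move=> Vx lx; have [E _ _] := red; have : (V `&` lam) x by []; rewrite E. Qed.

Lemma muN_ortho x : mu x -> (forall y, N y -> om x y = 0) -> (forall y, V y -> om x y = 0) -> x = 0.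
Proof.
move=> mx Nx Vx; apply: nd => z; have [v [n' [m [Vv Nn mm ->]]]] := VNmu z.
by rewrite !linearDr /= Vx // Nx // (lag_om mu_lag mx mm) !addr0.
Qed.

Lemma mu_N0 x : mu x -> N x -> x = 0.
Proof.
move=> mx Nx; apply: muN_ortho => // y Ny.
  by rewrite (lag_om lam_lag (N_lam Nx) (N_lam Ny)).
by apply: Nx; exact: V_W.
Qed.

(** The pairs [(v, m)] of [V x mu] with [m - v] in [lam] are counted twice: [m] runs over [mu /\ W]
    and determines [v]; [v] runs over [V /\ (lam + mu)], of dimension [n - d], with fibre
    [lam /\ mu], of dimension [d]. *)
Lemma dim_muW : has_dim_mod (mu `&` W) [set 0] n.
Proof.
have sLM : lin_sub (sumset lam mu) by exact: lin_sub_sumset.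
have sVL : lin_sub (V `&` sumset lam mu) by exact: lin_subI.
have hVd : has_dim_mod V (V `&` sumset lam mu) d.
  apply/(@dim_iso _ _ _ idfun _ V _ [set: Z] (sumset lam mu)) => //.
  - by move=> x Vx; split=> [[]|].
  - move=> z _; have [v [n' [m [Vv Nn mm ->]]]] := VNmu z; exists v => //=.
    by exists n'; [exact: N_lam|exists m => //; rewrite -[v + n' + m]addrA [v + _]addrC addrK].
pose G : set (Z * Z) := [set e | [/\ V e.1, mu e.2 & lam (e.2 - e.1)]].
pose G0 : set (Z * Z) := [set e | e.1 = 0 /\ (lam `&` mu) e.2].
have sG : lin_sub G.
  split; first by split; rewrite /= ?subrr; exact: sub0.
  move=> a [x1 x2] [y1 y2] [/= h1 h2 h3] [/= h4 h5 h6]; split => /=.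
  - by apply: subD => //; exact: subZ.
  - by apply: subD => //; exact: subZ.
  - by rewrite opprD addrACA -scalerBr; apply: subD => //; exact: subZ.
have sI : lin_sub (lam `&` mu) by exact: lin_subI.
have sG0 : lin_sub G0.
  split; first by split => //; exact: sub0.
  move=> a [x1 x2] [y1 y2] [/= -> h1] [/= -> h2]; split => /=; first by rewrite scaler0 addr0.
  exact: (subD sI (subZ _ sI _)).
have s00 : lin_sub ([set 0] : set (Z * Z)) := @lin_sub0 _ _.
have G0G : G0 `<=` G.
  move=> [x y] [/= -> [ly my]]; split => //=; [exact: sub0|by rewrite subr0].
have [a [e [ha he E]]] := dim_split sV sVL s0 (fun x x0 => ltac:(rewrite x0; exact: sub0)) (fun x => @proj1 _ _) hV.
have ad := dim_uniq sVL ha hVd; subst a.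
have hG1 : has_dim_mod G G0 e.
  apply/(@dim_iso _ _ _ (fun p : Z * Z => p.1) _ G G0 (V `&` sumset lam mu) [set 0]) => //.
  - move=> [x y] [/= Vx my lyx]; split => //; exists (- (y - x)); first exact: subN.
    by exists y => //; rewrite opprB subrK.
  - move=> [x y] [/= Vx my lyx]; split; first by case.
    by move=> /= x0; split => //; split => //; rewrite -[y]subr0 -x0.
  - move=> x [Vx [l ll [m mm E1]]]; exists (x, m); last by rewrite /= subrr.
    by split => //=; rewrite -E1 opprD addrCA subrr addr0; exact: subN.
have hG0 : has_dim_mod G0 [set 0] d.
  apply/(@dim_iso _ _ _ (fun p : Z * Z => p.2) _ G0 [set 0] (lam `&` mu) [set 0]) => //.
  - by move=> [x y] [].
  - by move=> [x y] [/= x0 _]; split => [[_ ->]//|/= ->]; rewrite x0.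
  - by move=> y [ly my]; exists (0, y); [split|rewrite /= subrr].
have hG : has_dim_mod G [set 0] n.
  rewrite -E addnC; apply: (dim_add s00 sG0 _ G0G hG1 hG0).
  by move=> x ->; exact: sub0.
apply/(@dim_iso _ _ _ (fun p : Z * Z => p.2) _ G [set 0] (mu `&` W) [set 0]) => //.
- by move=> [x y] [/= Vx my lyx]; split => //; exists x => //; exists (y - x) => //; rewrite addrC subrK.
- move=> [x y] [/= Vx my lyx]; split => [[_ ->]//|/= y0].
  suff -> : x = 0 by rewrite y0.
  by apply: Vlam0 => //; rewrite -[x]opprK -[- x]add0r -y0; exact: subN.
- move=> y [my [x Vx [l ll E1]]]; exists (x, y); last by rewrite /= subrr.
  by split => //=; rewrite -E1 addrC addKr.
Qed.

(** A vector of [mu] that annihilates [N] is determined by its pairings with [V], so these vectors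
    have dimension at most [n], which [mu /\ W] already attains. *)
Lemma dim_annN_mu : mu `&` annihilator om N `<=` W.
Proof.
have sD : lin_sub (mu `&` annihilator om N) by apply: lin_subI => //; exact: lin_sub_ann.
have sub : mu `&` W `<=` mu `&` annihilator om N.
  by move=> x [mx Wx]; split => // y Ny; exact: om_WN.
have [m mn hm] : exists2 m, (m <= n)%N & has_dim_mod (mu `&` annihilator om N) [set 0] m.
  apply: (pairing_findim (om := om) sD s0 hV).
    by move=> x y _ ->; rewrite linear0r.
  by move=> x [mx Nx] Vx; apply: muN_ortho.
have [m' m'm hm'] := dim_sub smW s0 sub hm.
have E : m = n by apply/eqP; rewrite eqn_leq mn -(dim_uniq s0 hm' dim_muW).
rewrite E in hm => x /(dim_eq_sub smW sD s0 _ sub dim_muW hm)[] //.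
by move=> y ->; exact: sub0.
Qed.

(** The double annihilator of [W] is [W]: along [Z = V + N + mu] it remains to treat the component
    in [mu]. As a result, Lagrangian subspaces of the reduction are Lagrangian in [Z] itself. *)
Lemma ann_N : annihilator om N = W.
Proof.
apply/seteqP; split => [x hx|x Wx y Ny]; last exact: om_WN.
have [v [n' [m [Vv Nn mm E]]]] := VNmu x.
have mW : W m.
  apply: dim_annN_mu; split => // y Ny.
  have -> : m = x - v - n' by rewrite E -[v + n' + m]addrA [v + _]addrC addrK [n' + m]addrC addrK.
  rewrite !linearBl /= (hx _ Ny) (om_WN (V_W Vv) Ny) (om_WN (N_W Nn) Ny).
  by rewrite !subr0.
by rewrite E; apply: subD => //; apply: subD => //; [exact: V_W|exact: N_W].
Qed.

Lemma reduction_lam : reduction W N lam = lam.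
Proof.
apply/seteqP; split => [_ [x [lx _] [y /N_lam ly <-]]|x lx]; first exact: subD.
by exists x; [split => //; exact: lam_W|exists 0; [exact: sub0 sN|rewrite addr0]].
Qed.

Let be := reduction W N mu.

Lemma lin_sub_be : lin_sub be. Proof. exact: lin_sub_sumset. Qed.
Let sbe := lin_sub_be.

Lemma be_W : be `<=` W.
Proof. by move=> _ [x [_ Wx] [y /N_W Wy <-]]; exact: subD. Qed.

Lemma N_be : N `<=` be. Proof. exact: sumset_r. Qed.

Lemma muW_be x : mu x -> W x -> be x.
Proof. by move=> mx Wx; apply: sumset_l => //; split. Qed.

Lemma be_iso x y : be x -> be y -> om x y = 0.
Proof.
move=> [m1 [mm1 W1] [n1 N1 <-]] [m2 [mm2 W2] [n2 N2 <-]].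
rewrite !linearDr /= !linearDl /= (lag_om mu_lag mm1 mm2) (om_WN W1 N2) (N1 _ W2).
by rewrite (N1 _ (N_W N2)) !addr0.
Qed.

(** The pairing of [mu /\ W] with [V] is perfect, both having dimension [n], and the other two
    components do not contribute to it. *)
Lemma VNmu_be v n' m : V v -> N n' -> mu m ->
  (forall y, mu y -> W y -> om (v + n' + m) y = 0) -> v = 0.
Proof.
move=> Vv Nn mm hx.
apply: (pairing_right (om := om) (N := [set 0]) smW sV s0 dim_muW hV) => //.
- by move=> y z _ ->; rewrite linear0r.
- move=> y [my Wy] hy; apply: muN_ortho => // z Nz; exact: om_WN.
- move=> y [my Wy]; apply: om_sym0.
  have := hx y my Wy; rewrite !linearDl /= (lag_om mu_lag mm my) (Nn _ Wy).
  by rewrite !addr0.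
Qed.

Lemma be_lag : be = W `&` annihilator om be.
Proof.
apply/seteqP; split => [x bx|x [Wx hx]].
  by split; [exact: be_W|move=> y by_; exact: be_iso].
have [v [n' [m [Vv Nn mm E]]]] := VNmu x.
have v0 : v = 0.
  apply: (VNmu_be Vv Nn mm) => y my Wy; rewrite -E; apply: hx; exact: muW_be.
have {}E : x = m + n' by rewrite E v0 add0r addrC.
rewrite E; exists m; last by exists n'.
by split => //; rewrite -[m](addrK n') -E; apply: subB => //; exact: N_W.
Qed.

Lemma findim_WN : findim_mod W N.
Proof.
have [m _ hm] : exists2 m, (m <= n)%N & has_dim_mod lam N m.
  apply: (pairing_findim (om := om) slam sN hV).
    by move=> x y _ ->; rewrite linear0r.
  by move=> x lx hx; rewrite N_def; split.
exists (n + m)%N; apply: (dim_add sN slam N_lam lam_W _ hm).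
apply/(@dim_iso _ _ _ idfun _ V [set 0] W lam) => //.
- exact: V_W.
- by move=> x Vx; split => [->|lx]; [exact: sub0|exact: Vlam0].
- by move=> _ [v Vv [l ll <-]]; exists v => //=; rewrite addrC addKr.
Qed.

Section Complement.
Variable L : set Z.
Hypotheses (NL : N `<=` L) (LW : L `<=` W) (LE : L = W `&` annihilator om L)
  (Llam : L `&` reduction W N lam = N) (Lmu : L `&` be = N).

Lemma complement_lagrangian : lagrangian om L.
Proof.
rewrite /lagrangian {1}LE; apply/seteqP; split => [x []//|x hx]; split => //.
by rewrite -ann_N; exact: ann_anti hx.
Qed.

Let sL : lin_sub L := lag_sub complement_lagrangian.

Lemma lam_cap : lam `&` L = N.
Proof. by rewrite setIC -{1}reduction_lam. Qed.

Lemma mu_cap : mu `&` L = [set 0].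
Proof.
apply/seteqP; split => [x [mx Lx]|x ->]; last by split; exact: sub0.
apply: mu_N0 => //; rewrite -Lmu; split => //; apply: muW_be => //; exact: LW.
Qed.

Lemma W_sub_Lbe : W `<=` sumset L be.
Proof. by apply: (complement_sum (om := om) sW sN findim_WN om_WN) => //; [exact: N_be|exact: be_lag]. Qed.

Lemma W_sub_Llam : W `<=` sumset L lam.
Proof.
apply: (complement_sum (om := om) sW sN findim_WN om_WN) => //; first exact: N_lam.
  apply/seteqP; split => [x lx|x [_ hx]].
    by split; [exact: lam_W|move=> y ly; exact: lag_om lam_lag lx ly].
  exact: lag_in lam_lag hx.
by have := Llam; rewrite reduction_lam.
Qed.

Lemma complement_direct : direct_sum mu L.
Proof.
split; first exact: mu_cap.
apply/seteqP; split => // z _; have [v [n' [m [Vv Nn mm ->]]]] := VNmu z.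
have [l Ll [_ [m' [mm' _] [n2 N2 <-]] E]] := W_sub_Lbe (V_W Vv).
exists (m + m'); first exact: subD.
exists (l + n2 + n'); first by do 2?[apply: subD] => //; exact: NL.
by rewrite -E [RHS]addrC -addrA; congr (_ + _); rewrite !addrA [m' + l]addrC.
Qed.

(** Here [L] stands for [Y] and [mu] for [X]; [A] becomes [N] and [B] is null, so that [j = 0]. *)
Lemma complement_moment : exists k, moment om mu L lam mu d 0 k.
Proof.
have [n' hn] := findim_WN; have [k _ hk] := dim_sub sL sN LW hn.
exists k; split => //.
- by split => //; exact: complement_lagrangian.
- exact: complement_direct.
- rewrite mu_cap lam_cap; split.
    have -> : N `&` [set 0] = [set 0].
      by apply/seteqP; split => [x []//|x ->]; split => //; exact: sub0 sN.
    exact: has_dim0.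
  have -> : sumset N [set 0] = N; last exact: hk.
  apply/seteqP; split => [_ [x Nx [y -> <-]]|x Nx]; first by rewrite addr0.
  by exists x => //; exists 0 => //; rewrite addr0.
Qed.

(** For [m] in [mu /\ W], a vector of [lam] that differs from [m] by an element of [L] makes a pair
    with [m], and the difference represents the graph map at [m]. Pairs represent [be/N] through
    their second component, and changes modulo [N] are invisible to [om] on [W]. *)
Lemma complement_morse neg p : max_pos (signed neg (qhat om)) (diff_in lam mu L) p ->
  morse_mod neg be N (graph_form om (reduction W N lam) L) = p.
Proof.
rewrite reduction_lam => hp.
pose rel (x : Z) (e : Z * Z) := N (x - e.2) /\ diff_in lam mu L e.
have s2 : (-1) ^+ neg * (-1) ^+ neg = 1 :> R[i] by rewrite -expr2 sqrr_sign.
have sD := lin_sub_diff_in lam_lag mu_lag sL.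
have eW e : diff_in lam mu L e -> W e.2.
  move=> [l m Lx]; rewrite -[e.2](subKr e.1); apply: subB => //; first exact: lam_W.
  exact: LW.
have rel_D x : be x -> exists2 e, diff_in lam mu L e & rel x e.
  move=> [m [mm Wm] [n1 N1 <-]]; have [l Ll [l' ll' E]] := W_sub_Llam Wm.
  have De : diff_in lam mu L (l', m).
    by split => //=; rewrite -E opprD addrCA subrr addr0; exact: subN.
  by exists (l', m) => //; split => //=; rewrite addrC addKr.
have rel_q x e : be x -> rel x e -> graph_form om lam L x x = (-1) ^+ neg * signed neg (qhat om) e e.
  move=> bx [Nx De]; rewrite /signed mulrA s2 mul1r.
  have [l m Le] := De; have We := eW _ De.
  have Wx := be_W bx.
  rewrite (qhat_lag lam_lag mu_lag complement_lagrangian De De) /graph_form /graph_map.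
  have Lz : L (e.1 - x).
    have -> : e.1 - x = (e.1 - e.2) - (x - e.2) by rewrite opprB addrA subrK.
    by apply: subB => //; exact: NL.
  case: xgetP => [z _ [Lz' lz]|/(_ (e.1 - x))[]]; last by split => //; rewrite addrC subrK.
  have Nd : N (z - (e.1 - x)).
    rewrite -lam_cap; split; last exact: (subB sL).
    by rewrite opprB addrA [z + x]addrC; exact: (subB slam).
  have -> : om x z = om x (e.1 - x).
    by apply/eqP; rewrite -subr_eq0 -linearBr /= (om_WN Wx Nd).
  rewrite !linearBr /= (be_iso bx bx) subr0 (lag_om lam_lag l l) sub0r.
  have -> : om x e.1 = om e.2 e.1.
    by apply/eqP; rewrite -subr_eq0 -linearBl /= (Nx _ (lam_W l)).
  have := lag_om complement_lagrangian Le Le.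
  rewrite !linearBr /= !linearBl /= (lag_om lam_lag l l) (lag_om mu_lag m m) sub0r subr0.
  by move=> /eqP; rewrite subr_eq0 eqr_oppLR => /eqP ->.
apply: (morse_modE (rel := rel) _ sbe sN N_be _ _ rel_D _ rel_q hp).
- by apply: signed_herm; exact: qhat_herm.
- move=> x y bx Ny; have [e De re] := rel_D _ bx.
  have re' : rel (x + y) e by split => //; rewrite addrAC; exact: (subD sN re.1 Ny).
  by rewrite (rel_q _ _ bx re) (rel_q _ _ (subD sbe bx (N_be Ny)) re').
- move=> r c b e h; split; last by apply: sub_lc => // i; case: (h i).
  have -> : (lc c e).2 = lc c (fun i => (e i).2) by apply: (@lc_linear _ _ _ (fun p : Z * Z => p.2)).
  by rewrite -lc_subf; apply: sub_lc => // i; case: (h i).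
- move=> e De; exists e.2; last by split => //; rewrite subrr; exact: sub0.
  by apply: muW_be; [case: De|exact: eW].
Qed.

End Complement.

End Reduction.

(** * The form of two linear relations *)

Section RelationForm.
Variables (C : numClosedFieldType) (Z : lmodType C).
Variable om : {hermitian Z for true & @Num.conj C}.
Variables (X Y lam mu : set Z) (d j k : nat).
Hypothesis mom : moment om X Y lam mu d j k.

Let nd : forall x, (forall y, om x y = 0) -> x = 0. Proof. by case: mom. Qed.
Let X_lag : lagrangian om X. Proof. by case: mom => _ []. Qed.
Let Y_lag : lagrangian om Y. Proof. by case: mom => _ []. Qed.
Let lam_lag : lagrangian om lam. Proof. by case: mom => _ []. Qed.
Let mu_lag : lagrangian om mu. Proof. by case: mom => _ []. Qed.
Let XY : direct_sum X Y. Proof. by case: mom. Qed.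
Let sX := lag_sub X_lag.
Let sY := lag_sub Y_lag.
Let slam := lag_sub lam_lag.
Let smu := lag_sub mu_lag.
Let D := rel_dom X Y lam `&` rel_dom X Y mu.
Let Q := rel_form om Y lam mu.
Let s0 := @lin_sub0 _ Z.

Lemma XY0 x : X x -> Y x -> x = 0.
Proof. by move=> Xx Yx; have : (X `&` Y) x by []; rewrite XY.1. Qed.

Lemma XY_split z : exists x y, [/\ X x, Y y & z = x + y].
Proof. by have : [set: Z] z by []; rewrite -XY.2 => -[x Xx [y Yy <-]]; exists x, y. Qed.

Lemma lin_sub_rel_dom l : lin_sub l -> lin_sub (rel_dom X Y l).
Proof.
move=> sl; split; first by split; [exact: sub0|exists 0; [exact: sub0|rewrite addr0; exact: sub0]].
move=> a x x' [Xx [y Yy h]] [Xx' [y' Yy' h']]; split.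
  by apply: subD => //; exact: subZ.
exists (a *: y + y'); first by apply: subD => //; exact: subZ.
by rewrite addrACA -scalerDr; apply: subD => //; exact: subZ.
Qed.

Let sD : lin_sub D.
Proof. by apply: lin_subI; exact: lin_sub_rel_dom. Qed.

(** Two values of [lam - mu] at [x] differ by an element of [A + B]; as [z] annihilates [A + B], the
    choice made by [xget] does not matter. *)
Lemma rel_form_value x z l m : D x -> lam l -> mu m -> Y (l - x) -> Y (m - x) ->
  (forall b, sumset (lam `&` Y) (mu `&` Y) b -> om z b = 0) -> Q z x = om z (l - m).
Proof.
move=> [[Xx [y1 Yy1 ly1]] [_ [y2 Yy2 my2]]] ll mm Yl Ym hz; rewrite /Q /rel_form.
case: xgetP => [y _ [a [Ya la] [b [Yb mb] <-]]|/(_ (y1 - y2))[]]; last first.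
  by exists y1 => //; exists y2.
apply/eqP; rewrite -subr_eq0 -linearBr /=; apply/eqP; apply: hz.
exists (x + a - l).
  split; first exact: (subB slam).
  by rewrite addrAC -[x - l]opprB addrC; exact: (subB sY).
exists (- (x + b - m)).
  split; first by apply: (subN smu); exact: (subB smu).
  by rewrite opprB opprD addrA; exact: (subB sY).
have -> : a - b = (x + a) - (x + b) by rewrite opprD addrACA subrr add0r.
by rewrite !opprD !opprK addrACA.
Qed.

Lemma D_ortho z b : D z -> sumset (lam `&` Y) (mu `&` Y) b -> om z b = 0.
Proof.
move=> [[Xz [y1 Yy1 ly1]] [_ [y2 Yy2 my2]]] hb.
apply: (om_DY lam_lag mu_lag Y_lag (x := z)) => //.
  split; [exists (z + y1) => //; exists (- y1); [exact: subN|rewrite addrK //]|].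
  by exists (z + y2) => //; exists (- y2); [exact: subN|rewrite addrK].
by case: hb => a [_ Ya] [b' [_ Yb] <-]; exact: subD.
Qed.

(** A vector [x] of the domain corresponds to the pairs [(x + y1, x + y2)] of [lam x mu] with [y1]
    and [y2] in [Y], and every pair with difference in [Y] has this form. *)
Lemma relation_morse neg p : max_pos (signed neg (qhat om)) (diff_in lam mu Y) p ->
  morse neg D Q = p.
Proof.
move=> hp.
pose rel (x : Z) (e : Z * Z) := [/\ X x, Y (e.1 - x), Y (e.2 - x) & diff_in lam mu Y e].
have s2 : (-1) ^+ neg * (-1) ^+ neg = 1 :> C by rewrite -expr2 sqrr_sign.
have rel_q x e : D x -> rel x e -> Q x x = (-1) ^+ neg * signed neg (qhat om) e e.
  move=> Dx [Xx Y1 Y2 De]; rewrite /signed mulrA s2 mul1r.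
  have [ll mm Ye] := De.
  rewrite (rel_form_value Dx ll mm Y1 Y2) => [|b]; last exact: D_ortho.
  rewrite (qhat_lag lam_lag mu_lag Y_lag De De); apply/eqP.
  by rewrite -subr_eq0 -linearBl /= -opprB linearNl /= (lag_om Y_lag Y1 Ye) oppr0.
apply: (morse_modE (rel := rel) _ sD s0 _ _ _ _ _ rel_q hp).
- by apply: signed_herm; exact: qhat_herm.
- by move=> x ->; exact: sub0.
- by move=> x y _ ->; rewrite addr0.
- move=> r c b e h; split.
  + by apply: sub_lc => // i; case: (h i).
  + have -> : (lc c e).1 = lc c (fun i => (e i).1) by apply: (@lc_linear _ _ _ (fun p : Z * Z => p.1)).
    by rewrite -lc_subf; apply: sub_lc => // i; case: (h i).
  + have -> : (lc c e).2 = lc c (fun i => (e i).2) by apply: (@lc_linear _ _ _ (fun p : Z * Z => p.2)).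
    by rewrite -lc_subf; apply: sub_lc => // i; case: (h i).
  + by apply: sub_lc => [|i]; [exact: (lin_sub_diff_in lam_lag mu_lag sY)|case: (h i)].
- move=> x [[Xx [y1 Yy1 ly1]] [_ [y2 Yy2 my2]]].
  have De : diff_in lam mu Y (x + y1, x + y2).
    by split => //=; rewrite opprD addrACA subrr add0r; exact: subB.
  exists (x + y1, x + y2) => //; split => //=; first by rewrite addrAC subrr add0r.
  by rewrite addrAC subrr add0r.
- move=> e De; have [ll mm Ye] := De; have [x [y [Xx Yy E]]] := XY_split e.1.
  have Y1 : Y (e.1 - x) by rewrite E addrAC subrr add0r.
  have Y2 : Y (e.2 - x).
    have -> : e.2 - x = (e.1 - x) - (e.1 - e.2) by rewrite opprB [RHS]addrC addrA subrK.
    exact: subB.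
  exists x; last by split.
  by split; split => //; [exists (e.1 - x)|exists (e.2 - x)]; rewrite // addrC subrK.
Qed.

(** The projection to [X] along [Y] maps [lam /\ mu] onto the kernel of [Q], and its own kernel is
    [A /\ B]. The set [G] is the graph of this projection. *)
Lemma relation_kernel_dim : sdim (lam `&` mu) = (sdim (form_ker D Q) + j)%N.
Proof.
have [_ _ _ [hd hd'] [hj hk]] := mom.
have [dj hdj E] := quotient_dim nd lam_lag mu_lag Y_lag hd hd' hj hk.
have sA : lin_sub (lam `&` Y) by exact: lin_subI.
have sB : lin_sub (mu `&` Y) by exact: lin_subI.
have sAB : lin_sub (lam `&` Y `&` (mu `&` Y)) by exact: lin_subI.
have sI : lin_sub (lam `&` mu) by exact: lin_subI.
pose G : set (Z * Z) := [set e | [/\ (lam `&` mu) e.1, X e.2 & Y (e.1 - e.2)]].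
pose G0 : set (Z * Z) := [set e | G e /\ e.2 = 0].
have sG : lin_sub G.
  split; first by split; rewrite /= ?subrr; [exact: (sub0 sI)|exact: (sub0 sX)|exact: (sub0 sY)].
  move=> a [x1 x2] [y1 y2] [/= h1 h2 h3] [/= h4 h5 h6]; split => /=.
  - exact: (subD sI (subZ _ sI _)).
  - exact: (subD sX (subZ _ sX _)).
  - by rewrite opprD addrACA -scalerBr; exact: (subD sY (subZ _ sY _)).
have sG0 : lin_sub G0.
  split; first by split => //; exact: (sub0 sG).
  move=> a x y [h1 h2] [h3 h4]; split; first exact: (subD sG (subZ _ sG _)).
  by rewrite /= h2 h4 scaler0 addr0.
have GD e : G e -> D e.2.
  move=> [[l m] Xe Ye]; split; split => //; exists (e.1 - e.2) => //; by rewrite addrC subrK.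
have h1 : has_dim_mod G G0 dj.
  apply/(@dim_iso _ _ _ (fun e : Z * Z => e.1) _ G G0 (lam `&` mu) (lam `&` Y `&` (mu `&` Y))) => //.
  - by move=> [a b] [].
  - move=> [a b] [/= [l m] Xb Yab]; split => [[_ /= b0]|[[_ Ya] _]].
      by rewrite b0 subr0 in Yab.
    split; first by split.
    by apply: XY0 => //=; rewrite -[b](subKr a); exact: (subB sY).
  - move=> z Iz; have [x [y [Xx Yy E1]]] := XY_split z; exists (z, x).
      by split => //=; rewrite E1 addrAC subrr add0r.
    by rewrite /= subrr; exact: (sub0 sAB).
have h2 : has_dim_mod (form_ker D Q) [set 0] dj.
  apply/(@dim_iso _ _ _ (fun e : Z * Z => e.2) _ G G0 (form_ker D Q) [set 0]) => //.
  - move=> e Ge; split; first exact: GD.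
    move=> y Dy; have [[l m] Xe Ye] := Ge.
    rewrite (rel_form_value (GD _ Ge) l m Ye Ye) ?subrr ?linear0r // => b; exact: D_ortho.
  - by move=> e Ge; split => [[]|].
  - move=> x [Dx hx]; have [[Xx [y1 Yy1 ly1]] [_ [y2 Yy2 my2]]] := Dx.
    have Ydiff : Y (y1 - y2) by exact: subB.
    have val y : D y -> om y (y1 - y2) = 0.
      move=> Dy; have := hx _ Dy; rewrite (rel_form_value Dx ly1 my2) => [|||b].
      - by rewrite opprD addrACA subrr add0r.
      - by rewrite addrAC subrr add0r.
      - by rewrite addrAC subrr add0r.
      - exact: D_ortho.
    (* By the double annihilator property [y1 - y2 = a + b], so [x + y1 - a = x + y2 + b] is a point
       of [lam /\ mu] that projects to [x]. *)
    have [a [la Ya] [b [mb Yb] E1]] : sumset (lam `&` Y) (mu `&` Y) (y1 - y2).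
      apply: (relation_kernel nd lam_lag mu_lag Y_lag hd hd' hj hk Ydiff).
      move=> p [[l ll [u Yu E1]] [m mm [u' Yu' E2]]].
      have [x' [y' [Xx' Yy' Ep]]] := XY_split p.
      have -> : om p (y1 - y2) = om x' (y1 - y2).
        by rewrite Ep linearDl /= (lag_om Y_lag Yy' Ydiff) addr0.
      apply: val; split; split => //; [exists (y' - u)|exists (y' - u')]; try exact: (subB sY).
        by rewrite addrA -Ep -E1 addrK.
      by rewrite addrA -Ep -E2 addrK.
    exists (x + y1 - a, x); last by rewrite /= subrr.
    split => //=.
      split; first exact: (subB slam).
      have -> : x + y1 - a = x + y2 + b.
        rewrite -addrA; have -> : y1 - a = y2 + b; last by rewrite addrA.
        by apply/eqP; rewrite subr_eq -addrA [b + a]addrC E1 addrC subrK.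
      exact: (subD smu).
    have -> : x + y1 - a - x = y1 - a by rewrite [x + y1]addrC addrAC addrK.
    exact: (subB sY).
by rewrite /sdim (dim_modE s0 hd) (dim_modE s0 h2) -E.
Qed.

End RelationForm.

(** * Gap continuous paths *)

Section Gap.
Variables (R : realType) (Z : completeNormedModType R[i]).
Implicit Types (M N : set Z) (x y : Z).

Lemma dist_le x y N : N y -> dist x N <= rnorm (x - y).
Proof.
move=> Ny; apply: ge_inf; last by exists y.
by exists 0 => _ [z Nz <-]; exact: rnorm_ge0.
Qed.

Lemma semigap_near M N (e : R) : lin_sub M -> lin_sub N -> semigap M N < e -> near_sub e M N.
Proof.
move=> sM sN h x Mx; have [x0|x0] := eqVneq (rnorm x) 0.
  by exists 0; [exact: sub0|rewrite (rnorm_eq0 x0) subrr rnorm0 mulr0].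
have xp : 0 < rnorm x by rewrite lt_neqAle eq_sym x0 rnorm_ge0.
pose u := ((rnorm x)^-1)%:C%C *: x.
have u1 : rnorm u = 1 by rewrite rnormZ rnormC gtr0_norm ?invr_gt0 // mulVf.
have Mu : M u by exact: subZ.
have hu : dist u N < e.
  apply: le_lt_trans h; apply: ub_le_sup; last by exists u.
  exists 1 => _ [y [My y1] <-]; rewrite -y1 -[y in leRHS]subr0; exact: (dist_le _ (sub0 sN)).
have hne : [set rnorm (u - y) | y in N] !=set0 by exists (rnorm (u - 0)), 0 => //; exact: sub0.
have [_ [y Ny <-] hy] := inf_lt hne hu; exists ((rnorm x)%:C%C *: y); first exact: subZ.
have E : x = (rnorm x)%:C%C *: u by rewrite /u scalerA -rmorphM mulfV // scale1r.
rewrite {1}E -scalerBr rnormZ rnormC ger0_norm ?rnorm_ge0 // mulrC.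
by rewrite ler_pM2r // ltW.
Qed.

Lemma semigap_ge0 M N : lin_sub N -> 0 <= semigap M N.
Proof.
move=> sN; rewrite /semigap; set S := [set _ | _ in _].
have [->|/set0P[w [x [Mx x1] _]]] := eqVneq S set0; first by rewrite sup0.
apply: (@le_trans _ _ (dist x N)).
  apply: lb_le_inf; first by exists (rnorm (x - 0)), 0 => //; exact: sub0.
  by move=> _ [y _ <-]; exact: rnorm_ge0.
apply: ub_le_sup; last by exists x.
exists 1 => _ [y [My y1] <-]; rewrite -y1 -[y in leRHS]subr0; exact: (dist_le _ (sub0 sN)).
Qed.

Lemma near_semigap M N (e : R) : 0 <= e -> near_sub e M N -> semigap M N <= e.
Proof.
move=> e0 h; rewrite /semigap; set S := [set _ | _ in _].
have [S0|/set0P Sn] := eqVneq S set0; first by rewrite S0 sup0.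
apply: ge_sup => // _ [x [Mx x1] <-]; have [y Ny xy] := h x Mx.
by apply: le_trans (dist_le _ Ny) _; rewrite x1 mulr1 in xy.
Qed.

End Gap.

Section Paths.
Variables (R : realType) (Z : completeNormedModType R[i]).
Implicit Types (M : R -> set Z) (om : R -> {hermitian Z for true & @Num.conj R[i]}).

Definition at_time (a b s : R) : set_system R := within `[a, b] (nbhs s).

#[local] Instance at_time_filter a b s : Filter (at_time a b s).
Proof. exact: within_filter. Qed.

Lemma at_time_in a b s : \forall t \near at_time a b s, t \in `[a, b].
Proof. by apply: filterS (withinT _ _). Qed.

Lemma at_time_delta a b s (P : set R) : (\forall t \near at_time a b s, P t) ->
  exists2 e : R, 0 < e & forall t, t \in `[a, b] -> `|t - s| < e -> P t.
Proof.
rewrite near_withinE => /nbhs_ballP[e /= e0 h]; exists e => // t tab ts.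
by apply: h => //; rewrite /ball /= distrC.
Qed.

Lemma delta_at_time a b s (P : set R) (e : R) : 0 < e ->
  (forall t, t \in `[a, b] -> `|t - s| < e -> P t) -> \forall t \near at_time a b s, P t.
Proof.
move=> e0 h; rewrite near_withinE; apply/nbhs_ballP; exists e => // t /= ts tab.
by apply: h => //; rewrite distrC.
Qed.

Lemma at_time_mono a b a' b' s (P : set R) : a <= a' -> b' <= b ->
  (\forall t \near at_time a b s, P t) -> \forall t \near at_time a' b' s, P t.
Proof.
move=> aa bb /at_time_delta[e e0 h]; apply: (delta_at_time e0) => t tab.
by apply: h; apply: subset_itvScc tab.
Qed.

Lemma path_sub a b M s : subspace_path a b M -> s \in `[a, b] -> lin_sub (M s) /\ closed (M s).
Proof. by move=> [h _] /h[/lin_subP]. Qed.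

Lemma path_near a b M s (e : R) : subspace_path a b M -> s \in `[a, b] -> 0 < e ->
  \forall t \near at_time a b s, gap (M t) (M s) < e.
Proof.
move=> [_ h] sab e0; have /cvgr0Pnorm_lt := h s sab => /(_ _ e0).
by apply: filterS => t; exact: le_lt_trans (ler_norm _).
Qed.

Lemma path_lsc a b M s : subspace_path a b M -> s \in `[a, b] -> lsc (at_time a b s) M (M s).
Proof.
move=> pM sab e e0; apply: filterS2 (path_near pM sab e0) (at_time_in a b s) => t gt tab.
apply: semigap_near; [by case: (path_sub pM sab)|by case: (path_sub pM tab)|].
by apply: le_lt_trans gt; rewrite /gap le_max lexx orbT.
Qed.

Lemma path_usc a b M s : subspace_path a b M -> s \in `[a, b] -> usc (at_time a b s) M (M s).
Proof.
move=> pM sab e e0; apply: filterS2 (path_near pM sab e0) (at_time_in a b s) => t gt tab.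
apply: semigap_near; [by case: (path_sub pM tab)|by case: (path_sub pM sab)|].
by apply: le_lt_trans gt; rewrite /gap le_max lexx.
Qed.

Lemma path_intro a b M : (forall s, s \in `[a, b] -> lin_sub (M s) /\ closed (M s)) ->
  (forall s, s \in `[a, b] -> lsc (at_time a b s) M (M s) /\ usc (at_time a b s) M (M s)) ->
  subspace_path a b M.
Proof.
move=> h1 h2; split=> s sab; first by have [/lin_subP] := h1 _ sab.
have [l u] := h2 _ sab; apply/cvgr0Pnorm_le => e e0.
apply: filterS2 (l e e0) (u e e0) => t lt ut.
rewrite ger0_norm; last by rewrite /gap le_max semigap_ge0 //; case: (h1 _ sab).
by rewrite /gap ge_max !near_semigap // ltW.
Qed.

Lemma path_restrict a b a' b' M : a <= a' -> b' <= b ->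
  subspace_path a b M -> subspace_path a' b' M.
Proof.
move=> aa bb pM; have sub t : t \in `[a', b'] -> t \in `[a, b] by apply: subset_itvScc.
apply: path_intro => s /sub sab; first exact: path_sub pM sab.
split=> e e0; apply: (at_time_mono aa bb); [exact: path_lsc|exact: path_usc].
Qed.

Lemma form_path_cvg a b om s : (forall t, t \in `[a, b] -> symplectic (om t)) ->
  form_path a b om -> s \in `[a, b] -> form_cvg (at_time a b s) om s.
Proof.
move=> sym pom sab e e0; have /cvgr0Pnorm_lt := pom s sab => /(_ _ e0).
move=> h; apply: filterS2 h (at_time_in a b s) => t ht tab x y.
have {}ht : form_norm (fun x y => om t x y - om s x y) < e by exact: le_lt_trans (ler_norm _) ht.
have [x0|x0] := eqVneq (rnorm x) 0.
  by rewrite x0 (rnorm_eq0 x0) !linear0l subrr rnorm0 mulr0 mul0r.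
have [y0|y0] := eqVneq (rnorm y) 0.
  by rewrite y0 (rnorm_eq0 y0) !linear0r subrr rnorm0 ?mulr0.
have xp : 0 < rnorm x by rewrite lt_neqAle eq_sym x0 rnorm_ge0.
have yp : 0 < rnorm y by rewrite lt_neqAle eq_sym y0 rnorm_ge0.
have scal (z : Z) : rnorm z != 0 -> exists2 u, rnorm u <= 1 & z = (rnorm z)%:C%C *: u.
  move=> z0; have zp : 0 < rnorm z by rewrite lt_neqAle eq_sym z0 rnorm_ge0.
  exists (((rnorm z)^-1)%:C%C *: z).
    by rewrite rnormZ rnormC gtr0_norm ?invr_gt0 // mulVf.
  by rewrite scalerA -rmorphM mulfV // scale1r.
have [u u1 xE] := scal x x0; have [v v1 yE] := scal y y0.
have uv : rnorm (om t u v - om s u v) < e.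
  (* The supremum in [form_norm] dominates its members because both forms, and hence their
     difference, are bounded. *)
  apply: le_lt_trans ht; apply: ub_le_sup; last by exists (u, v).
  have [B1 [B10 hB1]] := om_boundP (sym _ tab).1; have [B2 [B20 hB2]] := om_boundP (sym _ sab).1.
  exists (B1 + B2) => _ [[p q] [/= p1 q1] <-]; apply: le_trans (rnormB _ _) _.
  apply: lerD.
    apply: le_trans (hB1 _ _) _; rewrite -mulrA -[leRHS]mulr1 ler_wpM2l //.
    by rewrite -[leRHS]mulr1 ler_pM ?rnorm_ge0.
  apply: le_trans (hB2 _ _) _; rewrite -mulrA -[leRHS]mulr1 ler_wpM2l //.
  by rewrite -[leRHS]mulr1 ler_pM ?rnorm_ge0.
have omE r : om r x y = (rnorm x)%:C%C * ((rnorm y)%:C%C * om r u v).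
  rewrite {1}xE {1}yE linearZl_LR /= linearZr_LR /=; congr (_ * (_ * _)).
  by apply/CrealP; rewrite complex_real.
rewrite !omE -!mulrBr !rnormM !rnormC !ger0_norm ?rnorm_ge0 //.
by rewrite mulrA -[leRHS]mulrA [leRHS]mulrC ler_pM2l ?mulr_gt0 // ltW.
Qed.

Lemma form_path_restrict a b a' b' om : a <= a' -> b' <= b ->
  form_path a b om -> form_path a' b' om.
Proof.
move=> aa bb pom s sab; have sab' : s \in `[a, b] by apply: subset_itvScc sab.
apply/cvgr0Pnorm_lt => e e0; apply: (at_time_mono aa bb).
by have /cvgr0Pnorm_lt := pom s sab' => /(_ _ e0).
Qed.

End Paths.

(** Real induction: the supremum of the [x] with [P a x] is itself such an [x], and it cannot be
    smaller than [b]. The local hypothesis concerns intervals containing [s], possibly as an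
    endpoint. *)
Lemma cousin (R : realType) (a b : R) (P : R -> R -> Prop) : a < b ->
  (forall x y z, a <= x -> x < y -> y < z -> z <= b -> P x y -> P y z -> P x z) ->
  (forall s, a <= s <= b -> exists2 e, 0 < e & forall x y, a <= x -> x <= s -> s <= y -> y <= b ->
     x < y -> s - e < x -> y < s + e -> P x y) ->
  P a b.
Proof.
move=> ab add loc.
pose S := [set x | a < x <= b /\ P a x].
have hS : has_sup S.
  have [|e e0 ha] := loc a; first by rewrite lexx ltW.
  split; last by exists b => x [/andP[]].
  pose x := Num.min b (a + e / 2).
  have ax : a < x by rewrite lt_min ab ltrDl divr_gt0.
  have xb : x <= b by rewrite ge_min lexx.
  have xe : x <= a + e / 2 by rewrite ge_min lexx orbT.
  exists x; split; first by rewrite ax.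
  by apply: ha => //; [exact: ltW|lra|lra].
pose c := sup S.
have Sc x : S x -> x <= c by move=> Sx; apply: ub_le_sup => //; case: hS.
have cb : c <= b by apply: ge_sup => [|x [/andP[]]//]; case: hS.
have ac : a < c by have [[x Sx] _] := hS; apply: lt_le_trans (Sc _ Sx); case: Sx => /andP[].
have [|e e0 hc] := loc c; first by rewrite cb ltW.
have Pc : P a c.
  have [x Sx cx] := sup_adherent e0 hS.
  have xc := Sc _ Sx; have [/andP[ax xb] Px] := Sx.
  have [->//|xNc] := eqVneq c x.
  have xltc : x < c by rewrite lt_neqAle eq_sym xNc.
  apply: (add a x c) => //; apply: hc => //; [exact: ltW|lra].
have [<-//|cNb] := eqVneq c b.
have cltb : c < b by rewrite lt_neqAle cNb.
pose y := Num.min b (c + e / 2).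
have cy : c < y by rewrite lt_min cltb ltrDl divr_gt0.
have yb : y <= b by rewrite ge_min lexx.
have ye : y <= c + e / 2 by rewrite ge_min lexx orbT.
suff /Sc : S y by rewrite leNgt cy.
split; first by rewrite yb andbT; exact: lt_trans cy.
apply: (add a c y) => //; apply: hc => //; [exact: ltW|exact: ltW|lra|lra].
Qed.

(** * The value of the Maslov index *)

#[local] Existing Instance at_time_filter.

Section Partition.
Variables (R : realType) (a b : R) (n : nat) (t : nat -> R).
Hypothesis tp : time_partition a b n t.

Lemma partition_le k l : (k <= l)%N -> (l <= n)%N -> t k <= t l.
Proof.
have [_ _ tS] := tp; move=> /subnK <-; elim: (l - k)%N => [|i IH] // ln.
rewrite addSn in ln *; apply: le_trans (IH (ltnW ln)) _; exact/ltW/tS.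
Qed.

Lemma partition_ge k : (k <= n)%N -> a <= t k.
Proof. by move=> kn; have [<- _ _] := tp; exact: partition_le. Qed.

Lemma partition_le_end k : (k <= n)%N -> t k <= b.
Proof. by move=> kn; have [_ <- _] := tp; exact: partition_le. Qed.

Lemma partition_in k s : (k < n)%N -> s \in `[t k, t k.+1] -> s \in `[a, b].
Proof.
move=> kn; apply: subset_itvScc; rewrite ?bnd_simp.
  exact: partition_ge (ltnW kn).
exact: partition_le_end.
Qed.

End Partition.

(** Eliminates the values at the centre [s] from its comparisons with [x] and with [y]. *)
Lemma index_chain (ms js ns is_ mx jx nx ix my jy ny iy : nat) :
  (mx + js + (ns + ix) = ms + jx + (nx + is_))%N ->
  (my + js + (ns + iy) = ms + jy + (ny + is_))%N ->
  (my + jx + (nx + iy) = mx + jy + (ny + ix))%N.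
Proof. lia. Qed.

Section IndexDifference.
Variables (R : realType) (Z : completeNormedModType R[i]).
Variable om : R -> {hermitian Z for true & @Num.conj R[i]}.
Variables (lam mu : R -> set Z) (d : R -> nat) (a b : R).
Hypotheses (ab : a < b) (symp : forall s, s \in `[a, b] -> symplectic (om s)).
Hypothesis om_cvg : forall s, s \in `[a, b] -> form_cvg (at_time a b s) om s.
Hypothesis llam : forall s, s \in `[a, b] -> lsc (at_time a b s) lam (lam s).
Hypothesis lmu : forall s, s \in `[a, b] -> lsc (at_time a b s) mu (mu s).

Lemma index_difference X Y j k X' Y' j' k' (neg : bool) (m m' : R -> nat) :
  (forall s, s \in `[a, b] -> admissible (at_time a b s) s om lam mu d X Y j k) ->
  (forall s, s \in `[a, b] -> admissible (at_time a b s) s om lam mu d X' Y' j' k') ->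
  (forall s, s \in `[a, b] -> index_at om lam mu Y neg s (m s)) ->
  (forall s, s \in `[a, b] -> index_at om lam mu Y' neg s (m' s)) ->
  (m b + j a + (m' a + j' b) = m a + j b + (m' b + j' a))%N.
Proof.
move=> ad ad' im im'.
pose P x y := (m y + j x + (m' x + j' y) = m x + j y + (m' y + j' x))%N.
apply: (@cousin R a b P ab); rewrite /P; first by move=> x y z _ _ _ _; lia.
move=> s /andP[as_ sb].
have sab : s \in `[a, b] by rewrite in_itv /= as_ sb.
have sympn : \forall t \near at_time a b s, symplectic (om t).
  by apply: filterS (at_time_in a b s) => t; exact: symp.
have := index_comparison (at_time_filter a b s) (symp sab) sympn (om_cvg sab) (llam sab) (lmu sab)
  (ad s sab) (ad' s sab).
move=> /at_time_delta[e e0 he]; exists e => // x y ax xs sy yb xy sx ys.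
have xab : x \in `[a, b] by rewrite in_itv /= ax (le_trans xs).
have yab : y \in `[a, b] by rewrite in_itv /= yb (le_trans as_).
have hx : `|x - s| < e by rewrite ler0_norm ?subr_le0 // opprB ltrBlDr -ltrBlDl.
have hy : `|y - s| < e by rewrite ger0_norm ?subr_ge0 // ltrBlDl.
exact: index_chain (he x xab hx neg _ _ _ _ (im s sab) (im x xab) (im' s sab) (im' x xab))
  (he y yab hy neg _ _ _ _ (im s sab) (im y yab) (im' s sab) (im' y yab)).
Qed.

End IndexDifference.

Section Value.
Variables (R : realType) (Z : completeNormedModType R[i]).
Variable om : R -> {hermitian Z for true & @Num.conj R[i]}.
Variables (X Y lam mu : R -> set Z) (d j k : R -> nat).
Hypothesis mom : forall s, s \in `[0, 1] -> moment (om s) (X s) (Y s) (lam s) (mu s) (d s) (j s) (k s).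
Hypothesis symp : forall s, s \in `[0, 1] -> symplectic (om s).
Hypotheses (om_path : form_path 0 1 om) (X_path : subspace_path 0 1 X) (Y_path : subspace_path 0 1 Y)
  (lam_path : subspace_path 0 1 lam) (mu_path : subspace_path 0 1 mu)
  (A_path : subspace_path 0 1 (fun s => lam s `&` Y s))
  (B_path : subspace_path 0 1 (fun s => mu s `&` Y s)).

Let D s := rel_dom (X s) (Y s) (lam s) `&` rel_dom (X s) (Y s) (mu s).
Let Q s := rel_form (om s) (Y s) (lam s) (mu s).

Definition net_index (neg : bool) (s : R) : int := (morse neg (D s) (Q s))%:Z - (j s)%:Z.

Let sub01 (a b s : R) : 0 <= a -> b <= 1 -> s \in `[a, b] -> s \in `[0, 1].
Proof. by move=> a0 b1; apply: subset_itvScc; rewrite bnd_simp. Qed.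

Lemma index_at_moment (Y' : R -> set Z) s X' d' j' k' neg :
  moment (om s) X' (Y' s) (lam s) (mu s) d' j' k' -> exists p, index_at om lam mu Y' neg s p.
Proof. by move=> /moment_index[p [n [hp hn _]]]; case: neg; [exists n|exists p]. Qed.

Lemma index_at_Y neg (s : R) : s \in `[0, 1] -> index_at om lam mu Y neg s (morse neg (D s) (Q s)).
Proof.
move=> s01; have [p hp] := index_at_moment neg (mom s01).
by rewrite (relation_morse (mom s01) hp).
Qed.

Lemma admissible_Y (a b s : R) : 0 <= a -> b <= 1 -> s \in `[a, b] ->
  admissible (at_time a b s) s om lam mu d X Y j k.
Proof.
move=> a0 b1 sab; have s01 := sub01 a0 b1 sab; split.
- exact: mom.
- by apply: filterS (at_time_in a b s) => t tab; apply: mom; exact: sub01 tab.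
- exact: path_lsc (path_restrict a0 b1 X_path) sab.
- exact: path_lsc (path_restrict a0 b1 Y_path) sab.
- split; first exact: path_lsc (path_restrict a0 b1 A_path) sab.
  exact: path_lsc (path_restrict a0 b1 B_path) sab.
Qed.

Section Piece.
Variables (a b : R) (V : set Z) (neg : bool).
Hypotheses (ab : a < b) (a0 : 0 <= a) (b1 : b <= 1).
Hypotheses (sV : lin_sub V) (fV : findim V).
Hypothesis red : forall s, s \in `[a, b] -> reducing (om s) V (lam s) (mu s).

Let W s := sumset V (lam s).
Let N s := annihilator (om s) (W s).

(** Both [Y] and [L] are admissible on the piece: [lam /\ L] is the path [N], and [mu /\ L] is null.
    Since [j = 0] for [L], the comparison leaves the Morse indices of the graph form on one side. *)
Lemma complement_difference (L : R -> set Z) : subspace_path a b N ->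
  fd_lagrangian_path a b om W N L ->
  (forall s, s \in `[a, b] -> L s `&` reduction (W s) (N s) (lam s) = N s /\
    L s `&` reduction (W s) (N s) (mu s) = N s) ->
  let ind s := (morse_mod neg (reduction (W s) (N s) (mu s)) (N s)
    (graph_form (om s) (reduction (W s) (N s) (lam s)) (L s)))%:Z in
  ind b - ind a = net_index neg b - net_index neg a.
Proof.
move=> N_path [L_path hL] hcap ind.
have [n hn] := fV.
have data s : s \in `[a, b] -> [/\ lagrangian (om s) (lam s), lagrangian (om s) (mu s),
    has_dim_mod (lam s `&` mu s) [set 0] (d s) & has_dim_mod [set: Z] (sumset (lam s) (mu s)) (d s)].
  by move=> /(sub01 a0 b1)/mom[_ [_ _ h1 h2] _ [h3 h4] _].
have nds s : s \in `[a, b] -> forall x, (forall y, om s x y = 0) -> x = 0.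
  by move=> /(sub01 a0 b1)/symp[].
have cm s : s \in `[a, b] -> exists k', moment (om s) (mu s) (L s) (lam s) (mu s) (d s) 0 k'.
  move=> sab; have [l m h h'] := data s sab; have [NL LW LE] := hL s sab.
  have [c1 c2] := hcap s sab.
  exact: (complement_moment (nds s sab) l m h h' sV hn (red sab) NL LW LE c1 c2).
have [k' hk'] : exists k' : R -> nat, forall s, s \in `[a, b] ->
    moment (om s) (mu s) (L s) (lam s) (mu s) (d s) 0 (k' s).
  (* The choice function is defined at all times; its value 0 outside [[a, b]] is arbitrary. *)
  have /choice[k' hk'] : forall s, exists k', s \in `[a, b] ->
      moment (om s) (mu s) (L s) (lam s) (mu s) (d s) 0 k'.
    move=> s; have [/cm[k' h]|h] := pselect (s \in `[a, b]); first by exists k'.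
    by exists 0%N => sab; case: h.
  by exists k'.
have idx s : s \in `[a, b] -> index_at om lam mu L neg s
    (morse_mod neg (reduction (W s) (N s) (mu s)) (N s)
    (graph_form (om s) (reduction (W s) (N s) (lam s)) (L s))).
  move=> sab; have [p hp] := index_at_moment neg (hk' s sab).
  have [l m h h'] := data s sab; have [NL LW LE] := hL s sab.
  have [c1 c2] := hcap s sab.
  by rewrite (complement_morse (nds s sab) l m h h' sV hn (red sab) NL LW LE c1 hp).
have capl s : s \in `[a, b] -> lam s `&` L s = N s.
  move=> sab; have [l m h h'] := data s sab; have [NL LW LE] := hL s sab.
  have [c1 c2] := hcap s sab; exact: (lam_cap l sV c1).
have capm s : s \in `[a, b] -> mu s `&` L s = [set 0].
  move=> sab; have [l m h h'] := data s sab; have [NL LW LE] := hL s sab.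
  have [c1 c2] := hcap s sab.
  exact: (mu_cap (nds s sab) l m h h' sV hn (red sab) NL LW LE c2).
have adL s : s \in `[a, b] -> admissible (at_time a b s) s om lam mu d mu L (fun=> 0%N) k'.
  move=> sab; split.
  - exact: hk'.
  - by apply: filterS (at_time_in a b s) => t tab; exact: hk'.
  - exact: path_lsc (path_restrict a0 b1 mu_path) sab.
  - exact: path_lsc L_path sab.
  - split.
      rewrite capl //; apply: (lsc_eq (at_time_filter a b s) _ (path_lsc N_path sab)).
      by apply: filterS (at_time_in a b s) => t tab; rewrite capl.
    rewrite capm //; apply: (lsc_eq (at_time_filter a b s) _ (lsc_cst _ _)).
    by apply: filterS (at_time_in a b s) => t tab; rewrite capm.
have om_cvg s : s \in `[a, b] -> form_cvg (at_time a b s) om s.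
  apply: form_path_cvg; last exact: form_path_restrict om_path.
  by move=> t /(sub01 a0 b1); exact: symp.
have aab : a \in `[a, b] by rewrite in_itv /= lexx ltW.
have bab : b \in `[a, b] by rewrite in_itv /= lexx andbT ltW.
have E := index_difference (neg := neg) ab (fun s sab => symp (sub01 a0 b1 sab)) om_cvg
  (fun s sab => path_lsc (path_restrict a0 b1 lam_path) sab)
  (fun s sab => path_lsc (path_restrict a0 b1 mu_path) sab)
  (fun s => admissible_Y a0 b1) adL
  (fun s sab => index_at_Y neg (sub01 a0 b1 sab)) idx.
rewrite /ind /net_index; move: E; lia.
Qed.

End Piece.

Lemma piece_value (a b : R) V neg c : a < b -> 0 <= a -> b <= 1 -> lin_sub V -> findim V ->
  (forall s, s \in `[a, b] -> reducing (om s) V (lam s) (mu s)) ->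
  let W s := sumset V (lam s) in
  let N s := annihilator (om s) (W s) in
  is_maslov_fd neg a b om W N
    (fun s => reduction (W s) (N s) (lam s)) (fun s => reduction (W s) (N s) (mu s)) c ->
  c = (-1) ^+ neg * (net_index neg b - net_index neg a).
Proof.
move=> ab a0 b1 sV fV red W N [[_ _ N_path _] _ _ [n [t [L [tp hL ->]]]]].
have [ta tb tS] := tp.
pose f i := (-1) ^+ neg * net_index neg (t i).
have -> : (-1) ^+ neg * (net_index neg b - net_index neg a) = f n - f 0%N.
  by rewrite /f tb ta mulrBr.
rewrite -(telescope_sumr f (leq0n n)) big_mkord; apply: eq_bigr => i _; have ni := ltn_ord i.
rewrite /f -mulrBr; congr (_ * _).
have ati : a <= t i := partition_ge tp (ltnW ni).
have tib : t i.+1 <= b := partition_le_end tp ni.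
have [Lp hcap] := hL i ni.
apply: (complement_difference (V := V) neg _ (le_trans a0 ati) (le_trans tib b1) sV fV _ _ Lp hcap).
- exact: tS.
- by move=> s sti; apply: red; exact: partition_in tp _ _ ni sti.
- exact: path_restrict N_path.
Qed.

Lemma maslov_value neg m : is_maslov neg 0 1 om lam mu m ->
  m = (-1) ^+ neg * (net_index neg 1 - net_index neg 0).
Proof.
move=> [n [t [V [c [tp h ->]]]]].
have [ta tb tS] := tp.
pose f i := (-1) ^+ neg * net_index neg (t i).
have -> : (-1) ^+ neg * (net_index neg 1 - net_index neg 0) = f n - f 0%N.
  by rewrite /f tb ta mulrBr.
rewrite -(telescope_sumr f (leq0n n)) big_mkord; apply: eq_bigr => i _; have ni := ltn_ord i.
rewrite /f -mulrBr; have [/lin_subP sV fV _ red fd] := h i ni.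
apply: (piece_value _ _ _ sV fV red fd).
- exact: tS.
- by have := partition_ge tp (ltnW ni).
- by have := partition_le_end tp ni.
Qed.

End Value.

(** * Stability of reductions *)

Lemma twist_estimate (R : realType) (C e B w l x V a b c : R) :
  V <= B -> 0 <= V -> 0 <= C -> 0 <= e -> 0 <= w -> 0 <= l ->
  w <= C * B * x -> l <= (1 + C * B) * x ->
  a <= e * V * w -> b <= e * V * l -> c <= C * V * (e * l) ->
  2^-1 * a + (b + c) <= e * (B * (C * B + (1 + C) * (1 + C * B))) * x.
Proof.
move=> VB V0 C0 e0 w0 l0 hw hl ha hb hc.
have B0 : 0 <= B by exact: le_trans VB.
have h1 : e * V * w <= e * B * (C * B * x).
  by apply: ler_pM => //; [exact: mulr_ge0|exact: ler_wpM2l].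
have h2 : e * V * l <= e * B * ((1 + C * B) * x).
  by apply: ler_pM => //; [exact: mulr_ge0|exact: ler_wpM2l].
have h3 : C * (e * V * l) <= C * (e * B * ((1 + C * B) * x)) by exact: ler_wpM2l.
have p : 0 <= e * V * w by rewrite !mulr_ge0.
lra.
Qed.

Section Transfer.
Variables (R : realType) (Z : completeNormedModType R[i]).
Variables (n : nat) (v : 'I_n -> Z).
Implicit Types (om : {hermitian Z for true & @Num.conj R[i]}) (P : set Z).

Definition adjustable om P (C : R) : Prop := forall l (tau : 'I_n -> R[i]), P l ->
  exists l', [/\ P l', forall i, om (v i) l' = tau i
    & rnorm (l - l') <= C * \sum_i rnorm (tau i - om (v i) l)].

Definition bounded_away P (C : R) : Prop := forall (a : 'rV[R[i]]_n) l, P l ->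
  l1 a <= C * rnorm (lc a v + l).

Section FromDual.
Variables (T : Type) (F : set_system T) (FF : Filter F) (t0 : T).
Variables (om : T -> {hermitian Z for true & @Num.conj R[i]}) (P : T -> set Z).
Hypotheses (om_cvg : form_cvg F om t0) (om0 : form_bounded (om t0)).
Hypothesis P_lag : \forall t \near F, lagrangian (om t) (P t).
Hypothesis lP : lsc F P (P t0).
Variable h : 'I_n -> Z.
Hypotheses (Ph : forall j, P t0 (h j)) (vh : forall i j, om t0 (v i) (h j) = (i == j)%:R).

(** Vectors of [P] dual to [v] provide both properties: adding them corrects the pairings, and
    pairing with them reads off the coefficients of [lc a v + l] because [P] is isotropic. Near [t0]
    they remain dual up to a matrix close to the identity, so one constant serves. *)
Lemma adjustable_near : exists2 C : R, 0 <= C & \forall t \near F,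
  [/\ adjustable (om t) (P t) C, bounded_away (P t) C & om_bound (om t) C].
Proof.
have [W1 W10 hW1] := family_bound v; have [W2 W20 hW2] := family_bound h.
have [B B0 hB] := bound_near FF om_cvg om0.
pose N : R := n%:R + 1.
have N1 : 1 <= N by rewrite lerDr.
pose eta : R := (2 * N)^-1.
have eta0 : 0 < eta by rewrite invr_gt0 mulr_gt0 // (lt_le_trans ltr01).
have etan : n%:R * eta <= 2^-1.
  rewrite /eta invfM mulrCA ler_piMr ?invr_ge0 // ler_pdivrMr ?mul1r ?lerDl //.
  exact: lt_le_trans ltr01 N1.
have etan1 : n%:R * eta < 1 by apply: le_lt_trans etan _; rewrite invf_lt1 // ltr1n.
have [e' e'0 he'] := form_close FF om_cvg om0 (W1 + W2) eta0.
pose e := Num.min e' 1.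
have e0 : 0 < e by rewrite lt_min e'0 ltr01.
have ee' : e <= e' by rewrite ge_min lexx.
have e1 : e <= 1 by rewrite ge_min lexx orbT.
pose H := W2 + 1.
pose C1 := 2 * H; pose C2 := 2 * (n%:R * (B * H)).
have H0 : 0 <= H by rewrite addr_ge0.
have C10 : 0 <= C1 by rewrite mulr_ge0.
have C20 : 0 <= C2 by rewrite !mulr_ge0.
exists (C1 + C2 + B); first by rewrite !addr_ge0.
have near_h : \forall t \near F, forall j : 'I_n, exists2 y, P t y & rnorm (h j - y) <= e.
  by apply: filter_forall => j; exact: lsc_point lP (Ph j) e0.
apply: filter_app hB; apply: filterS3 P_lag near_h he' => t lagt ht het Bt.
have sPt := lag_sub lagt.
have /choice[g hg] : forall j, exists y, P t y /\ rnorm (h j - y) <= e.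
  by move=> j; have [y] := ht j; exists y.
have gH j : rnorm (g j) <= H by have [_ hj] := hg j; exact: close_le (hW2 j) hj e1 (lexx _).
pose Th := \matrix_(i, j) om t (v i) (g j).
have Th1 i j : rnorm (Th i j - (i == j)%:R) <= eta.
  rewrite mxE -vh; apply: het.
  - by apply: le_trans (hW1 i) _; rewrite lerDl.
  - by apply: le_trans (hW2 j) _; rewrite lerDr.
  - by rewrite subrr rnorm0 ltW.
  - by have [_ hj] := hg j; exact: le_trans ee'.
have two (c : 'rV[R[i]]_n) (M : 'M[R[i]]_n) :
    (forall i j, rnorm (M i j - (i == j)%:R) <= eta) -> l1 c <= 2 * l1 (c *m M).
  by move=> hM; exact: two_le (l1_ge0 _) etan (near_id c hM).
split.
- move=> l tau Pl; pose ev := \row_i (tau i - om t (v i) l).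
  have ThT i j : rnorm (Th^T i j - (i == j)%:R) <= eta by rewrite mxE eq_sym.
  have uT : Th^T \in unitmx.
    rewrite -row_free_unit; apply: row_free_kernel => c; exact: near_id_inj ThT etan1.
  pose c := map_mx Num.conj (ev *m invmx Th^T).
  have cTh : map_mx Num.conj c *m Th^T = ev.
    have -> : map_mx Num.conj c = ev *m invmx Th^T.
      by apply/matrixP => i j; rewrite [LHS]mxE [X in X^*]mxE conjCK.
    by rewrite -mulmxA mulVmx // mulmx1.
  have l1c : l1 c = l1 (map_mx Num.conj c).
    by apply: eq_bigr => i _; rewrite [in RHS]mxE rnorm_conj.
  exists (l + lc c g); split.
  + by apply: subD => //; apply: sub_lc => // j; case: (hg j).
  + move=> i; rewrite linearDr /= om_lcr; move/rowP: cTh => /(_ i).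
    rewrite [RHS]mxE => E; have -> : \sum_j (c 0 j)^* * om t (v i) (g j) = tau i - om t (v i) l.
      by rewrite -E mxE; apply: eq_bigr => j _; rewrite [in RHS]mxE [Th^T j i]mxE [Th i j]mxE.
    by rewrite addrC subrK.
  + rewrite opprD addrA subrr add0r rnormN.
    apply: le_trans (rnorm_lc _ gH) _.
    have S0 : 0 <= \sum_i rnorm (tau i - om t (v i) l) by apply: sumr_ge0 => i _; exact: rnorm_ge0.
    apply: (@le_trans _ _ (C1 * \sum_i rnorm (tau i - om t (v i) l))); last first.
      by rewrite ler_wpM2r // -addrA lerDl addr_ge0.
    rewrite /C1 mulrAC ler_wpM2r // l1c; apply: le_trans (two _ _ ThT) _.
    by rewrite cTh ler_pM2l //; apply: ler_sum => i _; rewrite mxE.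
- move=> a l Pl; apply: le_trans (two a Th Th1) _.
  apply: (@le_trans _ _ (C2 * rnorm (lc a v + l))); last first.
    by rewrite ler_wpM2r ?rnorm_ge0 // addrAC lerDr addr_ge0.
  rewrite /C2 -mulrA ler_pM2l //.
  apply: (@le_trans _ _ (\sum_(j < n) (B * H * rnorm (lc a v + l)))); last first.
    by rewrite sumr_const card_ord -[X in X <= _]mulr_natl mulrA.
  apply: ler_sum => j _; have [Pg _] := hg j.
  have -> : (a *m Th) 0 j = om t (lc a v + l) (g j).
    rewrite linearDl /= (lag_om lagt Pl Pg) addr0 om_lcl mxE.
    by apply: eq_bigr => i _; rewrite mxE.
  apply: le_trans (Bt.2 _ _) _; rewrite mulrAC ler_wpM2r ?rnorm_ge0 //.
  by rewrite ler_wpM2l // Bt.1.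
- have [_ hBt] := Bt; split; first by rewrite !addr_ge0.
  move=> x y; apply: le_trans (hBt x y) _.
  by rewrite -!mulrA ler_wpM2r ?mulr_ge0 ?rnorm_ge0 // lerDr addr_ge0.
Qed.

End FromDual.

Section Pair.
Variables (om om' : {hermitian Z for true & @Num.conj R[i]}) (lam lam' : set Z) (C e : R).
Hypotheses (C0 : 0 <= C) (e0 : 0 <= e).
Hypotheses (adj : adjustable om' lam' C) (sep : bounded_away lam C) (bd' : om_bound om' C).
Hypothesis close : near_sub e lam lam'.
Hypothesis om_close : forall x y, rnorm (om' x y - om x y) <= e * rnorm x * rnorm y.

(* When U is the span of v this is, modulo the annihilator of the span in lam, a
   Lagrangian complement of lam in its sum with the span (the term 2 l makes the set
   isotropic).  When U is null it is this annihilator. *)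
Definition twisted om (lam U : set Z) : set Z :=
  [set x | exists w l, [/\ U w, lam l, x = w + l & forall i, om (v i) (w + (l + l)) = 0]].

Let Bv : R := \sum_i rnorm (v i).
Let vB i : rnorm (v i) <= Bv.
Proof. by rewrite /Bv (bigD1 i) //= lerDl; apply: sumr_ge0 => j _; exact: rnorm_ge0. Qed.
Let Bv0 : 0 <= Bv. Proof. by apply: sumr_ge0 => j _; exact: rnorm_ge0. Qed.

Lemma separated_norm w l : fspan v w -> lam l ->
  rnorm w <= C * Bv * rnorm (w + l) /\ rnorm l <= (1 + C * Bv) * rnorm (w + l).
Proof.
move=> [a ->] ll; have h : rnorm (lc a v) <= C * Bv * rnorm (lc a v + l).
  apply: le_trans (rnorm_lc _ vB) _; rewrite mulrAC ler_wpM2r //; exact: sep.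
split => //; rewrite -[l in rnorm l](addrK (lc a v)) [l + _]addrC.
apply: le_trans (rnormB _ _) _; rewrite mulrDl mul1r; exact: lerD.
Qed.

Lemma sum_close : near_sub ((1 + C * Bv) * e) (sumset (fspan v) lam) (sumset (fspan v) lam').
Proof.
move=> _ [w Vw [l ll <-]]; have [l' ll' h] := close ll.
have [_ h2] := separated_norm Vw ll.
exists (w + l'); first by exists w => //; exists l'.
rewrite opprD addrACA subrr add0r; apply: le_trans h _.
by rewrite [(1 + _) * e]mulrC -mulrA; exact: ler_wpM2l.
Qed.

(** The first summand bounds the passage from [lam] to [lam'], the second the correction of the [n]
    pairings estimated in [twist_estimate]. *)
Definition twist_const : R :=
  (1 + C * Bv) + C * (n%:R * (Bv * (C * Bv + (1 + C) * (1 + C * Bv)))).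

Lemma twist_const_ge0 : 0 <= twist_const.
Proof. by rewrite !(addr_ge0, mulr_ge0). Qed.

Lemma twisted_close (U : set Z) : U `<=` fspan v ->
  near_sub (twist_const * e) (twisted om lam U) (twisted om' lam' U).
Proof.
move=> UV _ [w [l [Uw ll -> hw]]]; have [l0 l0' h] := close ll.
have [h1 h2] := separated_norm (UV _ Uw) ll.
set x := rnorm (w + l) in h1 h2 *.
pose tau i := - (2^-1 * om' (v i) w).
have [l2 [l2' hl2 h3]] := adj tau l0'.
exists (w + l2).
  exists w, l2; split => // i; rewrite linearDr /= linearDr /= hl2 /tau.
  by rewrite -opprD -mulrDl -[2^-1]mul1r -splitr mul1r subrr.
rewrite opprD addrACA subrr add0r.
have h4 i : rnorm (tau i - om' (v i) l0) <= e * (Bv * (C * Bv + (1 + C) * (1 + C * Bv))) * x.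
  have El : om (v i) l = - (2^-1 * om (v i) w).
    have := hw i; rewrite linearDr /= linearDr /= => /eqP; rewrite addrC addr_eq0 => /eqP E.
    by rewrite -mulrN -E mulrDr -mulrDl -[2^-1]mul1r -splitr mul1r.
  have -> : tau i - om' (v i) l0 = - (2^-1 * (om' (v i) w - om (v i) w)) -
     ((om' (v i) l - om (v i) l) - om' (v i) (l - l0)).
    by rewrite linearBr /= El /tau; ring.
  have b1 := om_close (v i) w; have b2 := om_close (v i) l.
  have b3 : rnorm (om' (v i) (l - l0)) <= C * rnorm (v i) * (e * rnorm l).
    apply: le_trans (bd'.2 _ _) _; apply: ler_wpM2l => //.
    by rewrite mulr_ge0 ?rnorm_ge0.
  apply: le_trans (rnormB _ _) _; rewrite rnormN rnormM rnorm_half.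
  apply: le_trans (lerD (lexx _) (rnormB _ _)) _.
  exact: twist_estimate (vB i) (rnorm_ge0 _) C0 e0 (rnorm_ge0 _) (rnorm_ge0 _) h1 h2 b1 b2 b3.
have h5 : \sum_i rnorm (tau i - om' (v i) l0) <=
    n%:R * (e * (Bv * (C * Bv + (1 + C) * (1 + C * Bv))) * x).
  apply: (@le_trans _ _ (\sum_(i < n) (e * (Bv * (C * Bv + (1 + C) * (1 + C * Bv))) * x))).
    by apply: ler_sum => i _; exact: h4.
  by rewrite sumr_const card_ord mulr_natl.
have h6 : rnorm (l0 - l2) <= C * (n%:R * (e * (Bv * (C * Bv + (1 + C) * (1 + C * Bv))) * x)).
  by apply: le_trans h3 _; exact: ler_wpM2l.
apply: le_trans (rnorm_tri l0 _ _) _; apply: le_trans (lerD h h6) _.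
have -> : twist_const * e * x = e * ((1 + C * Bv) * x) +
   C * (n%:R * (e * (Bv * (C * Bv + (1 + C) * (1 + C * Bv))) * x)) by rewrite /twist_const; ring.
by rewrite lerD2r ler_wpM2l.
Qed.

End Pair.
End Transfer.

(** * A Lagrangian complement of the reductions *)

Section Twist.
Variables (R : realType) (Z : completeNormedModType R[i]).
Variables (om : {hermitian Z for true & @Num.conj R[i]}) (lam : set Z) (n : nat) (v : 'I_n -> Z).
Hypothesis lam_lag : lagrangian om lam.

Let V := fspan v.
Let L := twisted v om lam V.
Let slam := lag_sub lam_lag.
Let sV : lin_sub V := lin_sub_fspan v.

Lemma double_eq0 (a : R[i]) : a + a = 0 -> a = 0.
Proof. by move/eqP; rewrite -mulr2n mulrn_eq0 => /eqP. Qed.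

Lemma double_cancel (a b c : R[i]) : a = c + c -> a + b - c = 0 -> a + (b + b) = 0.
Proof.
move=> -> h; have -> : c + c + (b + b) = (c + c + b - c) + (c + c + b - c) by ring.
by rewrite h addr0.
Qed.

Lemma half_conj : Num.conj (2^-1 : R[i]) = 2^-1.
Proof. by rewrite fmorphV rmorph_nat. Qed.

Lemma om_fspan x w : (forall i, om (v i) x = 0) -> V w -> om w x = 0.
Proof. by move=> h [a ->]; rewrite om_lcl big1 // => i _; rewrite h mulr0. Qed.

Lemma twisted_null : twisted v om lam [set 0] = annihilator om V `&` lam.
Proof.
apply/seteqP; split => [_ [w [l [-> ll -> h]]]|x [hx lx]].
  rewrite add0r; split => // y Vy; apply: om_sym0; apply: om_fspan Vy => i.
  by apply: double_eq0; rewrite -linearDr /=; have := h i; rewrite add0r.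
exists 0, x; rewrite add0r; split => // i; rewrite add0r linearDr /=.
by rewrite (om_sym0 (hx _ (fspan_in v i))) addr0.
Qed.

Lemma twisted_ann : annihilator om V `&` lam `<=` L.
Proof.
move=> x [hx lx]; exists 0, x; rewrite add0r; split => //; first exact: sub0.
by move=> i; rewrite add0r linearDr /= (om_sym0 (hx _ (fspan_in v i))) addr0.
Qed.

Lemma twisted_sum : L `<=` sumset V lam.
Proof. by move=> _ [w [l [Vw ll -> _]]]; exists w => //; exists l. Qed.

Lemma twisted_lam : V `&` lam = [set 0] -> L `&` lam = annihilator om V `&` lam.
Proof.
move=> E; apply/seteqP; split => [x [[w [l [Vw ll xE h]]] lx]|x hx].
  have w0 : w = 0.
    have : (V `&` lam) w by split => //; rewrite -[w](addrK l) -xE; exact: subB.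
    by rewrite E.
  rewrite -twisted_null; exists 0, l; split => //; first by rewrite xE w0.
  by move=> i; rewrite -{1}w0.
by split; [exact: twisted_ann|case: hx].
Qed.

Lemma half_swap w l w' : V w -> (forall i, om (v i) (w' + (l + l)) = 0) ->
  om w l = - (2^-1 * om w w').
Proof.
move=> Vw h; have := om_fspan h Vw.
rewrite !linearDr /= => /eqP; rewrite addrC addr_eq0 => /eqP E.
by rewrite -mulrN -E mulrDr -mulrDl -[2^-1]mul1r -splitr mul1r.
Qed.

(** The constraints give [om w l'] and [om l w'] the common value [- om w w' / 2], and
    [om l l' = 0], so the sum vanishes. *)
Lemma twisted_iso x y : L x -> L y -> om x y = 0.
Proof.
move=> [w [l [Vw ll -> h]]] [w' [l' [Vw' ll' -> h']]].
rewrite linearDr /= !linearDl /= (lag_om lam_lag ll ll') addr0 (half_swap Vw h').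
rewrite [om l w']om_skew (half_swap Vw' h) rmorphN rmorphM /= half_conj opprK.
have -> : Num.conj (om w' w) = - om w w' by rewrite [in RHS]om_skew opprK.
by rewrite mulrN -addrA -opprD -mulrDl -[2^-1]mul1r -splitr mul1r subrr.
Qed.

(** By [adjustable], each [v i] has a companion [m] in [lam] such that [v i + m] lies in [L];
    orthogonality of [w + l] to these vectors amounts to the constraints that define [L]. *)
Lemma twisted_lag C : adjustable v om lam C -> L = sumset V lam `&` annihilator om L.
Proof.
move=> adj; apply/seteqP; split => [x Lx|_ [[w Vw [l ll <-]] hx]].
  by split; [exact: twisted_sum|move=> y; exact: twisted_iso].
exists w, l; split => // i; apply: om_sym0.
have [m [lm hm _]] := adj 0 (fun j => - (2^-1 * om (v j) (v i))) (sub0 slam).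
have hj j : om (v j) (v i + (m + m)) = 0.
  by rewrite !linearDr /= hm -opprD -mulrDl -[2^-1]mul1r -splitr mul1r subrr.
have Ly : L (v i + m) by exists (v i), m; split => //; exact: fspan_in.
have := hx _ Ly; rewrite linearDr /= !linearDl /= (lag_om lam_lag ll lm) addr0 (half_swap Vw hj).
move=> E; apply: (double_cancel _ E).
by rewrite -mulrDl -[2^-1]mul1r -splitr mul1r.
Qed.

End Twist.

Section Transverse.
Variables (R : realType) (Z : completeNormedModType R[i]).
Variables (om : {hermitian Z for true & @Num.conj R[i]}) (lam mu : set Z) (n : nat) (v : 'I_n -> Z).
Hypothesis lam_lag : lagrangian om lam.

Let V := fspan v.
Let L := twisted v om lam V.

Lemma twisted_reduction : lin_sub mu -> lin_sub L -> L `&` mu = [set 0] ->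
  L `&` reduction (sumset V lam) (annihilator om V `&` lam) mu = annihilator om V `&` lam.
Proof.
move=> smu sL E; have slam := lag_sub lam_lag; apply/seteqP; split.
  move=> x [Lx [m [mm Wm] [n' N' xE]]].
  have : (L `&` mu) m.
    by split => //; rewrite -[m](addrK n') xE; apply: (subB sL) => //; exact: twisted_ann.
  by rewrite E => m0; rewrite -xE m0 add0r.
move=> x Nx; split; first exact: twisted_ann.
exists 0; last by exists x => //; rewrite add0r.
have sW : lin_sub (sumset V lam) by apply: lin_sub_sumset => //; exact: lin_sub_fspan.
by split; exact: sub0.
Qed.

(** The component [w] lies in both [V] and [lam + mu], so it vanishes; then [l] annihilates [V],
    [lam] and [mu], that is, all of [Z]. This serves at the time where [V] complements [lam + mu];
    [transversal_near] extends it to nearby times. *)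
Lemma twisted_mu : (forall x, (forall y, om x y = 0) -> x = 0) -> lagrangian om mu ->
  direct_sum V (sumset lam mu) -> L `&` mu `<=` [set 0].
Proof.
move=> nd mu_lag [VI VS] _ [[w [l [Vw ll -> h]]] mx].
have sS := lin_sub_sumset (lag_sub lam_lag) (lag_sub mu_lag).
have w0 : w = 0.
  have : (V `&` sumset lam mu) w.
    split => //; exists (- l); first exact: (subN (lag_sub lam_lag)).
    by exists (w + l) => //; rewrite addrC addrK.
  by rewrite VI.
move: mx h; rewrite w0 add0r => ml h.
have hV y : V y -> om l y = 0.
  move=> Vy; apply: om_sym0; apply: om_fspan Vy => i; apply: double_eq0.
  by rewrite -linearDr /=; have := h i; rewrite add0r.
apply: nd => z; have : [set: Z] z by []; rewrite -VS => -[y Vy [_ [a la [b mb <-]] <-]].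
by rewrite !linearDr /= hV // (lag_om lam_lag ll la) (lag_om mu_lag ml mb) !addr0.
Qed.

End Transverse.

(** * Quantitative comparison of the reductions at two times *)

Section Close.
Variables (R : realType) (Z : completeNormedModType R[i]).
Implicit Types (om : {hermitian Z for true & @Num.conj R[i]}) (lam mu M : set Z).

Lemma near_sub_le (e e' : R) M M' : e <= e' -> near_sub e M M' -> near_sub e' M M'.
Proof.
move=> ee h x /h[y My hy]; exists y => //; apply: le_trans hy _.
by rewrite ler_wpM2r ?rnorm_ge0.
Qed.

Variables (n : nat) (v : 'I_n -> Z).

Definition decomposable om lam mu (C : R) : Prop := forall z, exists w l m,
  [/\ fspan v w, (annihilator om (fspan v) `&` lam) l, mu m & z = w + l + m] /\
  [/\ rnorm w <= C * rnorm z, rnorm l <= C * rnorm z & rnorm m <= C * rnorm z].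

(** One constant [C] will hold at all times near [t0], so each estimate applies in both directions
    and gives both halves of gap convergence. *)
Definition regular om lam mu (C : R) : Prop :=
  [/\ adjustable v om lam C, bounded_away v lam C, om_bound om C & decomposable om lam mu C].

Variables (om om' : {hermitian Z for true & @Num.conj R[i]}) (lam lam' mu mu' : set Z) (C e : R).
Hypotheses (C0 : 0 <= C) (e0 : 0 <= e).
Hypotheses (lag : lagrangian om lam) (lag' : lagrangian om' lam') (smu : lin_sub mu) (smu' : lin_sub mu').
Hypotheses (reg : regular om lam mu C) (reg' : regular om' lam' mu' C).
Hypotheses (lam_close : near_sub e lam lam') (mu_close : near_sub e mu mu').
Hypothesis om_close : forall x y, rnorm (om' x y - om x y) <= e * rnorm x * rnorm y.

Let V := fspan v.
Let W := sumset V lam.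
Let W' := sumset V lam'.
Let N := annihilator om V `&` lam.
Let N' := annihilator om' V `&` lam'.
Let sV : lin_sub V := lin_sub_fspan v.
Let sW' : lin_sub W'. Proof. by apply: lin_sub_sumset => //; exact: lag_sub lag'. Qed.

Definition sum_const : R := 1 + C * \sum_i rnorm (v i).

Lemma sum_const_ge0 : 0 <= sum_const.
Proof. by rewrite addr_ge0 // mulr_ge0 // sumr_ge0 // => i _; exact: rnorm_ge0. Qed.

Lemma coisotropic_close : near_sub (sum_const * e) W W'.
Proof. by have [_ sep _ _] := reg; exact: sum_close. Qed.

Lemma complement_close : near_sub (twist_const v C * e) (twisted v om lam V) (twisted v om' lam' V).
Proof. by have [_ sep _ _] := reg; have [adj' _ bd' _] := reg'; exact: twisted_close. Qed.

Lemma isotropic_close : near_sub (twist_const v C * e) N N'.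
Proof.
have [_ sep _ _] := reg; have [adj' _ bd' _] := reg'.
rewrite /N /N' -!twisted_null.
by apply: twisted_close => // _ ->; exact: sub0.
Qed.

Definition cap_const : R := 1 + C * (1 + sum_const).

(** [x] is approximated by [y1] in [mu'] and by [y2] in [W']; splitting [y1 - y2] along
    [V + N' + mu'] brings the two to a common point. *)
Lemma cap_close : near_sub (cap_const * e) (mu `&` W) (mu' `&` W').
Proof.
have [_ _ _ dec'] := reg'; move=> x [mx Wx].
have [y1 m1 h1] := mu_close mx; have [y2 W2 h2] := coisotropic_close Wx.
have [w [l [m [[Vw [_ ll] mm E] [_ _ hm]]]]] := dec' (y1 - y2).
exists (y1 - m).
  split; first exact: subB.
  have -> : y1 - m = y2 + (w + l) by rewrite -[w + l](addrK m) -E addrA [y2 + _]addrC subrK.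
  by apply: subD => //; exists w => //; exists l.
rewrite opprB addrA addrAC; apply: le_trans (rnormD _ _) _.
have h3 : rnorm (y1 - y2) <= (1 + sum_const) * e * rnorm x.
  apply: le_trans (rnorm_tri x _ _) _; have -> : (1 + sum_const) * e * rnorm x =
    e * rnorm x + sum_const * e * rnorm x by ring.
  by apply: lerD h2; rewrite -rnormN opprB.
apply: le_trans (lerD h1 (le_trans hm (ler_wpM2l C0 h3))) _.
by have -> : cap_const * e * rnorm x = e * rnorm x + C * ((1 + sum_const) * e * rnorm x)
  by rewrite /cap_const; ring.
Qed.

Hypothesis V0 : forall w l m, V w -> N l -> mu m ->
  (forall y, mu y -> W y -> om (w + l + m) y = 0) -> w = 0.
Hypothesis red_iso : forall x y, reduction W N mu x -> mu y -> W y -> om x y = 0.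

(** By [V0] and [red_iso] a vector of the reduction has no component in [V]. It is then a sum of
    vectors of [mu /\ W] and [N] of controlled norm, which are moved separately. *)
Lemma reduction_close :
  near_sub (C * (cap_const + twist_const v C) * e) (reduction W N mu) (reduction W' N' mu').
Proof.
have [_ _ _ dec] := reg; move=> x bx.
have [w [l [m [[Vw Nl mm E] [_ hl hm]]]]] := dec x.
have w0 : w = 0 by apply: (V0 Vw Nl mm) => y; rewrite -E; exact: red_iso.
have {}E : x = m + l by rewrite E w0 add0r addrC.
have Wm : W m.
  have sW : lin_sub W by apply: lin_sub_sumset => //; exact: lag_sub lag.
  have sN : N `<=` W by move=> y [_ ly]; apply: sumset_r.
  have [m1 [_ W1] [l1 N1 El]] := bx.
  by rewrite -[m](addrK l) -E -El; apply: subB => //; [apply: subD => //; exact: sN|exact: sN].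
have [m' mW' h1] := cap_close (conj mm Wm); have [l' N'l h2] := isotropic_close Nl.
exists (m' + l'); first by exists m' => //; exists l'.
rewrite {1}E opprD addrACA; apply: le_trans (rnormD _ _) _.
apply: le_trans (lerD h1 h2) _.
have c1 : 0 <= cap_const * e.
  by rewrite mulr_ge0 // addr_ge0 // mulr_ge0 // addr_ge0 // sum_const_ge0.
have c2 : 0 <= twist_const v C * e by rewrite mulr_ge0 // twist_const_ge0.
apply: le_trans (lerD (ler_wpM2l c1 hm) (ler_wpM2l c2 hl)) _.
by have -> : cap_const * e * (C * rnorm x) + twist_const v C * e * (C * rnorm x) =
  C * (cap_const + twist_const v C) * e * rnorm x by ring.
Qed.

End Close.

Lemma half_small (R : realType) (c x m a b : R) : 0 <= c -> 0 <= x ->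
  a <= (2 * (2 * c + 1))^-1 * x -> m <= c * b ->
  b <= (2 * (2 * c + 1))^-1 * x + (2 * (2 * c + 1))^-1 * x -> x <= a + m -> x = 0.
Proof.
move=> c0 x0 ha hm hb h; set e := (_)^-1 in ha hb.
have E : e * (2 * (2 * c + 1)) = 1 by rewrite mulVf // gt_eqF //; lra.
have h1 : c * b <= c * (e * x + e * x) by exact: ler_wpM2l.
have h2 : e * x + c * (e * x + e * x) = 2^-1 * x.
  have -> : e * x + c * (e * x + e * x) = 2^-1 * (e * (2 * (2 * c + 1))) * x by field.
  by rewrite E mulr1.
lra.
Qed.

(** * Stability near a given time *)

Section Perturbation.
Variables (R : realType) (Z : completeNormedModType R[i]).
Variables (T : Type) (F : set_system T) (FF : Filter F).

(** A common vector [x] is close, relative to its norm, to some [m] in [M1] and some [l] in [M2].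
    The first summand in the decomposition of [m - l] is [m], so [m] is small against [rnorm x],
    which forces [x = 0]. *)
Lemma transversal_near (P1 P2 : T -> set Z) M1 M2 : lin_sub M1 -> lin_sub M2 -> closed M1 -> closed M2 ->
  direct_sum M1 M2 -> usc F P1 M1 -> usc F P2 M2 -> \forall t \near F, P1 t `&` P2 t `<=` [set 0].
Proof.
move=> s1 s2 c1 c2 [I12 S12] u1 u2.
have s0 := @lin_sub0 _ Z; have cl0 : closed [set (0 : Z)].
  rewrite (_ : [set 0] = M1 `&` M2); [exact: closedI|by rewrite I12].
have [z|c c0 hc] := solvability4 FF (good_cst FF s1 c1) (good_cst FF s2 c2) (good_cst FF s0 cl0)
  (good_cst FF s0 cl0).
  have : [set: Z] z by []; rewrite -S12 => -[x1 M1x [x2 M2x <-]].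
  by exists x1, x2, 0, 0; rewrite !addr0.
pose e : R := (2 * (2 * c + 1))^-1.
have e0 : 0 < e by rewrite invr_gt0; lra.
apply: filterS3 hc (u1 _ e0) (u2 _ e0) => t ht h1 h2 x [P1x P2x].
have [m Mm hm] := h1 x P1x; have [l Ml hl] := h2 x P2x.
have [x1 [x2 [x3 [x4 [[M1x M2x x30 x40] [hx1 _ _ _] E]]]]] := ht (m - l).
have m1 : m = x1.
  apply/eqP; rewrite -subr_eq0; apply/eqP.
  have : (M1 `&` M2) (m - x1).
    split; first exact: subB.
    have -> : m - x1 = l + x2; last exact: subD.
    by rewrite -[m](subrK l) E x30 x40 !addr0 [x1 + x2]addrC addrAC addrK addrC.
  by rewrite I12.
rewrite -m1 in hx1; apply/rnorm_eq0/(half_small c0 (rnorm_ge0 x) hm hx1).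
  apply: le_trans (rnorm_tri x _ _) _; apply: lerD => //; by rewrite -rnormN opprB.
by rewrite -[x in leLHS](subrK m); exact: rnormD.
Qed.

Lemma scaled_near (K : R) (P P' : T -> set Z) : 0 <= K ->
  (forall e : R, 0 < e -> \forall t \near F, near_sub (K * e) (P t) (P' t)) ->
  forall e : R, 0 < e -> \forall t \near F, near_sub e (P t) (P' t).
Proof.
move=> K0 h e e0; have K1 : 0 < K + 1 by rewrite ltr_wpDl.
apply: filterS (h _ (divr_gt0 e0 K1)) => t; apply: near_sub_le.
by rewrite mulrA ler_pdivrMr // mulrC ler_pM2l // lerDl.
Qed.

Variables (t0 : T) (om : T -> {hermitian Z for true & @Num.conj R[i]}) (lam mu : T -> set Z).
Variables (n : nat) (v : 'I_n -> Z).
Hypothesis F0 : forall P : set T, (\forall t \near F, P t) -> P t0.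
Hypotheses (symp : \forall t \near F, symplectic (om t))
  (lam_lag : \forall t \near F, lagrangian (om t) (lam t))
  (mu_lag : \forall t \near F, lagrangian (om t) (mu t)).
Hypotheses (om_cvg : form_cvg F om t0) (llam : lsc F lam (lam t0)) (lmu : lsc F mu (mu t0))
  (ulam : usc F lam (lam t0)) (umu : usc F mu (mu t0)).
Hypothesis iv : indep_mod [set 0] v.

Let V := fspan v.
Let W t := sumset V (lam t).
Let N t := annihilator (om t) V `&` lam t.
Let L t := twisted v (om t) (lam t) V.
Let be t := reduction (W t) (N t) (mu t).
Let sV : lin_sub V := lin_sub_fspan v.

Lemma om_close e : 0 < e -> \forall t \near F,
  (forall x y, rnorm (om t x y - om t0 x y) <= e * rnorm x * rnorm y) /\
  (forall x y, rnorm (om t0 x y - om t x y) <= e * rnorm x * rnorm y).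
Proof.
move=> /om_cvg; apply: filterS => t h; split => // x y; rewrite -rnormN opprB; exact: h.
Qed.

Lemma bounded_away_cap P C : bounded_away v P C -> lin_sub P -> V `&` P = [set 0].
Proof.
move=> sep sP; apply/seteqP; split => [_ [[a ->] Pa]|_ ->]; last by split; exact: sub0.
have := sep a _ (subN sP Pa); rewrite subrr rnorm0 mulr0 => h.
rewrite (l1_eq0 h).
by rewrite lc0.
Qed.

Lemma adjustable_mono om' P (C C' : R) : C <= C' -> adjustable v om' P C -> adjustable v om' P C'.
Proof.
move=> CC h l tau /h-/(_ tau)[l' [Pl' hl' hb]]; exists l'; split => //; apply: le_trans hb _.
by rewrite ler_wpM2r // sumr_ge0 // => i _; exact: rnorm_ge0.
Qed.

Lemma bounded_away_mono P (C C' : R) : C <= C' -> bounded_away v P C -> bounded_away v P C'.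
Proof.
by move=> CC h a l Pl; apply: le_trans (h a l Pl) _; rewrite ler_wpM2r ?rnorm_ge0.
Qed.

Lemma om_bound_mono (om' : {hermitian Z for true & @Num.conj R[i]}) (C C' : R) : C <= C' ->
  om_bound om' C -> om_bound om' C'.
Proof.
move=> CC [C0 h]; split=> [|x y]; first exact: le_trans CC.
by apply: le_trans (h x y) _; rewrite !ler_wpM2r ?rnorm_ge0.
Qed.

(** As [V] meets [lam] trivially at [t0], [lam] contains vectors dual to [v]. They give the
    adjustments near [t0], hence the lower semicontinuity of [N], hence uniform decompositions along
    [V + N + mu]. *)
Lemma regular_near : V `&` lam t0 = [set 0] ->
  (forall z, exists w l m, [/\ V w, N t0 l, mu t0 m & z = w + l + m]) ->
  exists2 C : R, 0 <= C & \forall t \near F, regular v (om t) (lam t) (mu t) C.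
Proof.
move=> Vlam sol; have lag0 := F0 lam_lag; have mlag0 := F0 mu_lag; have symp0 := F0 symp.
have s0 := @lin_sub0 _ Z.
have [h lh vh] : exists2 h : 'I_n -> Z, forall j, lam t0 (h j) &
    forall i j, om t0 (v i) (h j) = (i == j)%:R.
  apply: (dual_family (D := V) sV s0 (lag_sub lag0)) => // [i|x Vx hx]; first exact: fspan_in.
  have : (V `&` lam t0) x by split => //; exact: lag_in lag0 hx.
  by rewrite Vlam.
have [C1 C10 h1] := adjustable_near FF om_cvg symp0.1 lam_lag llam lh vh.
have [adj0 sep0 bd0] := F0 h1.
have lN : lsc F N (N t0).
  apply: (scaled_near (twist_const_ge0 v C10)) => e e0.
  apply: filterS (filterI (filterI h1 lam_lag) (filterI (llam e0) (om_close e0))).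
  move=> t [[[adj sep bd] lagt] [lt [ot _]]]; rewrite /N -!twisted_null //.
  by apply: twisted_close => //; [exact: ltW|move=> _ ->; exact: sub0].
have gV : good_family F (fun=> V) V := good_cst FF sV (closed_fspan symp0 iv).
have gmu : good_family F mu (mu t0).
  have [? ?] := lag_good symp0 mlag0; split => //.
  by apply: filterS2 symp mu_lag => t st mt; exact: lag_good st mt.
have goodN t : symplectic (om t) -> lagrangian (om t) (lam t) -> lin_sub (N t) /\ closed (N t).
  move=> st lt; have [sl cl] := lag_good st lt; split.
    by apply: lin_subI => //; exact: lin_sub_ann.
  by apply: closedI => //; exact: closed_ann st.1.
have gN : good_family F N (N t0).
  have [? ?] := goodN _ symp0 lag0; split => //.
  by apply: filterS2 symp lam_lag => t; exact: goodN.
have cl0 : closed [set (0 : Z)].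
  by rewrite -Vlam; apply: closedI; [case: gV|case: (lag_good symp0 lag0)].
have [z|c c0 hc] := solvability4 FF gV gN gmu (good_cst FF s0 cl0).
  by have [w [l [m [? ? ? ->]]]] := sol z; exists w, l, m, 0; rewrite addr0.
exists (C1 + c); first exact: addr_ge0.
have C1c : C1 <= C1 + c by rewrite lerDl.
apply: filterS2 h1 hc => t [adj sep bd] dec; split.
- exact: adjustable_mono adj.
- exact: bounded_away_mono sep.
- exact: om_bound_mono bd.
- move=> z; have [w [l [m [x4 [[Vw Nl mm ->] [hw hl hm _] E]]]]] := dec z.
  rewrite addr0 in E; exists w, l, m; split => //.
  have cC : c * rnorm z <= (C1 + c) * rnorm z by rewrite ler_wpM2r ?rnorm_ge0 // lerDr.
  by split; apply: le_trans cC.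
Qed.

Section Regular.
Variable C : R.
Hypotheses (C0 : 0 <= C) (reg : \forall t \near F, regular v (om t) (lam t) (mu t) C).

Lemma complement_usc : usc F L (L t0).
Proof.
apply: (scaled_near (twist_const_ge0 v C0)) => e e0.
apply: filterS3 reg (ulam e0) (om_close e0) => t rt ut [_ ot].
exact: complement_close C0 (ltW e0) rt (F0 reg) ut ot.
Qed.

Lemma complement_lsc : lsc F L (L t0).
Proof.
apply: (scaled_near (twist_const_ge0 v C0)) => e e0.
apply: filterS3 reg (llam e0) (om_close e0) => t rt ut [ot _].
exact: complement_close C0 (ltW e0) (F0 reg) rt ut ot.
Qed.

Lemma coisotropic_semicontinuous : lsc F W (W t0) /\ usc F W (W t0).
Proof.
split; apply: (scaled_near (sum_const_ge0 v C0)) => e e0.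
  apply: filterS (llam e0) => t lt; exact: coisotropic_close (ltW e0) (F0 reg) lt.
apply: filterS2 reg (ulam e0) => t rt ut; exact: coisotropic_close (ltW e0) rt ut.
Qed.

Lemma isotropic_semicontinuous : lsc F N (N t0) /\ usc F N (N t0).
Proof.
have lag0 := F0 lam_lag.
split; apply: (scaled_near (twist_const_ge0 v C0)) => e e0.
  apply: filterS (filterI (filterI reg lam_lag) (filterI (llam e0) (om_close e0))).
  move=> t [[rt lt] [lct [ot _]]].
  exact: isotropic_close C0 (ltW e0) (F0 reg) rt lct ot.
apply: filterS (filterI (filterI reg lam_lag) (filterI (ulam e0) (om_close e0))).
move=> t [[rt lt] [lct [_ ot]]].
exact: isotropic_close C0 (ltW e0) rt (F0 reg) lct ot.
Qed.

(** What [reduction_close] requires of the time it starts from; for a reducing [V] the two clauses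
    are supplied by [VNmu_be] and [be_iso]. *)
Definition rigid t : Prop :=
  (forall w l m, V w -> N t l -> mu t m ->
    (forall y, mu t y -> W t y -> om t (w + l + m) y = 0) -> w = 0) /\
  (forall x y, be t x -> mu t y -> W t y -> om t x y = 0).

Hypothesis rig : \forall t \near F, rigid t.

Lemma reduction_semicontinuous : lsc F be (be t0) /\ usc F be (be t0).
Proof.
have lag0 := F0 lam_lag; have mlag0 := F0 mu_lag.
have [V0 iso0] := F0 rig.
have K0 : 0 <= C * (cap_const v C + twist_const v C).
  by rewrite mulr_ge0 // addr_ge0 ?twist_const_ge0 // addr_ge0 // mulr_ge0 // addr_ge0 // sum_const_ge0.
split; apply: (scaled_near K0) => e e0.
  apply: filterS (filterI (filterI reg (filterI lam_lag mu_lag))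
    (filterI (filterI (llam e0) (lmu e0)) (om_close e0))).
  move=> t [[rt [lt mt]] [[lct mct] [ot _]]].
  exact: reduction_close C0 (ltW e0) lag0 lt (lag_sub mt) (F0 reg) rt lct mct ot V0 iso0.
apply: filterS (filterI (filterI (filterI reg rig) (filterI lam_lag mu_lag))
  (filterI (filterI (ulam e0) (umu e0)) (om_close e0))).
move=> t [[[rt [V0t isot]] [lt mt]] [[lct mct] [_ ot]]].
exact: reduction_close C0 (ltW e0) lt lag0 (lag_sub mlag0) rt (F0 reg) lct mct ot V0t isot.
Qed.

End Regular.
End Perturbation.

(** * Existence of the Maslov index *)

#[local] Existing Instance at_time_filter.

Lemma at_time_self (R : realType) (a b s : R) (P : set R) : s \in `[a, b] ->
  (\forall t \near at_time a b s, P t) -> P s.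
Proof. by move=> sab /at_time_delta[e e0 h]; apply: h => //; rewrite subrr normr0. Qed.

Section Gluing.
Variables (R : realType) (Z : normedModType R[i]).
Variables (neg : bool) (om : R -> Z -> Z -> R[i]) (lam mu : R -> set Z).

Definition maslov_piece (V : set Z) (x y : R) (c : int) : Prop :=
  let W s := sumset V (lam s) in
  let N s := annihilator (om s) (W s) in
  [/\ submod_closed (mem V), findim V,
      exists2 tau, tau \in `[x, y] & direct_sum V (sumset (lam tau) (mu tau)),
      forall s, s \in `[x, y] -> reducing (om s) V (lam s) (mu s)
    & is_maslov_fd neg x y om W N
        (fun s => reduction (W s) (N s) (lam s)) (fun s => reduction (W s) (N s) (mu s)) c].

Lemma maslov_single V x y c : x < y -> maslov_piece V x y c -> is_maslov neg x y om lam mu c.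
Proof.
move=> xy h; exists 1%N, (fun i => if i is 0%N then x else y), (fun=> V), (fun=> c); split.
- by split => // -[|k].
- by case=> [|k].
- by rewrite big_ord1.
Qed.

Lemma maslov_concat x y z m1 m2 : is_maslov neg x y om lam mu m1 ->
  is_maslov neg y z om lam mu m2 -> is_maslov neg x z om lam mu (m1 + m2).
Proof.
move=> [n1 [t1 [V1 [c1 [[t10 t1n t1S] h1 ->]]]]] [n2 [t2 [V2 [c2 [[t20 t2n t2S] h2 ->]]]]].
pose glue (T : Type) (f g : nat -> T) i := if (i < n1)%N then f i else g (i - n1)%N.
have gl (T : Type) (f g : nat -> T) i : (i < n1)%N -> glue T f g i = f i by rewrite /glue => ->.
have gr (T : Type) (f g : nat -> T) i : (n1 <= i)%N -> glue T f g i = g (i - n1)%N.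
  by rewrite /glue ltnNge => ->.
(* Valid at [i = n1] too, where the end of the first partition is the start of the second. *)
have tl i : (i <= n1)%N -> glue _ t1 t2 i = t1 i.
  rewrite leq_eqVlt => /predU1P[->|]; last exact: gl.
  by rewrite gr // subnn t20 t1n.
pose t := glue _ t1 t2; pose V := glue _ V1 V2; pose c := glue _ c1 c2.
have pieces k : (k < n1 + n2)%N -> t k < t k.+1 /\ maslov_piece (V k) (t k) (t k.+1) (c k).
  have [kn _|nk kn] := ltnP k n1.
    rewrite /t tl ?(ltnW kn) // (tl k.+1) // /V /c !gl //.
    by split; [exact: t1S|exact: h1].
  have k2 : (k - n1 < n2)%N by rewrite ltn_subLR.
  rewrite /t /V /c !gr //; last exact: leqW.
  by rewrite subSn //; split; [exact: t2S|exact: h2].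
exists (n1 + n2)%N, t, V, c; split.
- split.
  + by rewrite /t tl.
  + by rewrite /t gr ?leq_addr // addKn.
  + by move=> k /pieces[].
- by move=> k /pieces[].
- rewrite big_split_ord /=; congr (_ + _); apply: eq_bigr => i _ /=.
    by rewrite /c gl.
  by rewrite /c gr ?leq_addr // addKn.
Qed.

End Gluing.

Section LocalReduction.
Variables (R : realType) (Z : completeNormedModType R[i]).
Variables (T : Type) (F : set_system T) (FF : Filter F) (t0 : T).
Variables (om : T -> {hermitian Z for true & @Num.conj R[i]}) (lam mu : T -> set Z).
Hypothesis F0 : forall P : set T, (\forall t \near F, P t) -> P t0.
Hypotheses (symp : \forall t \near F, symplectic (om t))
  (lam_lag : \forall t \near F, lagrangian (om t) (lam t))
  (mu_lag : \forall t \near F, lagrangian (om t) (mu t)).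
Hypotheses (om_cvg : form_cvg F om t0) (llam : lsc F lam (lam t0)) (lmu : lsc F mu (mu t0))
  (ulam : usc F lam (lam t0)) (umu : usc F mu (mu t0)).
Variables (n : nat) (v : 'I_n -> Z).
Hypotheses (hd : has_dim_mod (lam t0 `&` mu t0) [set 0] n)
  (hd' : has_dim_mod [set: Z] (sumset (lam t0) (mu t0)) n)
  (sv : spans_mod [set: Z] (sumset (lam t0) (mu t0)) v)
  (iv : indep_mod (sumset (lam t0) (mu t0)) v).

Let V := fspan v.

Lemma span_direct : direct_sum V (sumset (lam t0) (mu t0)).
Proof.
have sS := lin_sub_sumset (lag_sub (F0 lam_lag)) (lag_sub (F0 mu_lag)).
split; apply/seteqP; split => [x|x] //.
- by move=> [[c ->] /iv->]; rewrite lc0.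
- by move=> ->; split; apply: sub0 => //; exact: lin_sub_fspan.
- move=> _; have [c hc] := sv.2 x I.
  by exists (lc c v); [exists c|exists (x - lc c v) => //; rewrite addrC subrK].
Qed.

(** The vectors dual to [v], taken in [lam /\ mu], keep [V] away from both [lam] and [mu] near [t0].
    At [t0] the complement [L] and [mu] are closed with direct sum [Z], and both are upper
    semicontinuous, so they stay transversal. *)
Lemma reducing_near : \forall t \near F, reducing (om t) V (lam t) (mu t) /\
  twisted v (om t) (lam t) V `&` mu t `<=` [set 0].
Proof.
have lag0 := F0 lam_lag; have mlag0 := F0 mu_lag; have symp0 := F0 symp.
have slam := lag_sub lag0; have smu := lag_sub mlag0; have s0 := @lin_sub0 _ Z.
have sS := lin_sub_sumset slam smu.
have iv0 : indep_mod [set 0] v by move=> c h; apply: iv; rewrite h; exact: sub0.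
have sV : lin_sub V := lin_sub_fspan v.
have dir := span_direct.
have [h Kh vh] := dual_in_intersection (d := fun=> n) lag0 mlag0 symp0 hd hd' iv.
have lh j : lam t0 (h j) by case: (Kh j).
have mh j : mu t0 (h j) by case: (Kh j).
have [C1 C10 h1] := adjustable_near FF om_cvg symp0.1 mu_lag lmu mh vh.
have Vlam : V `&` lam t0 = [set 0].
  apply/seteqP; split => [x [Vx lx]|x ->]; last by split; exact: sub0.
  by rewrite -dir.1; split => //; exact: sumset_l.
have sol z : exists w l m, [/\ V w, (annihilator (om t0) V `&` lam t0) l, mu t0 m & z = w + l + m].
  have : [set: Z] z by []; rewrite -dir.2 => -[w Vw [_ [l ll [m mm <-]] <-]].
  (* [k] in [lam /\ mu] has the same pairings with [v] as [l]: subtracting it puts [l] into [N], and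
     adding it keeps [m] in [mu]. *)
  pose k := lc (\row_i Num.conj (om t0 (v i) l)) h.
  have lk : lam t0 k by exact: sub_lc.
  have mk : mu t0 k by exact: sub_lc.
  exists w, (l - k), (m + k); split => //.
  - split; last exact: subB.
    move=> y Vy; apply: om_sym0; apply: om_fspan Vy => i.
    rewrite linearBr /= om_lcr (bigD1 i) //= vh eqxx mulr1 mxE conjCK big1 ?addr0 ?subrr //.
    by move=> j ji; rewrite vh eq_sym (negbTE ji) mulr0.
  - exact: subD.
  - by rewrite -[in RHS]addrA [l - k + _]addrACA [- k + k]addrC subrr addr0.
have [C C0 reg] := regular_near FF F0 symp lam_lag mu_lag om_cvg llam lmu iv0 Vlam sol.
have redt : \forall t \near F, reducing (om t) V (lam t) (mu t).
  apply: filterS (filterI (filterI reg h1) (filterI lam_lag mu_lag)) => t [[[_ sep _ dec] [_ sepm _]] [lt mt]].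
  split.
  - exact: bounded_away_cap sep (lag_sub lt).
  - exact: bounded_away_cap sepm (lag_sub mt).
  - apply/seteqP; split => // z _; have [w [l [m [[Vw Nl mm ->] _]]]] := dec z.
    by exists (w + l); [exists w => //; exists l|exists m].
have red0 := F0 redt; have [adj0 _ _ _] := F0 reg.
have sL : lin_sub (twisted v (om t0) (lam t0) V).
  rewrite (twisted_lag lag0 adj0); apply: lin_subI; last exact: lin_sub_ann.
  exact: lin_sub_sumset.
have cL : closed (twisted v (om t0) (lam t0) V).
  rewrite (twisted_lag lag0 adj0); apply: closedI; last exact: closed_ann symp0.1.
  rewrite -(ann_N symp0.2 lag0 mlag0 hd hd' sV (fspan_dim iv0) red0); exact: closed_ann symp0.1.
have Lmu : twisted v (om t0) (lam t0) V `&` mu t0 = [set 0].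
  apply/seteqP; split => [|x ->]; last by split; exact: sub0.
  exact: twisted_mu symp0.2 mlag0 dir.
have dirL : direct_sum (twisted v (om t0) (lam t0) V) (mu t0).
  have [_ E] : direct_sum (mu t0) (twisted v (om t0) (lam t0) V).
    apply: (complement_direct symp0.2 lag0 mlag0 hd hd' sV (fspan_dim iv0) red0).
    - by rewrite (N_def lag0 sV); exact: twisted_ann.
    - exact: twisted_sum.
    - exact: twisted_lag adj0.
    - by rewrite (N_def lag0 sV); exact: twisted_reduction.
  split => //; rewrite -E; apply/seteqP.
  by split => _ [x hx [y hy <-]]; exists y => //; exists x => //; rewrite addrC.
have cmu : closed (mu t0) by case: (lag_good symp0 mlag0).
have uL := complement_usc FF F0 om_cvg ulam C0 reg.
apply: filterS2 redt (transversal_near FF sL smu cL cmu dirL uL umu) => t; by split.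
Qed.

End LocalReduction.

Section Existence.
Variables (R : realType) (Z : completeNormedModType R[i]).
Variable om : R -> {hermitian Z for true & @Num.conj R[i]}.
Variables (lam mu : R -> set Z) (d : R -> nat) (neg : bool).
Hypotheses (symp : forall s, s \in `[0, 1] -> symplectic (om s))
  (lam_lag : forall s, s \in `[0, 1] -> lagrangian (om s) (lam s))
  (mu_lag : forall s, s \in `[0, 1] -> lagrangian (om s) (mu s))
  (hd : forall s, s \in `[0, 1] -> has_dim_mod (lam s `&` mu s) [set 0] (d s))
  (hd' : forall s, s \in `[0, 1] -> has_dim_mod [set: Z] (sumset (lam s) (mu s)) (d s)).
Hypotheses (om_path : form_path 0 1 om)
  (lam_path : subspace_path 0 1 lam) (mu_path : subspace_path 0 1 mu).

Section Piece.
Variables (a b : R) (n : nat) (v : 'I_n -> Z).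
Hypotheses (ab : a < b) (a0 : 0 <= a) (b1 : b <= 1) (iv : indep_mod [set 0] v).

Let V := fspan v.
Let W s := sumset V (lam s).
Let N s := annihilator (om s) (W s).
Let L s := twisted v (om s) (lam s) V.
Let be s := reduction (W s) (N s) (mu s).

Hypotheses (red : forall s, s \in `[a, b] -> reducing (om s) V (lam s) (mu s))
  (Lmu : forall s, s \in `[a, b] -> L s `&` mu s `<=` [set 0]).

Let sub01 s : s \in `[a, b] -> s \in `[0, 1].
Proof. by apply: subset_itvScc; rewrite bnd_simp. Qed.

Let sV : lin_sub V := lin_sub_fspan v.
Let hV : has_dim_mod V [set 0] n := fspan_dim iv.

Let inside (P : set R) s : s \in `[a, b] -> (forall t, t \in `[a, b] -> P t) ->
  \forall t \near at_time a b s, P t.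
Proof. by move=> sab h; apply: filterS (at_time_in a b s) => t; exact: h. Qed.

Lemma regular_at s : s \in `[a, b] ->
  exists2 C : R, 0 <= C & \forall t \near at_time a b s, regular v (om t) (lam t) (mu t) C.
Proof.
move=> sab; have s01 := sub01 sab; apply: regular_near => //.
- by move=> P; exact: at_time_self.
- by apply: inside => // t /sub01; exact: symp.
- by apply: inside => // t /sub01; exact: lam_lag.
- by apply: inside => // t /sub01; exact: mu_lag.
- apply: form_path_cvg; [by move=> t /sub01; exact: symp|exact: form_path_restrict om_path|by []].
- exact: path_lsc (path_restrict a0 b1 lam_path) sab.
- exact: path_lsc (path_restrict a0 b1 mu_path) sab.
- by case: (red sab).
- move=> z; have [w [l [m [Vw Nl mm zE]]]] := VNmu (lam_lag s01) sV (red sab) z.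
  by exists w, l, m; split => //; rewrite -(N_def (lam_lag s01) sV).
Qed.

Let symp_at s : s \in `[a, b] -> symplectic (om s).
Proof. by move=> /sub01; exact: symp. Qed.

Let lam_at s : s \in `[a, b] -> lagrangian (om s) (lam s).
Proof. by move=> /sub01; exact: lam_lag. Qed.

Let mu_at s : s \in `[a, b] -> lagrangian (om s) (mu s).
Proof. by move=> /sub01; exact: mu_lag. Qed.

Let N_at s : s \in `[a, b] -> N s = annihilator (om s) V `&` lam s.
Proof. by move=> /lam_at l; exact: N_def. Qed.

Let sW_at s : s \in `[a, b] -> lin_sub (W s).
Proof. by move=> /lam_at/lag_sub sl; exact: lin_sub_sumset. Qed.

Let closedW s : s \in `[a, b] -> closed (W s).
Proof.
move=> sab; have s01 := sub01 sab; rewrite /W.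
rewrite -(ann_N (symp s01).2 (lam_lag s01) (mu_lag s01) (hd s01) (hd' s01) sV hV (red sab)).
exact: closed_ann (symp s01).1.
Qed.

Let be_at s : s \in `[a, b] -> be s = W s `&` annihilator (om s) (be s).
Proof.
move=> sab; have s01 := sub01 sab.
by have := be_lag (symp s01).2 (lam_lag s01) (mu_lag s01) (hd s01) (hd' s01) sV hV (red sab).
Qed.

Let L_at s : s \in `[a, b] -> L s = W s `&` annihilator (om s) (L s).
Proof.
move=> sab; have [C _ reg] := regular_at sab.
by have [adj _ _ _] := at_time_self sab reg; have := twisted_lag (lam_at sab) adj.
Qed.

Let constrained_path (P : R -> set Z) :
  (forall s, s \in `[a, b] -> P s = W s `&` annihilator (om s) (P s)) ->
  (forall s, s \in `[a, b] -> lsc (at_time a b s) P (P s) /\ usc (at_time a b s) P (P s)) ->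
  subspace_path a b P.
Proof.
move=> hP; apply: path_intro => s sab; rewrite hP //; split.
  by apply: lin_subI; [exact: sW_at|exact: lin_sub_ann].
by apply: closedI; [exact: closedW|exact: closed_ann (symp_at sab).1].
Qed.

Let F0 s (sab : s \in `[a, b]) (P : set R) : (\forall t \near at_time a b s, P t) -> P s.
Proof. exact: at_time_self. Qed.

Let om_cvg s : s \in `[a, b] -> form_cvg (at_time a b s) om s.
Proof. by apply: form_path_cvg => //; exact: form_path_restrict om_path. Qed.

Let llam s : s \in `[a, b] -> lsc (at_time a b s) lam (lam s).
Proof. exact: path_lsc (path_restrict a0 b1 lam_path). Qed.

Let ulam s : s \in `[a, b] -> usc (at_time a b s) lam (lam s).
Proof. exact: path_usc (path_restrict a0 b1 lam_path). Qed.

Let lmu s : s \in `[a, b] -> lsc (at_time a b s) mu (mu s).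
Proof. exact: path_lsc (path_restrict a0 b1 mu_path). Qed.

Let umu s : s \in `[a, b] -> usc (at_time a b s) mu (mu s).
Proof. exact: path_usc (path_restrict a0 b1 mu_path). Qed.

Lemma W_path : subspace_path a b W.
Proof.
apply: path_intro => s sab; first by split; [exact: sW_at|exact: closedW].
have [C C0 reg] := regular_at sab.
exact: (coisotropic_semicontinuous (at_time_filter a b s) (F0 sab) (llam sab) (ulam sab) C0 reg).
Qed.

Lemma N_path : subspace_path a b N.
Proof.
apply: path_intro => s sab.
  by split; [exact: lin_sub_ann|exact: closed_ann (symp_at sab).1].
have [C C0 reg] := regular_at sab.
have E : \forall t \near at_time a b s, annihilator (om t) V `&` lam t = N t.
  by apply: inside => // t tab; rewrite N_at.
have [l u] := isotropic_semicontinuous (at_time_filter a b s) (F0 sab) (inside sab lam_at) (om_cvg sab)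
  (llam sab) (ulam sab) C0 reg.
by rewrite (N_at sab); split; [exact: lsc_eq l|exact: usc_eq u].
Qed.

Lemma L_path : subspace_path a b L.
Proof.
apply: constrained_path L_at _ => s sab; have [C C0 reg] := regular_at sab.
split; first exact: (complement_lsc (at_time_filter a b s) (F0 sab) (om_cvg sab) (llam sab) C0 reg).
exact: (complement_usc (at_time_filter a b s) (F0 sab) (om_cvg sab) (ulam sab) C0 reg).
Qed.

Lemma reduction_path : subspace_path a b be.
Proof.
apply: constrained_path be_at _ => s sab; have [C C0 reg] := regular_at sab.
have E : \forall t \near at_time a b s,
    reduction (sumset V (lam t)) (annihilator (om t) V `&` lam t) (mu t) = be t.
  by apply: inside => // t tab; rewrite -N_at.
have rig : \forall t \near at_time a b s, rigid om lam mu v t.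
  apply: inside => // t tab; have t01 := sub01 tab; rewrite /rigid -/V -!(N_at tab).
  split=> [w l m Vw Nl mm|x y bx my Wy]; last first.
    have h := be_iso (lam_at tab) (mu_at tab) sV; exact: h bx (muW_be _ my Wy).
  have h := VNmu_be (symp t01).2 (lam_lag t01) (mu_lag t01) (hd t01) (hd' t01) sV hV (red tab).
  exact: h Vw Nl mm.
have [l u] := reduction_semicontinuous (at_time_filter a b s) (F0 sab) (inside sab lam_at)
  (inside sab mu_at) (om_cvg sab) (llam sab) (lmu sab) (ulam sab) (umu sab) C0 reg rig.
rewrite /be (N_at sab); split; [exact: lsc_eq l|exact: usc_eq u].
Qed.

(** The twisted complement serves on the whole piece, so the trivial partition is enough. *)
Lemma maslov_fd_exists : exists c, is_maslov_fd neg a b om W N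
  (fun s => reduction (W s) (N s) (lam s)) be c.
Proof.
have N_W s : s \in `[a, b] -> N s `<=` W s.
  by move=> sab; rewrite (N_at sab) => x [_ lx]; apply: sumset_r.
have al_at s : s \in `[a, b] -> reduction (W s) (N s) (lam s) = lam s.
  by move=> sab; exact: reduction_lam (lam_at sab) sV.
pose t (i : nat) := if i is 0%N then a else b.
pose Lk (i : nat) := L.
eexists; split; [| | |exists 1%N, t, Lk; split].
- split; [exact: form_path_restrict om_path|exact: W_path|exact: N_path|].
  move=> s sab; split; [exact: N_W|exact: findim_WN (lam_at sab) sV hV (red sab)|].
  by rewrite -/(N s); apply/seteqP; split => [x []//|x Nx]; split => //; exact: N_W.
- split.
    apply: path_intro => s sab; rewrite (al_at _ sab).
      exact: path_sub (path_restrict a0 b1 lam_path) sab.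
    have E : \forall t \near at_time a b s, lam t = reduction (W t) (N t) (lam t).
      by apply: inside => // r rab; rewrite al_at.
    by split; [apply: lsc_eq (llam sab)|apply: usc_eq (ulam sab)].
  move=> s sab; rewrite (al_at _ sab); split.
  + by rewrite (N_at sab) => x [].
  + by move=> x lx; apply: sumset_r.
  + apply/seteqP; split => [x lx|x [_ hx]]; last exact: lag_in (lam_at sab) hx.
    by split; [exact: sumset_r|move=> y ly; exact: lag_om (lam_at sab) lx ly].
- split; first exact: reduction_path.
  move=> s sab; split; [|exact: be_W (lam_at sab) sV|exact: be_at].
  by apply: sumset_r; apply: lin_subI; [exact: lag_sub (mu_at sab)|exact: sW_at].
- by split => // -[|k].
- case=> // _; split.
    split; first exact: L_path.
    move=> s sab; rewrite /Lk (N_at sab); split; [exact: twisted_ann|exact: twisted_sum|exact: L_at].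
  move=> s sab; rewrite /Lk (al_at _ sab) (N_at sab).
  have [Vl _ _] := red sab; split; first exact: twisted_lam (lam_at sab) Vl.
  have smu := lag_sub (mu_at sab).
  have sL : lin_sub (L s) by rewrite (L_at sab); apply: lin_subI; [exact: sW_at|exact: lin_sub_ann].
  have LmuE : L s `&` mu s = [set 0].
    apply/seteqP; split; first exact: Lmu.
    by move=> x ->; split; exact: sub0.
  have := twisted_reduction (lam_at sab) smu sL LmuE.
  by rewrite /be (N_at sab).
- by [].
Qed.

End Piece.

(** [V] is spanned by a basis of [Z] modulo [lam + mu] at [tau]; [tau] is then the time required by
    the definition at which [V] is a complement. *)
Lemma maslov_local tau : tau \in `[0, 1] -> exists2 e : R, 0 < e & forall x y,
  0 <= x -> x <= tau -> tau <= y -> y <= 1 -> x < y -> tau - e < x -> y < tau + e ->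
  exists m, is_maslov neg x y om lam mu m.
Proof.
move=> t01; have [v [sv iv]] := (has_dim_modP _ _ _).1 (hd' t01).
have iv0 : indep_mod [set 0] v.
  move=> c h; apply: iv; rewrite h.
  by apply: sub0; apply: lin_sub_sumset; apply: lag_sub; [exact: lam_lag|exact: mu_lag].
have ins (P : set R) : (forall s, s \in `[0, 1] -> P s) -> \forall s \near at_time 0 1 tau, P s.
  by move=> h; apply: filterS (at_time_in 0 1 tau) => s; exact: h.
have F0 (P : set R) : (\forall s \near at_time 0 1 tau, P s) -> P tau by exact: at_time_self.
have dir := span_direct F0 (ins _ lam_lag) (ins _ mu_lag) sv iv.
have := reducing_near (at_time_filter 0 1 tau) F0 (ins _ symp) (ins _ lam_lag) (ins _ mu_lag)
  (form_path_cvg symp om_path t01) (path_lsc lam_path t01) (path_lsc mu_path t01)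
  (path_usc lam_path t01) (path_usc mu_path t01) (hd t01) (hd' t01) sv iv.
move=> /at_time_delta[e e0 he]; exists e => // x y x0 xt ty y1 xy ex ye.
have near s : s \in `[x, y] -> s \in `[0, 1] /\ `|s - tau| < e.
  rewrite !in_itv /= => /andP[xs sy]; split; first by rewrite (le_trans x0) // (le_trans sy).
  rewrite ltr_norml ltrBlDl (le_lt_trans sy ye) andbT ltrBrDl.
  exact: lt_le_trans ex xs.
have [c hc] := maslov_fd_exists xy x0 y1 iv0 (fun s h => (he s (near s h).1 (near s h).2).1)
  (fun s h => (he s (near s h).1 (near s h).2).2).
exists c; apply: (maslov_single (V := fspan v) xy); split.
- by apply/lin_subP; exact: lin_sub_fspan.
- by exists (d tau); exact: fspan_dim.
- by exists tau => //; rewrite in_itv /= xt.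
- by move=> s /near[s01 /(he s s01)[]].
- exact: hc.
Qed.

Lemma maslov_exists : exists m, is_maslov neg 0 1 om lam mu m.
Proof.
apply: (@cousin R 0 1 (fun x y => exists m, is_maslov neg x y om lam mu m) ltr01).
  by move=> x y z _ _ _ _ [m1 h1] [m2 h2]; exists (m1 + m2); exact: maslov_concat h1 h2.
by move=> s s01; apply: maslov_local; rewrite in_itv.
Qed.

End Existence.

Theorem theorem1p2 (R : realType) (Z : completeNormedModType R[i])
  (om : R -> {hermitian Z for true & @Num.conj R[i]})
  (X Y lam mu : R -> set Z)
  (om_symplectic : forall s : R, s \in `[0, 1] -> symplectic (om s))
  (om_path : form_path 0 1 om)
  (X_path : subspace_path 0 1 X)
  (Y_path : subspace_path 0 1 Y)
  (XY_sum : forall s : R, s \in `[0, 1] -> direct_sum (X s) (Y s))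
  (X_lag : forall s : R, s \in `[0, 1] -> lagrangian (om s) (X s))
  (Y_lag : forall s : R, s \in `[0, 1] -> lagrangian (om s) (Y s))
  (lam_path : subspace_path 0 1 lam)
  (mu_path : subspace_path 0 1 mu)
  (lam_lag : forall s : R, s \in `[0, 1] -> lagrangian (om s) (lam s))
  (mu_lag : forall s : R, s \in `[0, 1] -> lagrangian (om s) (mu s))
  (lam_mu_fredholm : forall s : R, s \in `[0, 1] -> fredholm_pair (lam s) (mu s))
  (lam_mu_index : forall s : R, s \in `[0, 1] -> fredholm_index (lam s) (mu s) = 0) :
  let A := fun s => lam s `&` Y s in
  let B := fun s => mu s `&` Y s in
  let D := fun s => rel_dom (X s) (Y s) (lam s) `&` rel_dom (X s) (Y s) (mu s) in
  let Q := fun s => rel_form (om s) (Y s) (lam s) (mu s) in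
  subspace_path 0 1 A ->
  subspace_path 0 1 B ->
  (forall s : R, s \in `[0, 1] -> findim_mod (Y s) (sumset (A s) (B s))) ->
  [/\ forall m : int, is_maslov_plus 0 1 om lam mu m <->
        m = (sdim (lam 0 `&` mu 0 `&` Y 0))%:Z - (sdim (lam 1 `&` mu 1 `&` Y 1))%:Z
            + (morse false (D 1) (Q 1))%:Z - (morse false (D 0) (Q 0))%:Z,
      forall m : int, is_maslov_minus 0 1 om lam mu m <->
        m = - (sdim (lam 0 `&` mu 0 `&` Y 0))%:Z + (sdim (lam 1 `&` mu 1 `&` Y 1))%:Z
            - (morse true (D 1) (Q 1))%:Z + (morse true (D 0) (Q 0))%:Z
    & forall s : R, s \in `[0, 1] ->
        sdim (lam s `&` mu s) = (sdim (form_ker (D s) (Q s)) + sdim (A s `&` B s))%N].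
Proof.
move=> A B D Q A_path B_path AB_findim.
pose d s := sdim (lam s `&` mu s).
pose j s := sdim (A s `&` B s).
pose k s := dim_mod (Y s) (sumset (A s) (B s)).
have dims s : s \in `[0, 1] -> has_dim_mod (lam s `&` mu s) [set 0] (d s) /\
    has_dim_mod [set: Z] (sumset (lam s) (mu s)) (d s).
  move=> s01; have slam := lag_sub (lam_lag s s01); have smu := lag_sub (mu_lag s s01).
  have [[n1 h1] [n2 h2]] := lam_mu_fredholm s s01.
  (* Index 0 lets the single number [d s] be both the dimension of the intersection and the
     codimension of the sum. *)
  have := lam_mu_index s s01; rewrite /fredholm_index /d /sdim.
  rewrite (dim_modE (@lin_sub0 _ Z) h1) (dim_modE (lin_sub_sumset slam smu) h2).
  by move=> /eqP; rewrite subr_eq0 => /eqP[E]; split => //; rewrite E.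
have mom s : s \in `[0, 1] -> moment (om s) (X s) (Y s) (lam s) (mu s) (d s) (j s) (k s).
  move=> s01; have [hd hd'] := dims s s01.
  have slam := lag_sub (lam_lag s s01); have smu := lag_sub (mu_lag s s01).
  have sY := lag_sub (Y_lag s s01).
  have sA : lin_sub (A s) by exact: lin_subI.
  have sB : lin_sub (B s) by exact: lin_subI.
  have s0 := @lin_sub0 _ Z.
  have [n _ hj] : exists2 n, (n <= d s)%N & has_dim_mod (A s `&` B s) [set 0] n.
    apply: (dim_sub _ s0 _ hd); first exact: lin_subI.
    by move=> x [[lx _] [mx _]].
  have [m hk] := AB_findim s s01.
  split.
  - by case: (om_symplectic s s01).
  - by split; [exact: X_lag|exact: Y_lag|exact: lam_lag|exact: mu_lag].
  - exact: XY_sum.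
  - by [].
  - by rewrite /j /sdim (dim_modE s0 hj) /k (dim_modE (lin_sub_sumset sA sB) hk).
have jE s : sdim (lam s `&` mu s `&` Y s) = j s.
  rewrite /j; congr (dim_mod _ _); apply/seteqP.
  by split => [x [[lx mx] Yx]|x [[lx Yx] [mx _]]].
have value neg m : is_maslov neg 0 1 om lam mu m <->
    m = (-1) ^+ neg * (((morse neg (D 1) (Q 1))%:Z - (j 1)%:Z) - ((morse neg (D 0) (Q 0))%:Z - (j 0)%:Z)).
  have val := maslov_value mom om_symplectic om_path X_path Y_path lam_path mu_path A_path B_path.
  (* For the converse, some value exists by [maslov_exists], and the direct implication identifies
     it with the formula. *)
  split => [/val//|->].
  have [m' hm'] := maslov_exists neg om_symplectic lam_lag mu_lag (fun s h => (dims s h).1)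
    (fun s h => (dims s h).2) om_path lam_path mu_path.
  by rewrite -[_ * _](val _ _ hm').
rewrite !jE; split.
- move=> m; rewrite /is_maslov_plus value expr0 mul1r; split => ->; ring.
- move=> m; rewrite /is_maslov_minus value expr1 mulN1r; split => ->; ring.
- by move=> s s01; exact: relation_kernel_dim (mom s s01).
Qed.
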